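(* Let $f:X\to\mathbb D(a,b)$ be a finite Galois étale covering with Galois group $G$. For every subgroup $H\subset G$, let $f_H:X/H\to\mathbb D(a,b)$ be the morphism deduced from $f$. Then $$\delta_{f_H}(-\log r)=\mathsf a^\flat_G(\mathbb C[G/H],r^+)\qquad\text{for every } r\in(a,b]\cap\Gamma_K,$$ and the right derivative of $\delta_{f_H}$ satisfies $$\frac{d\delta_{f_H}}{dt}(-\log r^+)=\mathsf{sw}^\natural_G(\mathbb C[G/H],r^+)\qquad\text{for every } r\in(a,b]\cap\Gamma_K .$$
   Context: $(K,|\cdot|)$ is an algebraically closed field, complete for a rank one valuation, with value group $\Gamma_K\subset\mathbb R_{>0}$; $a<b$ in $\Gamma_K$. Spaces are adic spaces in the sense of Huber; $\mathbb D(a,b)$ is the annulus $\{a\le|\xi|\le b\}$. $\mathbb C[G/H]=\mathrm{Ind}_H^G1_H$. For $X=\mathrm{Spa}\,B$, $X/H=\mathrm{Spa}\,B^H$. Discriminant function. For $g:Y\to\mathbb D(a,b)$ finite, flat, generically étale of degree $d$ and $r\in[a,b]\cap\Gamma_K$, let $\eta(r)^\flat$ be the point given by the Gauss valuation $\sum a_i\xi^i\mapsto\max|a_i|r^i$, with valuation ring $\kappa(r^\flat)^+$ of its residue field. The stalk $(g_*\mathcal O_Y^+)_{\eta(r)^\flat}$ is a free $\kappa(r^\flat)^+$-module of rank $d$; let $\mathfrak d^\flat_g(r)$ be the discriminant of its trace form (well defined up to squares of units), and $\delta_g(-\log r)=-\log|\mathfrak d_g^\flat(r)|_{\eta(r)^\flat}$.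 (It extends to a continuous piecewise linear function on $[\log1/b,\log1/a]$.) Conductors. Let $\varepsilon$ be a positive infinitesimal; the group $\Gamma_K\times(1-\varepsilon)^{\mathbb Q}$ is ordered lexicographically with $\Gamma_K$ dominant and $1-\varepsilon<1$, and its elements are written $\gamma=\gamma^\flat(1-\varepsilon)^{\gamma^\natural}$ with $\gamma^\flat\in\Gamma_K$, $\gamma^\natural\in\mathbb Q$. For $r\in(a,b]\cap\Gamma_K$, $\eta(r)\in\mathbb D(a,b)$ is the point given by $\sum a_i\xi^i\mapsto\max|a_i|r^i(1-\varepsilon)^i$. Pick $x\in f^{-1}(\eta(r))$ and let $St_x\subset G$ be its stabilizer, of order $o(St_x)$, which is the Galois group of $\kappa(x)^{\wedge h}$ over $\kappa(\eta(r))^{\wedge h}$ (henselizations of completions of residue fields). The value group $\Gamma_x$ of $x$ lies in $\Gamma_K\times(1-\varepsilon)^{\mathbb Q}$; for $\sigma\in St_x$, $i_x(\sigma)=|t-\sigma(t)|_x$ for any $t\in\kappa(x)^{\wedge h}$ such that $|t|_x$ is the largest element $<1$ of $\Gamma_x$ (independent of $t$). Put $\mathsf a_x(\sigma)=i_x(\sigma)^{-1}$ for $\sigma\ne1$, $\mathsf a_x(1)=\prod_{\tau\ne1}i_x(\tau)$, and define class functions on $St_x$: $$\mathsf a_x^\natural(\sigma)=o(St_x)\,\mathsf a_x(\sigma)^\natural,\quad \mathsf a_x^\flat(\sigma)=-o(St_x)\log\mathsf a_x(\sigma)^\flat,\quad \mathsf{sw}_x^\natural=\mathsf a_x^\natural-(\mathrm{reg}_{St_x}-1_{St_x}),$$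 with $\mathrm{reg}$ the regular character. Set $\mathsf a_G^\flat(r^+)=\mathrm{Ind}_{St_x}^G\mathsf a_x^\flat$, $\mathsf{sw}_G^\natural(r^+)=\mathrm{Ind}_{St_x}^G\mathsf{sw}_x^\natural$ (independent of $x$), and for $\chi\in K_0(\mathbb C[G])$, $\mathsf a_G^\flat(\chi,r^+)=\langle\mathsf a^\flat_G(r^+),\chi\rangle_G$, $\mathsf{sw}_G^\natural(\chi,r^+)=\langle\mathsf{sw}^\natural_G(r^+),\chi\rangle_G$, the usual scalar product of class functions. *)

(* Defs.v *)
From HB Require Import structures.
From mathcomp Require Import all_boot all_order all_algebra all_fingroup.
From mathcomp Require Import all_classical all_reals all_analysis.

Set Implicit Arguments.
Unset Strict Implicit.
Unset Printing Implicit Defensive.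

Import Order.TTheory GRing.Theory Num.Theory.
Import numFieldNormedType.Exports.
Local Open Scope classical_set_scope.
Local Open Scope ring_scope.

Section AbsoluteValue.
Variables (R : realType) (K : fieldType) (absK : K -> R).

Record is_nonarch_abs : Prop := IsNonarchAbs {
  abs_ge0 : forall x, 0 <= absK x ;
  abs_eq0 : forall x, absK x = 0 -> x = 0 ;
  abs_zero : absK 0 = 0 ;
  abs_one : absK 1 = 1 ;
  abs_mul : forall x y, absK (x * y) = absK x * absK y ;
  abs_add : forall x y, absK (x + y) <= Num.max (absK x) (absK y)
}.

Definition abs_complete : Prop :=
  forall u : nat -> K,
    (forall e : R, 0 < e -> exists N, forall m n,
       (N <= m)%N -> (N <= n)%N -> absK (u m - u n) < e) ->
    exists l, (fun n => absK (u n - l)) @ \oo --> (0 : R).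

(* "Complete for a rank one valuation". *)
Record is_complete_rank1 : Prop := IsCompleteRank1 {
  rank1_abs : is_nonarch_abs ;
  rank1_nontrivial : exists2 x : K, x != 0 & absK x != 1 ;
  rank1_complete : abs_complete
}.

(* Gamma_K *)
Definition value_group : set R := [set absK x | x in [set x : K | x != 0]].

End AbsoluteValue.

(* The values 0 (None) and gamma = p (1 - eps)^q (Some (p, q)), ordered
   lexicographically; since 1 - eps < 1, at equal p the larger exponent gives
   the smaller element. Whether p lies in Gamma_K is part of is_valuation. *)
Definition val2 (R : realType) : Type := option (R * rat).

Section Val2.
Variable R : realType.
Implicit Types u v : val2 R.

Definition vle u v : bool :=
  match u, v with
  | None, _ => true
  | Some _, None => false
  | Some (p, m), Some (q, n) => (p < q) || (p == q) && (n <= m)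
  end.

Definition vlt u v : bool := ~~ vle v u.

Definition vone : val2 R := Some (1, 0).

Definition vmul u v : val2 R :=
  match u, v with
  | Some (p, m), Some (q, n) => Some (p * q, m + n)
  | _, _ => None
  end.

Definition vinv u : val2 R :=
  if u is Some (p, m) then Some (p^-1, - m) else None.

Definition vflat u : R := if u is Some (p, _) then p else 0.
Definition vnat u : rat := if u is Some (_, m) then m else 0.

Definition is_vmax (S : set (val2 R)) v : Prop :=
  S v /\ forall u, S u -> vle u v.
Definition vmax (S : set (val2 R)) : val2 R := xget None (is_vmax S).

End Val2.

Section Valuation.
Variables (R : realType) (K : fieldType) (absK : K -> R).

Record is_valuation (D : nzRingType) (v : D -> val2 R) : Prop := IsValuation {
  val_zero : v 0 = None ;
  val_one : v 1 = vone R ;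
  val_mul : forall x y, v (x * y) = vmul (v x) (v y) ;
  val_add : forall x y, vle (v (x + y)) (v x) || vle (v (x + y)) (v y) ;
  val_group : forall x p q, v x = Some (p, q) -> value_group absK p
}.

Record is_field_valuation (F : fieldType) (v : F -> val2 R) : Prop :=
  IsFieldValuation {
    fval_val : is_valuation v ;
    fval_eq0 : forall x, v x = None -> x = 0
  }.

(* Sequences suffice: the powers of an element of Gamma_K smaller than 1 are
   coinitial in Gamma_K x (1 - eps)^Q. *)
Definition val_complete (F : fieldType) (v : F -> val2 R) : Prop :=
  forall u : nat -> F,
    (forall e : R, 0 < e -> exists N, forall m n,
       (N <= m)%N -> (N <= n)%N -> vlt (v (u m - u n)) (Some (e, 0))) ->
    exists l, forall e : R, 0 < e -> exists N, forall n,
       (N <= n)%N -> vlt (v (u n - l)) (Some (e, 0)).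

Definition henselian (F : fieldType) (v : F -> val2 R) : Prop :=
  forall (p : {poly F}) (z : F),
    p \is monic -> (forall i, vle (v p`_i) (vone R)) -> vle (v z) (vone R) ->
    vlt (v p.[z]) (vone R) -> v (p^`()).[z] = vone R ->
    exists2 y, root p y & vlt (v (y - z)) (vone R).

(* Universal property among the henselian extensions with value group in
   Gamma_K x (1 - eps)^Q; the henselization of F is itself one of these, since
   it has the same value group as F. *)
Record is_henselization (F E : fieldType) (v : F -> val2 R) (w : E -> val2 R)
    (i : {rmorphism F -> E}) : Prop := IsHenselization {
  hens_val : is_field_valuation w ;
  hens_ext : forall z, w (i z) = v z ;
  hens_hens : henselian w ;
  hens_univ : forall (L : fieldType) (u : L -> val2 R) (j : {rmorphism F -> L}),
    is_field_valuation u -> (forall z, u (j z) = v z) -> henselian u ->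
    exists phi : {rmorphism E -> L},
      [/\ forall z, phi (i z) = j z,
          forall z, u (phi z) = w z
        & forall psi : {rmorphism E -> L},
            (forall z, psi (i z) = j z) -> (forall z, u (psi z) = w z) ->
            psi =1 phi]
}.

(* (F, v) is the completion of the residue field kappa(x) at the point x of
   Spa B, i.e. the completion of the fraction field of B / supp x. *)
Record is_completed_residue_field (B : comNzRingType) (x : B -> val2 R)
    (F : fieldType) (v : F -> val2 R) (i : {rmorphism B -> F}) : Prop :=
  IsCompletedResidueField {
    crf_val : is_field_valuation v ;
    crf_ext : forall c, v (i c) = x c ;
    crf_complete : val_complete v ;
    crf_dense : forall (z : F) (e : R), 0 < e -> exists c d : B,
      x d != None /\ vlt (v (z - i c / i d)) (Some (e, 0))
  }.

(* (E, w) is kappa(x)^{wedge h}. *)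
Definition is_completed_henselization (B : comNzRingType) (x : B -> val2 R)
    (E : fieldType) (w : E -> val2 R) (iota : {rmorphism B -> E}) : Prop :=
  exists (F : fieldType) (v : F -> val2 R)
         (i : {rmorphism B -> F}) (j : {rmorphism F -> E}),
    [/\ is_completed_residue_field x v i, is_henselization v w j
      & forall c, iota c = j (i c)].

(* Gamma_x *)
Definition point_value_group (B : comNzRingType) (x : B -> val2 R) :
    set (val2 R) :=
  [set g | exists c d, [/\ x c != None, x d != None
                         & g = vmul (x c) (vinv (x d))]].

End Valuation.

Section Annulus.
Variables (R : realType) (K : closedFieldType) (absK : K -> R) (a b : R).

(* A, with coefficient map coef, is the ring of functions on D(a,b): the Laurent
   series sum_n a_n xi^n over K that converge for a <= |xi| <= b. The last
   axiom is the Cauchy product. *)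
Record is_annulus_algebra (A : comAlgType K) (coef : A -> int -> K) : Prop :=
  IsAnnulusAlgebra {
    ann_linear : forall (k : K) (f g : A) (n : int),
      coef (k *: f + g) n = k * coef f n + coef g n ;
    ann_inj : forall f g, coef f =1 coef g -> f = g ;
    ann_range : forall u : int -> K,
      (exists f, coef f =1 u) <->
      (fun n : nat => absK (u n%:Z) * b ^+ n) @ \oo --> (0 : R) /\
      (fun n : nat => absK (u (- n%:Z)) * a ^- n) @ \oo --> (0 : R) ;
    ann_one : forall n, coef 1 n = (n == 0)%:R ;
    ann_mul : forall (f g : A) (n : int),
      (fun N : nat => absK (coef (f * g) n -
         \sum_(i < (N.*2).+1) coef f (i%:Z - N%:Z) * coef g (n - (i%:Z - N%:Z))))
        @ \oo --> (0 : R)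
  }.

Variables (A : comAlgType K) (coef : A -> int -> K).

(* eta(r)^flat *)
Definition gauss (r : R) (f : A) : R :=
  sup (range (fun i : int => absK (coef f i) * r ^ i)).

Definition eta (r : R) (f : A) : val2 R :=
  vmax (range (fun i : int =>
    if coef f i == 0 then None else Some (absK (coef f i) * r ^ i, i%:~R))).

Definition power_bounded (f : A) : Prop := gauss a f <= 1 /\ gauss b f <= 1.

(* The rational subset |t| <= |s| <> 0 (t in T), where T generates the unit
   ideal, is a neighbourhood of eta(r)^flat. *)
Definition rational_nbhd (r : R) (T : seq A) (s : A) : Prop :=
  [/\ exists h : nat -> A, \sum_(i < size T) h i * T`_i = 1,
      forall t, t \in T -> gauss r t <= gauss r s
    & gauss r s != 0].

(* Forms of degree D in the elements of T, with coefficients in A^o. *)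
Inductive form (T : seq A) : nat -> A -> Prop :=
| form_cst u of power_bounded u : form T 0 u
| form_mul D t u of t \in T & form T D u : form T D.+1 (t * u)
| form_add D u v of form T D u & form T D v : form T D (u + v).

(* A pair (c, k) stands for the fraction c / s^k of A[1/s]. The sets
   lambda A^o[T/s], lambda in K^*, are a basis of neighbourhoods of 0 for the
   topology of A[1/s] whose completion is O(U(T/s)). *)
Definition frac_small (T : seq A) (s : A) (lambda : K) (q : A * nat) : Prop :=
  exists D u, form (s :: T) D u /\ s ^+ D * q.1 = lambda *: (s ^+ q.2 * u).

Definition frac_sub (s : A) (q q' : A * nat) : A * nat :=
  (q.1 * s ^+ q'.2 - q'.1 * s ^+ q.2, (q.2 + q'.2)%N).

Definition frac_cauchy (T : seq A) (s : A) (q : nat -> A * nat) : Prop :=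
  forall lambda : K, lambda != 0 -> exists N, forall m n,
    (N <= m)%N -> (N <= n)%N -> frac_small T s lambda (frac_sub s (q m) (q n)).

(* (kap, nu) is kappa(r^flat), the residue field of O_{D(a,b), eta(r)^flat}: its
   elements are exactly the values at eta(r)^flat of the sections of O over the
   rational neighbourhoods of eta(r)^flat. *)
Record is_stalk_residue_field (r : R) (kap : fieldType) (nu : kap -> R)
    (iota : {rmorphism A -> kap}) : Prop := IsStalkResidueField {
  srf_abs : is_nonarch_abs nu ;
  srf_ext : forall f, nu (iota f) = gauss r f ;
  srf_germ : forall T s (q : nat -> A * nat),
    rational_nbhd r T s -> frac_cauchy T s q ->
    exists z, (fun n => nu (z - iota (q n).1 / iota s ^+ (q n).2))
                @ \oo --> (0 : R) ;
  srf_surj : forall z, exists T s (q : nat -> A * nat),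
    [/\ rational_nbhd r T s, frac_cauchy T s q
      & (fun n => nu (z - iota (q n).1 / iota s ^+ (q n).2)) @ \oo --> (0 : R)]
}.

(* L = kap (x)_A C *)
Record is_base_change (C : comAlgType A) (kap : fieldType)
    (iota : {rmorphism A -> kap}) (L : comAlgType kap)
    (j : {rmorphism C -> L}) : Prop := IsBaseChange {
  bc_comm : forall f, j f%:A = (iota f)%:A ;
  bc_univ : forall (T : comAlgType kap) (phi : {rmorphism C -> T}),
    (forall f, phi f%:A = (iota f)%:A) ->
    exists psi : {lrmorphism L -> T},
      (forall c, psi (j c) = phi c) /\
      forall psi' : {lrmorphism L -> T},
        (forall c, psi' (j c) = phi c) -> psi' =1 psi
}.

End Annulus.

Section Discriminant.
Variables (R : realType) (kap : fieldType) (nu : kap -> R).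
Variable L : comAlgType kap.

(* Integrality over the valuation ring kap^+ = {nu <= 1}. *)
Definition integral_over_plus (z : L) : Prop :=
  exists p : {poly kap},
    [/\ p \is monic, forall i, nu p`_i <= 1 & root (map_poly (in_alg L) p) z].

Definition is_plus_basis d (e : 'I_d -> L) : Prop :=
  (forall i, integral_over_plus (e i)) /\
  forall z, integral_over_plus z ->
    exists! c : 'rV[kap]_d,
      (forall i, nu (c 0 i) <= 1) /\ z = \sum_i c 0 i *: e i.

(* M is the matrix of multiplication by z in the basis e. *)
Definition is_mult_mx d (e : 'I_d -> L) (z : L) (M : 'M[kap]_d) : Prop :=
  forall k, z * e k = \sum_l M l k *: e l.

Definition is_trace_form_mx d (e : 'I_d -> L) (T : 'M[kap]_d) : Prop :=
  forall i j, exists2 M, is_mult_mx e (e i * e j) M & T i j = \tr M.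

End Discriminant.

Section DiscriminantFunction.
Variables (R : realType) (K : closedFieldType) (absK : K -> R) (a b : R).
Variables (A : comAlgType K) (coef : A -> int -> K) (C : comAlgType A).

(* v = - log |d^flat_g(r)| for g : Spa C -> D(a,b). As g is finite, the stalk of
   g_* O at eta(r)^flat is kappa(r^flat) (x)_A C, and the stalk of g_* O^+ is the
   integral closure of kappa(r^flat)^+ in it. *)
Definition is_log_discriminant (r v : R) : Prop :=
  exists (kap : fieldType) (nu : kap -> R) (iota : {rmorphism A -> kap})
         (L : comAlgType kap) (j : {rmorphism C -> L})
         (d : nat) (e : 'I_d -> L) (T : 'M[kap]_d),
    [/\ is_stalk_residue_field absK a b coef r nu iota,
        is_base_change iota j, is_plus_basis nu e, is_trace_form_mx e T
      & v = - ln (nu (\det T))].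

(* delta is affine on the closed intervals of a subdivision of [u, v]; in
   particular it is continuous on [u, v]. *)
Definition piecewise_linear (u v : R) (delta : R -> R) : Prop :=
  exists s : seq R,
    [/\ path <%R u s, last u s = v
      & forall i, (i < size s)%N -> exists m c : R,
          forall t, nth u (u :: s) i <= t <= nth u (u :: s) i.+1 ->
            delta t = m * t + c].

(* delta = delta_g on [log 1/b, log 1/a]. Gamma_K being dense in the positive
   reals, these conditions determine delta on that interval. *)
Definition is_discriminant_function (delta : R -> R) : Prop :=
  piecewise_linear (ln b^-1) (ln a^-1) delta /\
  forall r, value_group absK r -> a <= r <= b ->
    is_log_discriminant r (delta (- ln r)).

Definition has_right_derivative (delta : R -> R) (t l : R) : Prop :=
  (fun h : R => (delta (t + h) - delta t) / h) @ 0^'+ --> l.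

End DiscriminantFunction.

Section Galois.
Variables (A : comNzRingType) (B : comAlgType A) (gT : finGroupType).
Variable act : gT -> {lrmorphism B -> B}.

(* Spa B -> Spa A is a finite Galois etale covering with group gT, i.e. B / A is
   a Galois extension of commutative rings: the last axiom, which says that
   B (x)_A B -> prod_s B, u (x) v |-> (u s(v))_s is onto, then implies that this
   map is bijective and that B is a finite etale A-algebra. *)
Record is_galois_cover : Prop := IsGaloisCover {
  gal_act1 : forall c, act 1%g c = c ;
  gal_actM : forall s t c, act (s * t)%g c = act s (act t c) ;
  gal_inj : forall f : A, f%:A = 0 :> B -> f = 0 ;
  gal_inv : forall c, (forall s, act s c = c) -> exists f : A, c = f%:A ;
  gal_etale : exists n (u v : 'I_n -> B),
    forall s, \sum_i u i * act s (v i) = (s == 1%g)%:R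
}.

Variable H : {group gT}.

(* B^H *)
Definition fixed_pred : {pred B} := [pred c | [forall s in H, act s c == c]].

Fact fixed_subalg : subalg_closed fixed_pred.
Proof.
split=> [|k c d|c d].
- by apply/forall_inP => s _; rewrite rmorph1.
- move=> /forall_inP hc /forall_inP hd; apply/forall_inP => s sH.
  by rewrite linearP /= (eqP (hc s sH)) (eqP (hd s sH)).
- move=> /forall_inP hc /forall_inP hd; apply/forall_inP => s sH.
  by rewrite rmorphM /= (eqP (hc s sH)) (eqP (hd s sH)).
Qed.

HB.instance Definition _ := GRing.isSubalgClosed.Build A B fixed_pred fixed_subalg.

Record fixring := Fixring { fixval : B ; _ : fixval \in fixed_pred }.
HB.instance Definition _ := [isSub for fixval].
HB.instance Definition _ := [Choice of fixring by <:].
HB.instance Definition _ := [SubChoice_isSubComNzRing of fixring by <:].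
HB.instance Definition _ := [SubZmodule_isSubLmodule of fixring by <:].
HB.instance Definition _ := [SubNzRing_SubLmodule_isSubLalgebra of fixring by <:].
HB.instance Definition _ := [SubLalgebra_isSubAlgebra of fixring by <:].

End Galois.

(* All class functions below are real valued, so that the usual hermitian scalar
   product involves no conjugation. *)
Section ClassFunctions.
Variables (R : realType) (gT : finGroupType).

Definition cind (S : {set gT}) (phi : gT -> R) (g : gT) : R :=
  #|S|%:R^-1 *
  \sum_(y : gT | (y^-1 * g * y)%g \in S) phi (y^-1 * g * y)%g.

Definition cdot (phi psi : gT -> R) : R :=
  #|gT|%:R^-1 * \sum_(g : gT) phi g * psi g.

(* The character of C[G/H] = Ind_H^G 1_H. *)
Definition perm_char (H : {set gT}) : gT -> R := cind H (fun=> 1).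

Definition reg_char (S : {set gT}) (s : gT) : R :=
  if s == 1%g then #|S|%:R else 0.

End ClassFunctions.

Section Conductors.
Variables (R : realType) (K : closedFieldType) (absK : K -> R).
Variables (A : comAlgType K) (coef : A -> int -> K) (B : comAlgType A).
Variables (gT : finGroupType) (act : gT -> {lrmorphism B -> B}).

(* x is a point of f^{-1}(eta(r)), normalized so as to extend eta(r) on the
   nose. Continuity of x, and x <= 1 on B^+ (the integral closure of A^o in B),
   follow from the same properties of eta(r) since B is finite over A. *)
Definition is_point_over (r : R) (x : B -> val2 R) : Prop :=
  is_valuation absK x /\ forall f : A, x f%:A = eta absK coef r f.

Variable x : B -> val2 R.

Definition stabilizer : {set gT} := [set s | `[< forall c, x (act s c) = x c >]].

(* actE is the action of St_x on (E, w) = kappa(x)^{wedge h}. *)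
Definition is_stabilizer_action (E : fieldType) (w : E -> val2 R)
    (iota : {rmorphism B -> E}) (actE : gT -> {rmorphism E -> E}) : Prop :=
  forall s, s \in stabilizer ->
    (forall c, actE s (iota c) = iota (act s c)) /\
    (forall z, w (actE s z) = w z).

Definition is_uniformizer (E : fieldType) (w : E -> val2 R) (t : E) : Prop :=
  is_vmax [set g | point_value_group x g /\ vlt g (vone R)] (w t).

Definition is_ramification_function (E : fieldType) (w : E -> val2 R)
    (actE : gT -> {rmorphism E -> E}) (ix : gT -> val2 R) : Prop :=
  forall s, s \in stabilizer ->
    forall t, is_uniformizer w t -> ix s = w (t - actE s t).

Variable ix : gT -> val2 R.

Definition a_x (s : gT) : val2 R :=
  if s == 1%g then \big[@vmul R/vone R]_(t in stabilizer | t != 1%g) ix t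
  else vinv (ix s).

Definition a_nat_x (s : gT) : R := #|stabilizer|%:R * ratr (vnat (a_x s)).
Definition a_flat_x (s : gT) : R := - (#|stabilizer|%:R * ln (vflat (a_x s))).
Definition sw_nat_x (s : gT) : R := a_nat_x s - (reg_char R stabilizer s - 1).

Definition a_flat_G : gT -> R := cind stabilizer a_flat_x.
Definition sw_nat_G : gT -> R := cind stabilizer sw_nat_x.

End Conductors.

(* Main.v *)
(* Write E for the henselized completion, with valuation w, and phi_g = iota o g
   for g in G.  The points of X/H over eta(r) are the valuations w o phi_g on B^H,
   and the flat parts of their values lie in |K^*|, the natural parts in (1/e)Z.

   Stability of eta(r): the ramification indices e at the points of X/H add up to
   deg f_H.  Take the functions xi^l b_i with |l| <= m and b a basis of B^H over
   Frac A.  Leja points turn them into a family that is orthonormal for the sup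
   norm over |xi| = r.  The characteristic polynomials confine the natural parts
   of the values of functions of sup norm 1 to an interval of length 2m + O(1), so
   Gauss elimination at each point bounds the number of functions by
   2m (sum of the e) + O(1), while there are about 2m deg f_H of them.

   Hence B^H has a family orthogonal for the largest of the w o phi_g, one member
   of value (1, q/e) for each point and each 0 <= q < e.  It spans the same lattice
   of integral elements as the powers of an element theta that has distinct residues
   at the points and is, up to these residues, a uniformizer at each of them.  So its
   discriminant is the Vandermonde one of theta, a product over pairs of embeddings
   that Serre's formula (Local Fields, IV, Prop. 3) rewrites with the i_x(sigma).

   Orthogonality and the strict inequalities behind it persist at radii r' < r
   close to r.  Rescaling the same family by constants then gives a basis of the
   integral stalk at r', so delta is affine just to the right of -log r with the
   slope and intercept read off w(det)^2, and continuity gives the value at r.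
   Frobenius reciprocity identifies these numbers with the two scalar products. *)
Require Import Defs.
From HB Require Import structures.
From mathcomp Require Import all_boot all_order all_algebra all_fingroup.
From mathcomp Require Import all_classical all_reals all_analysis.
From mathcomp Require Import zify ring lra.
Set Implicit Arguments.
Unset Strict Implicit.
Unset Printing Implicit Defensive.
Import Order.TTheory GRing.Theory Num.Theory.
Import numFieldNormedType.Exports.
Local Open Scope classical_set_scope.
Local Open Scope ring_scope.

(** One device carries most estimates: [chi c] has coefficients in [A] and the conjugates of [c] as
    roots, and ultrametric root bounds pass between coefficients and conjugates, be it for [w], for
    its flat part or at [K]-points. The same equation shows that residues of [B] lie in the
    algebraically closed residue field of [K], and that the power of exponent [#|gT|!] of a nonzero
    value is the value of a monomial. Functions with prescribed behaviour at the points are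
    therefore built inside [B] from constants, monomials and approximate inverses. A value [(p, q)]
    stands for the germ of [p t ^ q] as [t] tends to 1 from below, so finitely many inequalities at
    eta(r) persist nearby. The difficulty at a nearby radius is that integrality there is governed
    by a spectral norm, and power-multiplicativity of the norm given by a basis is not a finite
    condition. It is drawn from the multiplicativity of [w] at eta(r): an element is replaced by its
    leading terms, whose norms at the two radii differ by known powers of [t]. *)

(** * The ordered monoid of values *)

Section Val2Order.
Variable R : realType.
Implicit Types u v t : val2 R.

HB.instance Definition _ := Choice.copy (val2 R) (option (R * rat)).

Fact vle_anti : antisymmetric (@vle R).
Proof.
case=> [[p m]|] [[q n]|] //= /andP[].
case: (ltgtP p q) => //= -> h1 h2; congr (Some (_, _)).
by apply/eqP; rewrite eq_le h1 h2.
Qed.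

Fact vle_trans : transitive (@vle R).
Proof.
case=> [[p m]|] [[q n]|] [[k l]|] //=.
move=> /orP[h|/andP[/eqP-> h]] /orP[h'|/andP[/eqP<- h']].
- by rewrite (lt_trans h h').
- by rewrite h.
- by rewrite h'.
- by rewrite eqxx (le_trans h' h) orbT.
Qed.

Fact vle_total : total (@vle R).
Proof.
by case=> [[p m]|] [[q n]|] //=; case: (ltgtP p q) => //= _; rewrite le_total.
Qed.

Fact vle_refl : reflexive (@vle R).
Proof. by move=> u; have := vle_total u u; rewrite orbb. Qed.

Fact val2_display : Order.disp_t. Proof. exact: (Order.Disp tt tt). Qed.
HB.instance Definition _ :=
  Order.Le_isPOrder.Build val2_display (val2 R) vle_refl vle_anti vle_trans.
HB.instance Definition _ :=
  Order.POrder_isTotal.Build val2_display (val2 R) vle_total.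

Lemma vleE u v : vle u v = (u <= v)%O. Proof. by []. Qed.
Lemma vltE u v : vlt u v = (u < v)%O. Proof. by rewrite ltNge. Qed.

Lemma vle_some (p q : R) (m n : rat) :
  ((Some (p, m) : val2 R) <= Some (q, n))%O = (p < q) || (p == q) && (n <= m).
Proof. by []. Qed.

Lemma vlt_some (p q : R) (m n : rat) :
  ((Some (p, m) : val2 R) < Some (q, n))%O = (p < q) || (p == q) && (n < m).
Proof.
rewrite ltNge vle_some negb_or negb_and -leNgt -ltNge.
by case: (ltgtP p q); rewrite ?orbF ?orbT.
Qed.

Lemma vle_none v : ((None : val2 R) <= v)%O. Proof. by []. Qed.
Lemma vle_Nnone v : (v <= (None : val2 R))%O = (v == None).
Proof. case: v => [[p m]|]; reflexivity. Qed.
Lemma vlt_none v : ((None : val2 R) < v)%O = (v != None).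
Proof. by rewrite ltNge vle_Nnone. Qed.

(** The type [val2 R] contains [Some (p, m)] with [p <= 0], for which multiplication is not
    monotone. The values of a valuation satisfy [vpos] because [val_group] puts [p] into the value
    group. *)
Definition vpos v := if v is Some (p, _) then 0 < p else true.

Lemma vmulA : associative (@vmul R).
Proof. by case=> [[p m]|] [[q n]|] [[k l]|] //=; rewrite mulrA addrA. Qed.
Lemma vmulC : commutative (@vmul R).
Proof. by case=> [[p m]|] [[q n]|] //=; rewrite mulrC addrC. Qed.
Lemma vmul1 : left_id (vone R) (@vmul R).
Proof. by case=> [[p m]|] //=; rewrite mul1r add0r. Qed.
HB.instance Definition _ :=
  Monoid.isComLaw.Build (val2 R) (vone R) (@vmul R) vmulA vmulC vmul1.
Lemma vmul_1 v : vmul v (vone R) = v.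
Proof. by rewrite vmulC vmul1. Qed.
Lemma vmuln v : vmul v None = None. Proof. by case: v => [[]|]. Qed.
Lemma vmul_eqn u v : (vmul u v == None) = (u == None) || (v == None).
Proof. by case: u v => [[p m]|] [[q n]|]. Qed.
Lemma vposM u v : vpos u -> vpos v -> vpos (vmul u v).
Proof. by case: u v => [[p m]|] [[q n]|] //= ? ?; rewrite mulr_gt0. Qed.
Lemma vpos1 : vpos (vone R). Proof. exact: ltr01. Qed.

Lemma vltM2r u v t : vpos t -> t != None -> (u < v)%O -> (vmul u t < vmul v t)%O.
Proof.
case: u v t => [[p m]|] [[q n]|] [[k l]|] // k0 _.
rewrite /= !vlt_some ltr_pM2r // ltrD2r => /orP[->//|/andP[/eqP-> ->]].
by rewrite eqxx orbT.
Qed.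
Lemma vleM2r u v t : vpos t -> (u <= v)%O -> (vmul u t <= vmul v t)%O.
Proof.
case: t => [t|] t0; last by rewrite !vmuln.
rewrite le_eqVlt => /predU1P[->//|h].
by apply/ltW/vltM2r.
Qed.
Lemma vleM u v u' v' : vpos u' -> vpos v -> (u <= v)%O -> (u' <= v')%O ->
  (vmul u u' <= vmul v v')%O.
Proof.
move=> h1 h2 l1 l2; apply: le_trans (vleM2r h1 l1) _.
by rewrite vmulC (vmulC v); apply: vleM2r.
Qed.
Lemma vltM u v u' v' : vpos u -> vpos v -> v != None -> (u <= v)%O ->
  (u' < v')%O -> vpos u' -> (vmul u u' < vmul v v')%O.
Proof.
move=> h1 h2 h3 l1 l2 h4; apply: le_lt_trans (vleM2r h4 l1) _.
by rewrite vmulC (vmulC v); apply: vltM2r.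
Qed.
Lemma vltMr u v u' v' : vpos u -> vpos v' -> v' != None -> (u < v)%O ->
  (u' <= v')%O -> vpos u' -> (vmul u u' < vmul v v')%O.
Proof.
by move=> h1 h2 h3 l1 l2 h4; rewrite (vmulC u) (vmulC v); apply: vltM.
Qed.
Lemma vleM2rE u v t : vpos t -> t != None ->
  (vmul u t <= vmul v t)%O = (u <= v)%O.
Proof.
move=> t0 tn; apply/idP/idP; last exact: vleM2r.
by apply: contraTT; rewrite -!ltNge => /(vltM2r t0 tn).
Qed.
Lemma vltM2rE u v t : vpos t -> t != None ->
  (vmul u t < vmul v t)%O = (u < v)%O.
Proof. by move=> t0 tn; rewrite !ltNge vleM2rE. Qed.

Lemma vmulIr u v t : vpos t -> t != None -> vmul u t = vmul v t -> u = v.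
Proof.
move=> t0 tn e; apply/le_anti/andP.
by split; rewrite -(vleM2rE _ _ t0 tn) e.
Qed.

Fixpoint vexp v n := if n is n'.+1 then vmul v (vexp v n') else vone R.
Lemma vexp_some (p : R) (m : rat) n : vexp (Some (p, m)) n = Some (p ^+ n, m *+ n).
Proof. by elim: n => //= n ->; rewrite exprS mulrS. Qed.
Lemma vexp1n n : vexp (vone R) n = vone R.
Proof. by rewrite vexp_some expr1n mul0rn. Qed.
Lemma vexp_pos v n : vpos v -> vpos (vexp v n).
Proof. by move=> h; elim: n => [|n IH] /=; [exact: vpos1|apply: vposM]. Qed.
Lemma vexp_eqn v n : (vexp v n == None) = (0 < n)%N && (v == None).
Proof. by elim: n => //= n IH; rewrite vmul_eqn IH; case: (v == None); rewrite ?andbF. Qed.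
Lemma vexp_le u v n : vpos u -> vpos v -> (u <= v)%O -> (vexp u n <= vexp v n)%O.
Proof.
by move=> u0 v0 h; elim: n => //= n IH; apply: vleM => //; apply: vexp_pos.
Qed.
Lemma vexp_lt u v n : (0 < n)%N -> vpos u -> vpos v -> (u < v)%O ->
  (vexp u n < vexp v n)%O.
Proof.
move=> n0 u0 v0 h; case: n n0 => // n _ /=.
have vn : v != None by rewrite -vlt_none; apply: le_lt_trans h.
apply: vltMr => //; first exact: vexp_pos.
- by rewrite vexp_eqn (negPf vn) andbF.
- exact/vexp_le/ltW.
- exact: vexp_pos.
Qed.
Lemma vexp_le1 v n : vpos v -> (v <= vone R)%O -> (vexp v n <= vone R)%O.
Proof.
by move=> v0 h; rewrite -(vexp1n n); apply: vexp_le => //; exact: vpos1.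
Qed.
Lemma vexpD v m n : vexp v (m + n)%N = vmul (vexp v m) (vexp v n).
Proof. by elim: m => [|m IH]; rewrite ?add0n ?vmul1 // addSn /= IH vmulA. Qed.
Lemma vexpM v m n : vexp v (m * n)%N = vexp (vexp v m) n.
Proof. by elim: n => [|n IH]; rewrite ?muln0 // mulnS vexpD IH. Qed.

(** For [n = k + 1] both sides contain the factor [u v], and what remains is [v ^ k <= u ^ k]. It
    shows in [peak] that dividing by a power of the excess removes the excess. *)
Lemma vexp_swap u v n : vpos u -> vpos v -> (v <= u)%O -> (0 < n)%N ->
  (vmul u (vexp v n) <= vmul v (vexp u n))%O.
Proof.
move=> u0 v0 h; case: n => // n _ /=; rewrite vmulA (vmulC u) -vmulA.
rewrite (vmulC u) (vmulC u); rewrite !vmulA; apply: vleM2r => //.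
rewrite !(vmulC v); apply: vleM2r => //; exact: vexp_le.
Qed.

Lemma vinvK v : vpos v -> v != None -> vmul v (vinv v) = vone R.
Proof.
by case: v => [[p m]|] //= p0 _; rewrite mulfV ?gt_eqF // subrr.
Qed.
Lemma vinv_pos v : vpos v -> vpos (vinv v).
Proof. by case: v => [[p m]|] //= h; rewrite invr_gt0. Qed.
Lemma vinv_eqn v : (vinv v == None) = (v == None).
Proof. by case: v => [[p m]|]. Qed.
Lemma vleV u v : vpos u -> u != None -> (u <= v)%O -> vpos v -> (vinv v <= vinv u)%O.
Proof.
move=> u0 un h v0.
have vn : v != None by rewrite -vlt_none; apply: lt_le_trans h; rewrite vlt_none.
rewrite -(@vleM2rE _ _ u) // (vmulC (vinv u)) vinvK //.
by rewrite -(@vleM2rE _ _ v) // -vmulA (vmulC u) vmulA (vmulC (vinv v)) vinvK // vmul1 vmul1.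
Qed.
End Val2Order.

(** * Nonarchimedean absolute values and valuations *)

Section NonarchAbs.
Variables (R : realType) (K : fieldType) (absK : K -> R).
Hypothesis hK : is_nonarch_abs absK.
Implicit Types x y z : K.

Lemma nabs_neq0 x : x != 0 -> absK x != 0.
Proof. by apply: contra_neq => /(abs_eq0 hK). Qed.
Lemma nabs_gt0 x : x != 0 -> 0 < absK x.
Proof. by move=> /nabs_neq0 h; rewrite lt_neqAle eq_sym h abs_ge0. Qed.
Lemma nabsX x n : absK (x ^+ n) = absK x ^+ n.
Proof.
by elim: n => [|n IH]; rewrite ?expr0 ?(abs_one hK) // !exprS (abs_mul hK) IH.
Qed.
Lemma nabsN1 : absK (-1) = 1.
Proof.
apply/eqP; rewrite -(@eqrXn2 _ 2) ?(abs_ge0 hK) //.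
by rewrite -nabsX sqrrN expr1n (abs_one hK) expr1n.
Qed.
Lemma nabsN x : absK (- x) = absK x.
Proof. by rewrite -mulN1r (abs_mul hK) nabsN1 mul1r. Qed.
Lemma nabsV x : absK x^-1 = (absK x)^-1.
Proof.
have [->|x0] := eqVneq x 0; first by rewrite !invr0 (abs_zero hK) invr0.
apply: (mulfI (nabs_neq0 x0)).
by rewrite -(abs_mul hK) !mulfV ?nabs_neq0 // (abs_one hK).
Qed.
Lemma nabs_addle x y c : absK x <= c -> absK y <= c -> absK (x + y) <= c.
Proof. by move=> h1 h2; apply: le_trans (abs_add hK _ _) _; rewrite ge_max h1. Qed.
Lemma nabs_suble x y c : absK x <= c -> absK y <= c -> absK (x - y) <= c.
Proof. by move=> h1 h2; apply: nabs_addle; rewrite ?nabsN. Qed.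
Lemma nabs_addlt x y c : absK x < c -> absK y < c -> absK (x + y) < c.
Proof. by move=> h1 h2; apply: le_lt_trans (abs_add hK _ _) _; rewrite gt_max h1. Qed.
Lemma nabs_sublt x y c : absK x < c -> absK y < c -> absK (x - y) < c.
Proof. by move=> h1 h2; apply: nabs_addlt; rewrite ?nabsN. Qed.
Lemma nabs_subC x y : absK (x - y) = absK (y - x).
Proof. by rewrite -nabsN opprB. Qed.
Lemma nabs_dom x y : absK x < absK y -> absK (x + y) = absK y.
Proof.
move=> h; apply/le_anti/andP; split; first by apply: nabs_addle => //; exact: ltW.
rewrite leNgt; apply/negP => h'.
by have := nabs_sublt h' h; rewrite addrAC subrr add0r ltxx.
Qed.
Lemma nabs_sum (I : Type) (s : seq I) (P : pred I) (F : I -> K) c : 0 <= c ->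
  (forall i, P i -> absK (F i) <= c) -> absK (\sum_(i <- s | P i) F i) <= c.
Proof.
move=> c0 h; elim/big_ind: _ => //; first by rewrite (abs_zero hK).
by move=> *; apply: nabs_addle.
Qed.
Lemma nabs_sum_lt (I : Type) (s : seq I) (P : pred I) (F : I -> K) c : 0 < c ->
  (forall i, P i -> absK (F i) < c) -> absK (\sum_(i <- s | P i) F i) < c.
Proof.
move=> c0 h; elim/big_ind: _ => //; first by rewrite (abs_zero hK).
by move=> *; apply: nabs_addlt.
Qed.
Lemma nabs_prod (I : Type) (s : seq I) (P : pred I) (F : I -> K) :
  absK (\prod_(i <- s | P i) F i) = \prod_(i <- s | P i) absK (F i).
Proof. by apply: big_morph; [exact: abs_mul|exact: abs_one]. Qed.
Lemma nabs_sign n : absK ((-1) ^+ n) = 1.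
Proof. by rewrite nabsX nabsN1 expr1n. Qed.
Lemma value_group_gt0 p : value_group absK p -> 0 < p.
Proof. by case=> x /= x0 <-; apply: nabs_gt0. Qed.

Lemma nabs_det_le n (M : 'M[K]_n) c : 0 <= c -> (forall i j, absK (M i j) <= c) ->
  absK (\det M) <= c ^+ n.
Proof.
move=> c0 h; apply: nabs_sum; first exact: exprn_ge0.
move=> s _; rewrite (abs_mul hK) nabs_sign mul1r nabs_prod.
apply: le_trans (_ : \prod_(i < n) c <= _).
  by apply: ler_prod => i _; rewrite (abs_ge0 hK) h.
by rewrite prodr_const card_ord.
Qed.

Lemma nabs_coef_prod (s : seq K) i :
  absK (\prod_(z <- s) ('X - z%:P))`_i <= \prod_(z <- s) Num.max 1 (absK z).
Proof.
elim: s i => [|z s IH] i.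
  by rewrite !big_nil coef1; case: (i == 0%N); rewrite ?(abs_one hK) ?(abs_zero hK).
have c0 : 0 <= \prod_(j <- s) Num.max 1 (absK j).
  by apply: prodr_ge0 => j _; rewrite le_max ler01.
rewrite !big_cons mulrBl coefB coefXM coefCM.
apply: nabs_suble.
  case: i => [|i] /=.
    by rewrite (abs_zero hK) mulr_ge0 // le_max ler01.
  by apply: le_trans (IH _) _; rewrite ler_peMl // le_max lexx.
rewrite (abs_mul hK); apply: ler_pM => //; rewrite ?(abs_ge0 hK) //.
by rewrite le_max lexx orbT.
Qed.
End NonarchAbs.

Section ClosedAbs.
Variables (R : realType) (K : closedFieldType) (absK : K -> R).
Hypothesis hK : is_nonarch_abs absK.

Lemma closed_root (x : K) n : (0 < n)%N -> exists y, y ^+ n = x.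
Proof.
move=> n0; have /closed_rootP[y] : size ('X^n - x%:P) != 1%N.
  by rewrite size_XnsubC //; case: n n0.
by rewrite /root !hornerE => /eqP/subr0_eq <-; exists y.
Qed.

(** An explicit form of the infinitude of the residue field. A root [u] of [X * Q - 1], with [Q] the
    product of the [X - z], satisfies [u * Q(u) = 1]; it cannot have absolute value above 1, so all
    the factors are at most 1 and, their product being 1, equal to 1. *)
Lemma abs_unit_avoid (s : seq K) :
  exists2 u, absK u = 1 & forall z, z \in s -> absK z <= 1 -> absK (u - z) = 1.
Proof.
pose t := [seq z <- s | absK z <= 1].
pose Q := \prod_(z <- t) ('X - z%:P).
have Qm : Q \is monic by apply: monic_prod_XsubC.
have sQ : size Q = (size t).+1 by rewrite size_prod_XsubC.
have /closed_rootP[u] : size ('X * Q - 1%:P) != 1%N.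
  by rewrite size_polyDl ?size_polyN ?size_polyC ?oner_eq0 size_monicM
    ?monicX ?monic_neq0 // sQ size_polyX.
rewrite /root !hornerE => /eqP/subr0_eq Qu.
have tle z : z \in t -> absK z <= 1 by rewrite mem_filter => /andP[].
have Qu1 : absK u * \prod_(z <- t) absK (u - z) = 1.
  move: (congr1 absK Qu); rewrite (abs_one hK) (abs_mul hK) horner_prod (nabs_prod hK).
  by under eq_bigr do rewrite !hornerE.
have u1 : absK u <= 1.
  rewrite leNgt; apply/negP => u1.
  suff : 1 < absK u * \prod_(z <- t) absK (u - z) by rewrite Qu1 ltxx.
  apply: (lt_le_trans u1); rewrite ler_peMr ?(abs_ge0 hK) //.
  have -> : \prod_(z <- t) absK (u - z) = \prod_(z <- t) absK u.
    apply: eq_big_seq => z /tle hz; rewrite addrC (nabs_dom hK) // (nabsN hK).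
    exact: le_lt_trans u1.
  elim: (t) => [|z r IH]; first by rewrite big_nil.
  by rewrite big_cons mulr_ege1 // ltW.
have P1 (r : seq K) : {subset r <= t} -> \prod_(z <- r) absK (u - z) <= 1.
  elim: r => [|z r IH] hr; first by rewrite big_nil.
  rewrite big_cons mulr_ile1 ?(abs_ge0 hK) ?IH //.
  - by apply: prodr_ge0 => *; exact: abs_ge0.
  - by apply: (nabs_suble hK) => //; apply/tle/hr; rewrite mem_head.
  - by move=> y hy; apply: hr; rewrite in_cons hy orbT.
have ue : absK u = 1.
  apply/le_anti; rewrite u1 /= -Qu1 -[leRHS]mulr1 ler_wpM2l ?(abs_ge0 hK) //.
  exact: P1.
exists u => // z zs z1; have zt : z \in t by rewrite mem_filter z1.
apply/le_anti; rewrite (nabs_suble hK) ?ue //= -Qu1 ue mul1r.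
rewrite (big_rem z zt) /= -[leRHS]mulr1 ler_wpM2l ?(abs_ge0 hK) //.
by apply: P1 => y /mem_rem.
Qed.

(** If [u] avoids the residues of the roots of [P], then [|u - z| = max 1 |z|] for every root [z],
    and the product of these maxima bounds the coefficients of the monic part of [P]. Thus the Gauss
    norm is attained at [u]. *)
Lemma poly_unit_generic (s : seq {poly K}) :
  exists2 u, absK u = 1 & forall P i, P \in s -> absK P`_i <= absK P.[u].
Proof.
pose rts P := sval (closed_field_poly_normal (P : {poly K})).
have [u u1 hu] := abs_unit_avoid (flatten [seq rts P | P <- s]).
exists u => // P i Ps.
have e := svalP (closed_field_poly_normal P); rewrite -/(rts P) in e.
rewrite {2}e {1}e coefZ hornerZ !(abs_mul hK) ler_wpM2l ?(abs_ge0 hK) //.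
apply: le_trans (nabs_coef_prod hK _ _) _.
rewrite horner_prod (nabs_prod hK) big_seq [leRHS]big_seq; apply: ler_prod => z zr.
rewrite le_max ler01 /= !hornerE.
have [z1|z1] := leP (absK z) 1.
  rewrite hu //; apply/flattenP.
  by exists (rts P) => //; apply: map_f.
by rewrite (nabs_dom hK) (nabsN hK) ?u1.
Qed.
End ClosedAbs.

Section NonarchRoots.
Variables (R : realType) (K : fieldType) (absK : K -> R).
Hypothesis hK : is_nonarch_abs absK.

Lemma nabs_prod_coef (s : seq K) c k : 0 <= c -> (forall z, z \in s -> absK z <= c) ->
  absK (\prod_(z <- s) ('X - z%:P))`_k <= c ^+ (size s - k).
Proof.
move=> c0; elim: s k => [|z s IH] k hs.
  by rewrite big_nil coef1 sub0n expr0; case: eqP; rewrite ?(abs_one hK) ?(abs_zero hK) ?ler01.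
have {}IH j := IH j (fun y ys => hs y (mem_behead (s := z :: s) ys)).
rewrite big_cons mulrBl coefB coefXM coefCM /=.
apply: (nabs_suble hK).
  by case: k => [|k] //=; rewrite ?(abs_zero hK) ?exprn_ge0 // subSS.
have [ks|ks] := leqP k (size s).
  rewrite (abs_mul hK) subSn // exprS; apply: ler_pM; rewrite ?(abs_ge0 hK) //.
  by apply: hs; rewrite mem_head.
rewrite nth_default ?mulr0 ?(abs_zero hK) ?exprn_ge0 //.
by rewrite size_prod_XsubC.
Qed.

(** Were [|z| > c], the term [z ^ n] would strictly dominate all the others and the equation could
    not hold. *)
Lemma nabs_root_le (Q : {poly K}) n z c : 0 <= c -> size Q = n.+1 -> Q \is monic ->
  root Q z -> (forall i, (i < n)%N -> absK Q`_i <= c ^+ (n - i)) -> absK z <= c.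
Proof.
move=> c0 sQ mQ /eqP rz h; rewrite leNgt; apply/negP => cz.
have z0 : 0 < absK z by apply: le_lt_trans cz.
have : absK (\sum_(i < n) Q`_i * z ^+ i) < absK (z ^+ n).
  apply: (nabs_sum_lt hK) => [|i _]; first by rewrite (nabsX hK) exprn_gt0.
  rewrite (abs_mul hK) !(nabsX hK).
  apply: le_lt_trans (_ : c ^+ (n - i) * absK z ^+ i < _).
    by rewrite ler_wpM2r ?exprn_ge0 ?(abs_ge0 hK) // h.
  rewrite -[X in _ < _ ^+ X](subnK (ltnW (ltn_ord i))) exprD ltr_pM2r ?exprn_gt0 //.
  by rewrite ltrXn2r ?(abs_ge0 hK) // -lt0n subn_gt0.
move: rz; rewrite horner_coef sQ big_ord_recr /= => /eqP; rewrite addr_eq0 => /eqP ->.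
have -> : Q`_n = 1 by move: mQ; rewrite monicE /lead_coef sQ /= => /eqP.
by rewrite mul1r (nabsN hK) ltxx.
Qed.

Lemma nabs_root_lt1 (Q : {poly K}) n z : size Q = n.+1 -> Q \is monic ->
  root Q z -> (forall i, (i < n)%N -> absK Q`_i < 1) -> absK z < 1.
Proof.
move=> sQ mQ /eqP rz h; rewrite ltNge; apply/negP => z1.
have z0 : 0 < absK z by apply: lt_le_trans z1.
have : absK (\sum_(i < n) Q`_i * z ^+ i) < absK (z ^+ n).
  apply: (nabs_sum_lt hK) => [|i _]; first by rewrite (nabsX hK) exprn_gt0.
  rewrite (abs_mul hK) !(nabsX hK).
  apply: lt_le_trans (_ : 1 * absK z ^+ i <= _).
    by rewrite ltr_pM2r ?exprn_gt0 // h.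
  by rewrite mul1r ler_weXn2l // ltnW.
move: rz; rewrite horner_coef sQ big_ord_recr /= => /eqP; rewrite addr_eq0 => /eqP ->.
have -> : Q`_n = 1 by move: mQ; rewrite monicE /lead_coef sQ /= => /eqP.
by rewrite mul1r (nabsN hK) ltxx.
Qed.
End NonarchRoots.

Section FieldVal.
Variables (R : realType) (K : fieldType) (absK : K -> R).
Hypothesis hK : is_nonarch_abs absK.
Variables (E : fieldType) (w : E -> val2 R).
Hypothesis hw : is_field_valuation absK w.
Implicit Types (x y z : E) (u v : val2 R).
Let hv := fval_val hw.

Lemma w0 : w 0 = None. Proof. exact: (val_zero hv). Qed.
Lemma w1 : w 1 = vone R. Proof. exact: (val_one hv). Qed.
Lemma wM x y : w (x * y) = vmul (w x) (w y). Proof. exact: (val_mul hv). Qed.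
Lemma w_eqn x : (w x == None) = (x == 0).
Proof. by apply/eqP/eqP => [/(fval_eq0 hw)|->]; rewrite ?w0. Qed.
Lemma w_pos x : vpos (w x).
Proof.
case e: (w x) => [[p q]|] //=.
exact: (value_group_gt0 hK (val_group hv e)).
Qed.
Hint Resolve w_pos : core.
Lemma wX x n : w (x ^+ n) = vexp (w x) n.
Proof. by elim: n => [|n IH]; rewrite ?expr0 ?w1 // exprS wM IH. Qed.
Lemma w_prod (I : Type) (s : seq I) (P : pred I) (F : I -> E) :
  w (\prod_(i <- s | P i) F i) = \big[@vmul R/vone R]_(i <- s | P i) w (F i).
Proof. by apply: big_morph; [exact: wM|exact: w1]. Qed.
Lemma wN1 : w (-1) = vone R.
Proof.
have := wM (-1) (-1); rewrite mulN1r opprK w1; have := w_pos (-1).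
case: (w (-1)) => [[p q]|] //= p0 [e1 e2]; congr (Some (_, _)); last by lra.
apply/eqP; rewrite -(@eqrXn2 _ 2) ?ltW //; by rewrite expr1n expr2 -e1.
Qed.
Lemma wN x : w (- x) = w x. Proof. by rewrite -mulN1r wM wN1 vmul1. Qed.
Lemma wD x y : (w (x + y) <= Order.max (w x) (w y))%O.
Proof. by rewrite le_max; exact: (val_add hv). Qed.
Lemma w_addle x y u : (w x <= u)%O -> (w y <= u)%O -> (w (x + y) <= u)%O.
Proof. by move=> h1 h2; apply: le_trans (wD _ _) _; rewrite ge_max h1. Qed.
Lemma w_addlt x y u : (w x < u)%O -> (w y < u)%O -> (w (x + y) < u)%O.
Proof. by move=> h1 h2; apply: le_lt_trans (wD _ _) _; rewrite gt_max h1. Qed.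
Lemma w_suble x y u : (w x <= u)%O -> (w y <= u)%O -> (w (x - y) <= u)%O.
Proof. by move=> h1 h2; apply: w_addle; rewrite ?wN. Qed.
Lemma w_sublt x y u : (w x < u)%O -> (w y < u)%O -> (w (x - y) < u)%O.
Proof. by move=> h1 h2; apply: w_addlt; rewrite ?wN. Qed.
Lemma w_subC x y : w (x - y) = w (y - x). Proof. by rewrite -wN opprB. Qed.
Lemma w_dom x y : (w x < w y)%O -> w (x + y) = w y.
Proof.
move=> h; apply/le_anti/andP; split; first by apply: w_addle => //; exact: ltW.
rewrite leNgt; apply/negP => h'.
by have := w_sublt h' h; rewrite addrAC subrr add0r ltxx.
Qed.
Lemma w_sum_le (I : Type) (s : seq I) (P : pred I) (F : I -> E) u :
  (forall i, P i -> (w (F i) <= u)%O) -> (w (\sum_(i <- s | P i) F i) <= u)%O.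
Proof.
move=> h; elim/big_ind: _ => //; first by rewrite w0.
by move=> *; apply: w_addle.
Qed.
Lemma w_sum_lt (I : Type) (s : seq I) (P : pred I) (F : I -> E) u : u != None ->
  (forall i, P i -> (w (F i) < u)%O) -> (w (\sum_(i <- s | P i) F i) < u)%O.
Proof.
move=> un h; elim/big_ind: _ => //; first by rewrite w0 vlt_none.
by move=> *; apply: w_addlt.
Qed.
Lemma w_sum_dom (I : finType) (F : I -> E) i0 : F i0 != 0 ->
  (forall i, i != i0 -> (w (F i) < w (F i0))%O) -> w (\sum_i F i) = w (F i0).
Proof.
move=> n0 h; rewrite (bigD1 i0) //= addrC; apply: w_dom.
by apply: w_sum_lt => //; rewrite w_eqn.
Qed.
Lemma w_sub1 x : (w (x - 1) < vone R)%O -> w x = vone R.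
Proof. by move=> h; rewrite -[x](subrK 1) w_dom w1. Qed.
Lemma w_mull x y u : (w x <= vone R)%O -> (w y <= u)%O -> (w (x * y) <= u)%O.
Proof.
move=> h1 h2; rewrite wM; apply: le_trans h2.
by rewrite -[leRHS]vmul1; apply: vleM2r.
Qed.

(** Forgetting the natural part is the coarsening of [w] to rank one; the root bounds for absolute
    values thereby apply to flat parts. *)
Lemma flat_nonarch : is_nonarch_abs (fun x => vflat (w x)).
Proof.
split.
- by move=> x; have := w_pos x; case: (w x) => [[p q]|] //= /ltW.
- move=> x e; apply/eqP; rewrite -w_eqn; have := w_pos x.
  by case: (w x) e => [[p q]|] //= ->; rewrite ltxx.
- by rewrite w0.
- by rewrite w1.
- by move=> x y; rewrite wM; case: (w x) (w y) => [[p q]|] [[k l]|] //=; rewrite ?mulr0 ?mul0r.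
- move=> x y; have := wD x y; have := w_pos x; have := w_pos y.
  rewrite le_max [in X in _ -> _ -> _ -> X]le_max.
  case: (w x) (w y) (w (x + y)) => [[p q]|] [[k l]|] [[i j]|] //=;
    rewrite ?vle_some ?vle_Nnone ?orbF //= => h1 h2.
  + by move=> /orP[/orP[/ltW->|/andP[/eqP-> _]]|/orP[/ltW->|/andP[/eqP-> _]]]; rewrite ?lexx ?orbT.
  + by rewrite (ltW h1) orbT.
  + by move=> /orP[/ltW->|/andP[/eqP-> _]]; rewrite ?lexx.
  + by rewrite (ltW h2).
  + by move=> /orP[/ltW->|/andP[/eqP-> _]]; rewrite ?lexx ?orbT.
  + by rewrite (ltW h1) orbT.
  + by rewrite lexx.
Qed.

Lemma w_coef_prod (s : seq E) u k : vpos u -> (forall z, z \in s -> (w z <= u)%O) ->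
  (k <= size s)%N ->
  (w (\prod_(z <- s) ('X - z%:P))`_k <= vexp u (size s - k))%O.
Proof.
move=> c0; elim: s k => [|z s IH] k hs.
  by rewrite leqn0 => /eqP->; rewrite big_nil coef1 w1.
have {}IH j := IH j (fun y ys => hs y (mem_behead (s := z :: s) ys)).
move=> ks; rewrite big_cons mulrBl coefB coefXM coefCM /=; apply: w_suble.
  case: k ks => [|k] ks /=; first by rewrite w0.
  by rewrite subSS; apply: IH.
rewrite leq_eqVlt in ks; case/predU1P: ks => [->|ks].
  by rewrite nth_default ?size_prod_XsubC ?leqnn // mulr0 w0.
rewrite wM subSn //=; apply: vleM => //; last by apply: IH.
by apply: hs; rewrite mem_head.
Qed.

Lemma w_root_le (Q : {poly E}) n z u : vpos u -> u != None -> size Q = n.+1 -> Q \is monic ->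
  root Q z -> (forall i, (i < n)%N -> (w Q`_i <= vexp u (n - i))%O) -> (w z <= u)%O.
Proof.
move=> u0 un sQ mQ /eqP rz h; rewrite leNgt; apply/negP => uz.
have z0 : w z != None by rewrite -vlt_none; apply: le_lt_trans uz.
have : (w (\sum_(i < n) Q`_i * z ^+ i) < w (z ^+ n))%O.
  apply: w_sum_lt => [|i _]; first by rewrite wX vexp_eqn (negPf z0) andbF.
  rewrite wM !wX -[X in (_ < vexp _ X)%O](subnK (ltnW (ltn_ord i))) vexpD.
  apply: le_lt_trans (_ : (vmul (vexp u (n - i)) (vexp (w z) i) < _)%O).
    by apply: vleM2r; [exact: vexp_pos|exact: h].
  apply: vltM2r; [exact: vexp_pos| |].
    by rewrite vexp_eqn (negPf z0) andbF.
  by apply: vexp_lt; rewrite ?subn_gt0.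
move: rz; rewrite horner_coef sQ big_ord_recr /= => /eqP; rewrite addr_eq0 => /eqP ->.
have -> : Q`_n = 1 by move: mQ; rewrite monicE /lead_coef sQ /= => /eqP.
by rewrite mul1r wN ltxx.
Qed.
End FieldVal.
#[export] Hint Resolve w_pos : core.

Section CommutativeSubalgebra.
Variables (F : fieldType) (M : algType F) (P : {pred M}).
Hypotheses (hP : subalg_closed P) (hC : forall u v, u \in P -> v \in P -> u * v = v * u).
(** The two closure proofs are parameters, so that instances depending on them can be attached to
    the predicate. Subalgebras of [L] and of a matrix ring thus become commutative algebras, over
    which the universal property of a base change quantifies. *)
Definition csub_pred of subalg_closed P & (forall u v, u \in P -> v \in P -> u * v = v * u) : {pred M} := P.
Local Notation Q := (csub_pred hP hC).
HB.instance Definition _ := GRing.isSubalgClosed.Build F M Q hP.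
Record csub := CSub { csval : M ; _ : csval \in Q }.
HB.instance Definition _ := [isSub for csval].
HB.instance Definition _ := [Choice of csub by <:].
HB.instance Definition _ := [SubChoice_isSubNzRing of csub by <:].
HB.instance Definition _ := [SubZmodule_isSubLmodule of csub by <:].
HB.instance Definition _ := [SubNzRing_SubLmodule_isSubLalgebra of csub by <:].
HB.instance Definition _ := [SubLalgebra_isSubAlgebra of csub by <:].
Fact csub_mulC (u v : csub) : u * v = v * u.
Proof. by apply/val_inj; rewrite !rmorphM /=; apply: hC; exact: valP. Qed.
HB.instance Definition _ := GRing.PzRing_hasCommutativeMul.Build csub csub_mulC.
End CommutativeSubalgebra.

(** * Base change to the stalk and integral bases *)

Section BaseChange.
Variables (K : closedFieldType) (A : comAlgType K) (C : comAlgType A) (kap : fieldType).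
Variables (iota : {rmorphism A -> kap}) (L : comAlgType kap) (j : {rmorphism C -> L}).
Hypothesis hj : is_base_change iota j.

(** The span [P] is a subalgebra through which [j] factors, so the universal property gives a map
    from [L] to [P]. Composed with the inclusion it is the identity, by uniqueness, hence [P] is all
    of [L]. *)
Lemma bc_span d (c : 'I_d -> C) :
  (forall u, exists a : 'I_d -> kap, j u = \sum_k a k *: j (c k)) ->
  forall z, exists a : 'I_d -> kap, z = \sum_k a k *: j (c k).
Proof.
move=> h; pose P : {pred L} := [pred z | `[< exists a : 'I_d -> kap, z = \sum_k a k *: j (c k) >]].
have PZ (a : kap) u v : u \in P -> v \in P -> a *: u + v \in P.
  move=> /asboolP[x ->] /asboolP[y ->]; apply/asboolP.
  exists (fun k => a * x k + y k); rewrite scaler_sumr -big_split; apply: eq_bigr => k _ /=.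
  by rewrite scalerA scalerDl.
have Pj u : j u \in P by apply/asboolP; exact: h.
have P0 : 0 \in P by rewrite -(rmorph0 j).
have Psum (I : finType) (a : I -> kap) (u : I -> L) : (forall i, u i \in P) -> \sum_i a i *: u i \in P.
  by move=> hu; elim/big_ind: _ => [//|x y hx hy|i _]; [rewrite -[x]scale1r PZ|rewrite -[_ *: _]addr0 PZ].
have hP : subalg_closed P.
  split=> //; first by rewrite -(rmorph1 j).
  move=> u v /asboolP[x ->] /asboolP[y ->].
  rewrite mulr_suml; under eq_bigr do rewrite -scalerAl; apply: (Psum) => k.
  rewrite mulr_sumr; under eq_bigr do rewrite -scalerAr; apply: Psum => l.
  by rewrite -rmorphM.
have hC (u v : L) : u \in P -> v \in P -> u * v = v * u by rewrite mulrC.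
pose S : comAlgType kap := csub hP hC.
pose phi0 (u : C) : S := CSub (Pj u : j u \in csub_pred hP hC).
have phiB : zmod_morphism phi0 by move=> u v; apply/val_inj; rewrite /= rmorphB.
have phiM : monoid_morphism phi0.
  by split=> [|u v]; apply/val_inj; rewrite /= ?rmorph1 ?rmorphM.
pose pa := GRing.isZmodMorphism.Build C S phi0 phiB.
pose pm := GRing.isMonoidMorphism.Build C S phi0 phiM.
pose phi : {rmorphism C -> S} := HB.pack phi0 pa pm.
have [|psi [hpsi _]] := bc_univ hj (phi := phi).
  by move=> f; apply/val_inj; rewrite /= (bc_comm hj).
have [|id' [_ uniq]] := bc_univ hj (phi := j); first exact: bc_comm hj.
move=> z; have e : \val (psi z) = z.
  pose f (u : S) : L := \val u.
  have fB : zmod_morphism f by move=> u v; rewrite /f rmorphB.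
  have fM : monoid_morphism f by split=> [|u v]; rewrite /f ?rmorph1 ?rmorphM.
  have fZ : scalable f by move=> a' u; rewrite /f linearZ.
  pose fa := GRing.isZmodMorphism.Build S L f fB.
  pose fm := GRing.isMonoidMorphism.Build S L f fM.
  pose fs := GRing.isScalable.Build kap S L *:%R f fZ.
  pose inc : {lrmorphism S -> L} := HB.pack f fa fm fs.
  rewrite -[LHS]/((inc \o psi) z) -[RHS]/(idfun z) (uniq (inc \o psi)); last first.
    by move=> u; rewrite /= hpsi.
  by rewrite -(uniq idfun).
by have /asboolP := valP (psi z); rewrite e.
Qed.

(** Independence is tested in an algebra where it is visible: the matrices of multiplication in the
    coordinates [co]. Applied to the coordinates of 1, the matrix [M (c k)] gives the [k]-th unit
    vector. *)
Lemma bc_free d (c : 'I_d -> C) (co : C -> 'I_d -> kap) :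
  (forall u v k, co (u - v) k = co u k - co v k) ->
  (forall f u k, co (f *: u) k = iota f * co u k) ->
  (forall l k, co (c l) k = (k == l)%:R) ->
  (forall u v k, co (u * v) k = \sum_l co (u * c l) k * co v l) ->
  forall a : 'I_d -> kap, \sum_k a k *: j (c k) = 0 -> forall k, a k = 0.
Proof.
case: d c co => [|d] c co coB coZ coc coM a ha k; first by case: k.
pose M u : 'M[kap]_d.+1 := \matrix_(k, l) co (u * c l) k.
have MM u v : M (u * v) = M u * M v.
  by apply/matrixP => k' l; rewrite !mxE -mulrA coM; apply: eq_bigr => i _; rewrite !mxE.
have M1 : M 1 = 1.
  by apply/matrixP => k' l; rewrite !mxE mul1r coc.
have MB u v : M (u - v) = M u - M v.
  by apply/matrixP => k' l; rewrite !mxE mulrBl coB.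
(* The bicommutant of the matrices [M u]: a subalgebra that contains them, and commutative because
   they commute with one another. *)
pose P : {pred 'M[kap]_d.+1} := [pred X | `[< forall Z : 'M[kap]_d.+1, (forall u, Z * M u = M u * Z) -> X * Z = Z * X >]].
have PM u : M u \in P by apply/asboolP => Z h; rewrite h.
have hP : subalg_closed P.
  split=> [|x X Z /asboolP hX /asboolP hZ|X Z /asboolP hX /asboolP hZ]; apply/asboolP => W hW.
  - by rewrite mulr1 mul1r.
  - by rewrite mulrDl mulrDr -scalerAl -scalerAr hX ?hZ.
  - by rewrite -mulrA (hZ W hW) mulrA (hX W hW) mulrA.
have hC X Z : X \in P -> Z \in P -> X * Z = Z * X.
  move=> /asboolP hX /asboolP hZ; apply: hX => u; apply: hZ => v.
  by rewrite -!MM mulrC.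
pose S : comAlgType kap := csub hP hC.
pose phi0 (u : C) : S := CSub (PM u : M u \in csub_pred hP hC).
have phiB : zmod_morphism phi0 by move=> u v; apply/val_inj; rewrite /= MB.
have phiM : monoid_morphism phi0.
  by split=> [|u v]; apply/val_inj; rewrite /= ?M1 ?MM.
pose pa := GRing.isZmodMorphism.Build C S phi0 phiB.
pose pm := GRing.isMonoidMorphism.Build C S phi0 phiM.
pose phi : {rmorphism C -> S} := HB.pack phi0 pa pm.
have [|psi [hpsi _]] := bc_univ hj (phi := phi).
  move=> f; apply/val_inj; rewrite /=; apply/matrixP => k' l.
  by rewrite !mxE -scalerAl mul1r coZ coc.
have : \sum_k a k *: M (c k) = 0.
  have := congr1 \val (congr1 psi ha); rewrite !rmorph0 => h0; rewrite -[RHS]h0.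
  rewrite !raddf_sum; apply: eq_bigr => i _.
  by rewrite /= [psi _]linearZ /= hpsi.
move=> /(congr1 (fun X => (X *m \col_l co 1 l) k 0)).
rewrite mul0mx [RHS]mxE mulmx_suml summxE (bigD1 k) //= big1 ?addr0.
  by rewrite -scalemxAl !mxE; under eq_bigr do rewrite !mxE; rewrite -coM mulr1 coc eqxx mulr1.
move=> i ik; rewrite -scalemxAl !mxE; under eq_bigr do rewrite !mxE.
by rewrite -coM mulr1 coc eq_sym (negPf ik) mulr0.
Qed.
End BaseChange.

Section PlusBasis.
Variables (R : realType) (kap : fieldType) (nu : kap -> R) (hnu : is_nonarch_abs nu).
Variables (L : comAlgType kap) (d : nat) (f : 'I_d -> L).
Hypotheses (fspan : forall z, exists a : 'rV[kap]_d, z = \sum_k a 0 k *: f k)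
  (ffree : forall a : 'rV[kap]_d, \sum_k a 0 k *: f k = 0 -> a = 0).
Definition co z : 'rV[kap]_d := sval (cid (fspan z)).
Lemma coP z : z = \sum_k co z 0 k *: f k. Proof. by rewrite /co; case: cid. Qed.
Lemma co_uniq z (a : 'rV[kap]_d) : z = \sum_k a 0 k *: f k -> co z = a.
Proof.
move=> e; apply/eqP; rewrite -subr_eq0; apply/eqP/ffree; apply/eqP.
rewrite (eq_bigr (fun k => co z 0 k *: f k - a 0 k *: f k)); last first.
  by move=> k _; rewrite !mxE scalerBl.
by rewrite sumrB -coP -e subrr.
Qed.
Lemma co_lin (t : kap) z y : co (t *: z + y) = t *: co z + co y.
Proof.
apply: co_uniq; rewrite {1}[z]coP {1}[y]coP scaler_sumr -big_split; apply: eq_bigr => k _ /=.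
by rewrite !mxE scalerA scalerDl.
Qed.
Lemma coB z y : co (z - y) = co z - co y.
Proof. by rewrite addrC -scaleN1r co_lin scaleN1r addrC. Qed.
Lemma coZ t z : co (t *: z) = t *: co z.
Proof. by have := co_lin t z 0; rewrite addr0 -(subrr z) coB subrr addr0. Qed.

Definition mulm z : 'M[kap]_d := \matrix_k co (z * f k).
Lemma mulmE z k : z * f k = \sum_l mulm z k l *: f l.
Proof. by rewrite [LHS]coP; apply: eq_bigr => l _; rewrite mxE. Qed.
Lemma mulm_uniq z (X : 'M[kap]_d) : (forall k, z * f k = \sum_l X k l *: f l) -> mulm z = X.
Proof.
move=> h; apply/row_matrixP => k; rewrite rowK; apply: co_uniq.
by rewrite h; apply: eq_bigr => l _; rewrite mxE.
Qed.
Lemma mulm_lin (t : kap) z y : mulm (t *: z + y) = t *: mulm z + mulm y.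
Proof. by apply/row_matrixP => k; rewrite linearP /= !rowK mulrDl -scalerAl co_lin. Qed.
Lemma mulmM z y : mulm (z * y) = mulm z *m mulm y.
Proof.
apply: mulm_uniq => k; rewrite [z * y]mulrC -mulrA mulmE mulr_sumr.
rewrite (eq_bigr (fun l => \sum_i (mulm z k l * mulm y l i) *: f i)); last first.
  by move=> l _; rewrite -scalerAr mulmE scaler_sumr; apply: eq_bigr => i _; rewrite scalerA.
by rewrite exchange_big; apply: eq_bigr => i _; rewrite mxE scaler_suml.
Qed.
Lemma mulm1 : mulm 1 = 1%:M.
Proof.
apply: mulm_uniq => k; rewrite mul1r (bigD1 k) //= big1 ?addr0; first by rewrite mxE eqxx scale1r.
by move=> l lk; rewrite mxE eq_sym (negPf lk) scale0r.
Qed.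
Definition trL z : kap := \tr (mulm z).
Lemma trL_lin (t : kap) z y : trL (t *: z + y) = t * trL z + trL y.
Proof. by rewrite /trL mulm_lin linearP. Qed.
Lemma trL_sum (I : Type) (s : seq I) (a : I -> kap) (F : I -> L) :
  trL (\sum_(i <- s) a i *: F i) = \sum_(i <- s) a i * trL (F i).
Proof.
elim: s => [|i s IH]; last by rewrite !big_cons trL_lin IH.
rewrite !big_nil; have := trL_lin (-1) 0 0.
by rewrite scaler0 addr0 mulN1r => ->; rewrite addNr.
Qed.

(** The sup norm in the basis [f]. It is to be recognized as the spectral norm, whose unit ball is
    the integral closure of the valuation ring. *)
Definition nL z : R := \big[Num.max/0]_k nu (co z 0 k).
Lemma nL_ub z k : nu (co z 0 k) <= nL z. Proof. exact: le_bigmax. Qed.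
Lemma nL_ge0 z : 0 <= nL z.
Proof. by rewrite /nL; elim/big_rec: _ => // i u _ u0; rewrite le_max u0 orbT. Qed.
Lemma nL_leP z (c : R) : 0 <= c -> (nL z <= c) <-> forall k, nu (co z 0 k) <= c.
Proof.
move=> c0; split=> [h k|h]; first exact: le_trans (nL_ub z k) h.
by apply: bigmax_le.
Qed.
Lemma nL_add_le z y c : nL z <= c -> nL y <= c -> nL (z + y) <= c.
Proof.
move=> h h'; have c0 := le_trans (nL_ge0 z) h.
apply/(nL_leP _ c0) => k; have := co_lin 1 z y; rewrite !scale1r => ->; rewrite mxE.
by apply: (nabs_addle hnu); apply: le_trans (nL_ub _ _) _.
Qed.
Lemma nL_sum_le (I : Type) (s : seq I) (P : pred I) (F : I -> L) c : 0 <= c ->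
  (forall i, P i -> nL (F i) <= c) -> nL (\sum_(i <- s | P i) F i) <= c.
Proof.
move=> c0 h; elim/big_ind: _ => //; last by move=> *; exact: nL_add_le.
by apply/(nL_leP _ c0) => k; rewrite -(subrr 0) coB subrr mxE (abs_zero hnu).
Qed.
Lemma nLZ t z : nL (t *: z) = nu t * nL z.
Proof.
have t0 := abs_ge0 hnu t; apply/le_anti/andP; split.
  apply/nL_leP => [|k]; first by rewrite mulr_ge0 ?nL_ge0.
  by rewrite coZ mxE (abs_mul hnu) ler_wpM2l ?nL_ub.
have [->|tn] := eqVneq t 0; first by rewrite (abs_zero hnu) mul0r nL_ge0.
rewrite mulrC -ler_pdivlMr ?(nabs_gt0 hnu) //; apply/nL_leP => [|k].
  by rewrite divr_ge0 ?nL_ge0.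
rewrite ler_pdivlMr ?(nabs_gt0 hnu) // mulrC -(abs_mul hnu).
by have := nL_ub (t *: z) k; rewrite coZ mxE.
Qed.
Lemma nL_eq0 z : nL z = 0 -> z = 0.
Proof.
move=> h; rewrite [z]coP big1 // => k _; rewrite (_ : co z 0 k = 0) ?scale0r //.
by apply: (abs_eq0 hnu); apply/le_anti; rewrite (abs_ge0 hnu) andbT -h nL_ub.
Qed.

Section Submultiplicative.
Hypotheses (hmul : forall k l, nL (f k * f l) <= 1) (h1 : nL 1 <= 1).
Lemma nLM z y : nL (z * y) <= nL z * nL y.
Proof.
have c0 : 0 <= nL z * nL y by rewrite mulr_ge0 ?nL_ge0.
rewrite {1}[z]coP {1}[y]coP mulr_suml; apply: nL_sum_le => // k _.
rewrite mulr_sumr; apply: nL_sum_le => // l _.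
rewrite -scalerAl -scalerAr scalerA nLZ (abs_mul hnu) -[leRHS]mulr1.
by apply: ler_pM; rewrite ?mulr_ge0 ?(abs_ge0 hnu) ?nL_ge0 ?hmul //; apply: ler_pM; rewrite ?(abs_ge0 hnu) ?nL_ub.
Qed.
Lemma nLX z n : nL (z ^+ n) <= nL z ^+ n.
Proof.
elim: n => [|n IH]; first by rewrite !expr0.
by rewrite !exprS; apply: le_trans (nLM _ _) _; rewrite ler_wpM2l ?nL_ge0.
Qed.

Lemma char_poly_le1 n (X : 'M[kap]_n) : (forall i j, nu (X i j) <= 1) ->
  forall i, nu (char_poly X)`_i <= 1.
Proof.
move=> h; pose P (p : {poly kap}) := forall i, nu p`_i <= 1.
have PM p q : P p -> P q -> P (p * q).
  move=> hp hq i; rewrite coefM; apply: (nabs_sum hnu) => // j _.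
  by rewrite (abs_mul hnu) mulr_ile1 ?(abs_ge0 hnu).
have PD p q : P p -> P q -> P (p + q).
  by move=> hp hq i; rewrite coefD; apply: (nabs_addle hnu).
have P1 : P 1 by move=> i; rewrite coef1; case: eqP; rewrite ?(abs_one hnu) ?(abs_zero hnu).
have P0 : P 0 by move=> i; rewrite coef0 (abs_zero hnu).
have PN p : P p -> P (- p) by move=> hp i; rewrite coefN (nabsN hnu).
rewrite -/(P (char_poly X)) /char_poly /determinant; elim/big_ind: _ => // s _.
apply: (PM); first by case: (odd_perm s); rewrite ?expr1 ?expr0; [exact: PN|].
elim/big_ind: _ => // i _; rewrite !mxE; apply: (PD).
  case: eqP => _ j; rewrite ?mulr0n ?mulr1n ?coef0 ?(abs_zero hnu) //.
  by rewrite coefX; case: eqP; rewrite ?(abs_one hnu) ?(abs_zero hnu).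
by apply: (PN) => j; rewrite coefC; case: eqP; rewrite ?h ?(abs_zero hnu).
Qed.
(** The matrix of multiplication by [z] has entries in the valuation ring, and [z] is a root of its
    characteristic polynomial. *)
Lemma integral_of_le z : nL z <= 1 -> integral_over_plus nu z.
Proof.
move=> z1; exists (char_poly (mulm z)); split; first exact: char_poly_monic.
  apply: char_poly_le1 => k l; rewrite mxE; apply: le_trans (nL_ub _ _) _.
  apply: le_trans (nLM _ _) _; rewrite mulr_ile1 ?nL_ge0 //.
  apply/nL_leP => // m; rewrite (co_uniq (a := delta_mx 0 k)).
    by rewrite mxE; case: (_ && _); rewrite ?(abs_one hnu) ?(abs_zero hnu).
  rewrite (bigD1 k) //= big1 ?addr0; first by rewrite mxE !eqxx scale1r.
  by move=> i ik; rewrite mxE (negPf ik) andbF scale0r.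
have Xz p : mulm (map_poly (in_alg L) p).[z] = \sum_(i < size p) p`_i *: mulm (z ^+ i).
  rewrite (horner_coef_wide (n := size p)) ?size_poly // -[RHS]addr0.
  have m0 : mulm 0 = 0 by have := mulm_lin (-1) 0 0; rewrite scaler0 addr0 scaleN1r addNr.
  rewrite -[X in _ + X]m0; elim: (index_enum _) => [|i s IH]; first by rewrite !big_nil add0r.
  by rewrite !big_cons -addrA -IH coef_map /= -scalerAl mul1r mulm_lin.
suff h : mulm (map_poly (in_alg L) (char_poly (mulm z))).[z] = 0.
  rewrite /root -[X in X == 0]mulr1 [1]coP mulr_sumr big1 // => k _.
  by rewrite -scalerAr mulmE h big1 ?scaler0 // => l _; rewrite mxE scale0r.
have mX i : mulm (z ^+ i) = iter i (mulmx (mulm z)) 1%:M.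
  by elim: i => [|i IH] /=; rewrite ?expr0 ?mulm1 // exprS mulmM IH.
rewrite Xz; under eq_bigr do rewrite mX.
move: (mulm z); clear; case: d => [|n] X; first by apply/matrixP => -[].
transitivity (horner_mx X (char_poly X)); last exact: Cayley_Hamilton.
rewrite -[X in horner_mx _ X](coefK (char_poly X)) poly_def rmorph_sum; apply: eq_bigr => i _.
rewrite /= horner_mxZ rmorphXn /= horner_mx_X; congr (_ *: _).
by elim: (nat_of_ord i) => [|m IH] /=; rewrite ?expr0 // exprS IH.
Qed.

Hypothesis happrox : forall z, 0 < nL z -> exists y, nL (z - y) < nL z /\ forall n, nL z ^+ n <= nL (y ^+ n).
(** [happrox] controls the powers of some [y] near [z] only. As [z ^ n - y ^ n] is a multiple of
    [z - y], its norm is below [nL z ^ n], and the bound passes from [y] to [z]. This leaves the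
    freedom to choose [y] of a convenient form. *)
Lemma nLX_ge z n : nL z ^+ n <= nL (z ^+ n).
Proof.
case: n => [|n].
  (* The claim is [1 <= nL 1]: otherwise [nL 1 <= nL 1 ^ 2] forces [nL 1 = 0], hence [1 = 0]. *)
  rewrite !expr0 leNgt; apply/negP => lt1; have := nLX 1 2; rewrite expr1n => h.
  have h0 : nL 1 = 0.
    apply/eqP; rewrite eq_le nL_ge0 andbT leNgt; apply/negP => h0.
    by move: h; rewrite expr2 leNgt gtr_pMr ?lt1.
  by have := oner_neq0 L; rewrite (nL_eq0 h0) eqxx.
have [z0|] := ltP 0 (nL z); last first.
  by move=> z0; have -> : nL z = 0 by [apply/le_anti; rewrite z0 nL_ge0]; rewrite expr0n nL_ge0.
have [y [hy hyn]] := happrox z0.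
have yz : nL y <= nL z.
  rewrite -[y](subKr z); apply: nL_add_le => //.
  by rewrite -scaleN1r nLZ (nabsN hnu) (abs_one hnu) mul1r ltW.
have : nL (z ^+ n.+1 - y ^+ n.+1) < nL z ^+ n.+1.
  rewrite subrXX exprS; apply: le_lt_trans (nLM _ _) _.
  apply: (@le_lt_trans _ _ (nL (z - y) * nL z ^+ n)).
    rewrite ler_wpM2l ?nL_ge0 //; apply: nL_sum_le => [|i _]; first by rewrite exprn_ge0 ?nL_ge0.
    apply: le_trans (nLM _ _) _; have -> : nL z ^+ n = nL z ^+ (n.+1.-1 - i) * nL z ^+ i by rewrite -exprD subnK // leq_ord.
    apply: ler_pM; rewrite ?nL_ge0 //; first exact: nLX.
    by apply: le_trans (nLX _ _) _; rewrite lerXn2r ?nnegrE ?nL_ge0.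
  by rewrite ltr_pM2r // exprn_gt0.
move=> h; rewrite leNgt; apply/negP => h'; have := hyn n.+1; rewrite leNgt => /negP; apply.
have [m] : exists m : R, [/\ m < nL z ^+ n.+1, nL (z ^+ n.+1 - y ^+ n.+1) <= m & nL (z ^+ n.+1) <= m].
  exists (Num.max (nL (z ^+ n.+1 - y ^+ n.+1)) (nL (z ^+ n.+1))).
  by rewrite gt_max h h' !le_max !lexx orbT.
case=> m1 m2 m3; apply: le_lt_trans m1.
rewrite -[y ^+ _](subKr (z ^+ n.+1)); apply: nL_add_le => //.
by rewrite -scaleN1r nLZ (nabsN hnu) (abs_one hnu) mul1r.
Qed.
Lemma le_of_integral z : integral_over_plus nu z -> nL z <= 1.
Proof.
move=> [p [mp p1 /eqP rp]]; rewrite leNgt; apply/negP => z1.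
have hs : (0 < size (map_poly (in_alg L) p))%N.
  by rewrite (size_map_poly_id0 (f := in_alg L)) ?size_poly_gt0 ?monic_neq0 // (monicP mp) /= scale1r oner_eq0.
have sp : size (map_poly (in_alg L) p) = size p.
  by rewrite (size_map_poly_id0 (f := in_alg L)) // (monicP mp) /= scale1r oner_eq0.
case en : (size p) hs sp => [|n] hs sp; first by rewrite sp in hs.
move: rp; rewrite horner_coef sp big_ord_recr coef_map /=.
have -> : p`_n = 1 by have := monicP mp; rewrite /lead_coef en.
rewrite scale1r mul1r => /eqP; rewrite addrC addr_eq0 => /eqP ez.
(* The integral equation expresses [z ^ n] by lower powers with coefficients of norm at most 1; for
   [nL z > 1] the resulting inequality is absurd. *)
have n1 : nL z ^+ n <= nL z ^+ n.-1.
  apply: le_trans (nLX_ge z n) _; rewrite ez -scaleN1r nLZ (nabsN hnu) (abs_one hnu) mul1r.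
  apply: nL_sum_le => [|i _]; first by rewrite exprn_ge0 ?nL_ge0.
  rewrite coef_map /= -scalerAl mul1r nLZ -[leRHS]mul1r.
  apply: ler_pM; rewrite ?(abs_ge0 hnu) ?nL_ge0 //; apply: le_trans (nLX _ _) _.
  by rewrite ler_weXn2l ?(ltW z1) //; have := ltn_ord i; lia.
case: n en {hs sp} ez n1 => [|n] en ez n1 /=; last by move: n1; rewrite leNgt ltr_eXn2l ?ltnSn.
by move/eqP: ez; rewrite expr0 big_ord0 oppr0 oner_eq0.
Qed.

Lemma det_le1 n (X : 'M[kap]_n) : (forall i j, nu (X i j) <= 1) -> nu (\det X) <= 1.
Proof. by move=> h; have := nabs_det_le hnu ler01 h; rewrite expr1n. Qed.

(** Both [e] and [f] generate the module of integral elements. The transition matrices are integral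
    and mutually inverse, so they are square with determinant of absolute value 1. *)
Lemma plus_basis_disc d' (e : 'I_d' -> L) (T : 'M[kap]_d') : is_plus_basis nu e -> is_trace_form_mx e T ->
  nu (\det T) = nu (\det (\matrix_(k < d, l < d) trL (f k * f l))).
Proof.
move=> [eint ebas] hT.
pose U : 'M[kap]_(d', d) := \matrix_i co (e i).
have U1 i k : nu (U i k) <= 1.
  by rewrite mxE; apply: le_trans (nL_ub _ _) _; exact: le_of_integral.
have eU i : e i = \sum_k U i k *: f k by rewrite {1}[e i]coP; apply: eq_bigr => k _; rewrite mxE.
have fint k : integral_over_plus nu (f k).
  apply: integral_of_le; apply/nL_leP => // m; rewrite (co_uniq (a := delta_mx 0 k)).
    by rewrite mxE; case: (_ && _); rewrite ?(abs_one hnu) ?(abs_zero hnu).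
  rewrite (bigD1 k) //= big1 ?addr0; first by rewrite mxE !eqxx scale1r.
  by move=> i ik; rewrite mxE (negPf ik) andbF scale0r.
have /choice[v hv] k : exists v : 'rV[kap]_d', (forall i, nu (v 0 i) <= 1) /\ f k = \sum_i v 0 i *: e i.
  by have [v [hv _]] := ebas _ (fint k); exists v.
pose V : 'M[kap]_(d, d') := \matrix_k v k.
have V1 k i : nu (V k i) <= 1 by rewrite mxE; exact: (hv k).1.
have fV k : f k = \sum_i V k i *: e i.
  by rewrite (hv k).2; apply: eq_bigr => i _; rewrite mxE.
have VU : V *m U = 1%:M.
  apply/row_matrixP => k; rewrite -[LHS](co_uniq (z := f k)).
    apply: co_uniq; rewrite (bigD1 k) //= big1 ?addr0; first by rewrite !mxE eqxx scale1r.
    by move=> i ik; rewrite !mxE eq_sym (negPf ik) scale0r.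
  rewrite {1}fV; under eq_bigr => i _ do rewrite eU scaler_sumr.
  rewrite exchange_big; apply: eq_bigr => l _; rewrite !mxE scaler_suml.
  by apply: eq_bigr => i _; rewrite scalerA.
(* Freeness of [e] is given as uniqueness of integral coordinates, so the identity is read off from
   two integral expressions of [e i]. *)
have UV : U *m V = 1%:M.
  apply/row_matrixP => i; have [c [_ cu]] := ebas _ (eint i).
  transitivity c.
    apply/esym/cu; split=> [l|].
      rewrite !mxE; apply: (nabs_sum hnu) => // k _.
      by rewrite (abs_mul hnu) mulr_ile1 ?(abs_ge0 hnu).
    rewrite {1}eU; under eq_bigr => k _ do rewrite fV scaler_sumr.
    rewrite exchange_big; apply: eq_bigr => l _; rewrite !mxE scaler_suml.
    by apply: eq_bigr => k _; rewrite scalerA.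
  apply: cu; split=> [l|]; first by rewrite !mxE; case: eqP; rewrite ?(abs_one hnu) ?(abs_zero hnu).
  rewrite (bigD1 i) //= big1 ?addr0; first by rewrite !mxE eqxx scale1r.
  by move=> l li; rewrite !mxE eq_sym (negPf li) scale0r.
have dd : d' = d by apply/eqP; rewrite eqn_leq (mulmx1_min UV) (mulmx1_min VU).
pose T' := \matrix_(k < d, l < d) trL (f k * f l).
have TT : T = U *m T' *m U^T.
  apply/matrixP => i l; have [M hM ->] := hT i l.
  have -> : \tr M = trL (e i * e l).
    (* [M] lists coordinates in columns and [mulm] in rows, whence the transpose. *)
    have h : M^T *m U = U *m mulm (e i * e l).
      apply/row_matrixP => k; rewrite -[LHS](co_uniq (z := e i * e l * e k)).
        apply: co_uniq; rewrite [in LHS](eU k) mulr_sumr.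
        rewrite (eq_bigr (fun m => \sum_n (U k m * mulm (e i * e l) m n) *: f n)); last first.
          move=> m _; rewrite -scalerAr mulmE scaler_sumr.
          by apply: eq_bigr => n _; rewrite scalerA.
        rewrite exchange_big; apply: eq_bigr => n _; rewrite !mxE scaler_suml.
        by apply: eq_bigr => m _.
      rewrite hM (eq_bigr (fun m => \sum_n (M m k * U m n) *: f n)); last first.
        by move=> m _; rewrite {1}eU scaler_sumr; apply: eq_bigr => n _; rewrite scalerA.
      rewrite exchange_big; apply: eq_bigr => n _; rewrite !mxE scaler_suml.
      by apply: eq_bigr => m _; rewrite [M^T k m]mxE.
    by rewrite -mxtrace_tr -[M^T]mulmx1 -UV mulmxA h mxtrace_mulC mulmxA VU mul1mx.
  rewrite {1}eU mulr_suml; under eq_bigr => k _ do rewrite -scalerAl.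
  rewrite trL_sum mxE -[RHS](eq_bigr _ (fun k _ => erefl)).
  transitivity (\sum_k \sum_m U i k * (U l m * T' k m)).
    apply: eq_bigr => k _; have -> : f k * e l = \sum_m U l m *: (f k * f m).
      by rewrite {1}eU mulr_sumr; apply: eq_bigr => m _; rewrite -scalerAr.
    by rewrite trL_sum mulr_sumr; apply: eq_bigr => m _; rewrite [T' k m]mxE.
  rewrite exchange_big; apply: eq_bigr => m _; rewrite !mxE mulr_suml.
  by apply: eq_bigr => k _; rewrite mulrA mulrAC.
move: U V U1 V1 {eU fV} VU UV TT; rewrite -/T'; move: T {hT}; move: e {eint ebas hv v}.
rewrite dd => _ T U V U1 V1 VU UV ->.
rewrite !det_mulmx det_tr !(abs_mul hnu) mulrAC.
suff -> : nu (\det U) = 1 by rewrite mul1r mul1r.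
apply/le_anti; rewrite det_le1 //=.
have : nu (\det U) * nu (\det V) = 1 by rewrite -(abs_mul hnu) -det_mulmx UV det1 (abs_one hnu).
by have := det_le1 V1; have := abs_ge0 hnu (\det U); have := abs_ge0 hnu (\det V); nra.
Qed.
End Submultiplicative.
End PlusBasis.

Section RealAux.
Variable R : realType.
Lemma cvg0P (u : nat -> R) : (u @ \oo --> (0 : R)) <->
  (forall e : R, 0 < e -> exists N, forall n, (N <= n)%N -> `|u n| < e).
Proof.
split=> [/cvgr0Pnorm_lt h e /h[N _ hN]|h].
  by exists N => n /hN.
apply/cvgr0Pnorm_lt => e /h[N hN].
by exists N => // n /= /hN.
Qed.
Lemma cvg_cst0 (c : R) (u : nat -> R) : (u @ \oo --> (0 : R)) ->
  (exists N, forall n, (N <= n)%N -> u n = c) -> c = 0.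
Proof.
move=> /cvg0P h [N hN]; apply/eqP; rewrite -normr_eq0; apply/eqP.
apply/le_anti; rewrite normr_ge0 andbT; apply/ler_addgt0Pl => e e0.
rewrite addr0; have [M hM] := h _ e0.
by rewrite -(hN (maxn N M)) ?leq_maxl // ltW // hM // leq_maxr.
Qed.
Lemma gt_ge0 (x y : R) : (forall e : R, 0 < e -> x <= y + e) -> x <= y.
Proof. by move=> h; apply/ler_addgt0Pr. Qed.
(** Bernoulli's inequality: for [s > 1 - e] the power [s ^ n] is at least [1 - n e], and [e] is
    chosen small with respect to [k]. *)
Lemma pow_near1 (q : R) k : q < 1 ->
  exists2 s0 : R, 0 <= s0 < 1 & forall s, s0 < s -> s <= 1 -> forall j, (j <= k)%N -> q < s ^+ j.
Proof.
move=> q1; have k0 : (0 : R) < k.+1%:R by rewrite ltr0n.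
pose e := Num.min (1 - q) 1 / k.+1%:R.
have e0 : 0 < e by rewrite divr_gt0 // lt_min subr_gt0 q1 ltr01.
have e1 : e <= 1.
  rewrite ler_pdivrMr // mul1r; apply: (@le_trans _ _ 1); first by rewrite ge_min lexx orbT.
  by rewrite ler1n.
exists (1 - e); first by rewrite subr_ge0 e1 /= gtrBl.
move=> s h s1 j jk.
have B n : 1 - e *+ n <= s ^+ n.
  have s0 : 0 <= s by apply: le_trans (ltW h); rewrite subr_ge0.
  elim: n => [|n IH]; first by rewrite mulr0n subr0 expr0.
  have [h0|h0] := leP 0 (1 - e *+ n).
    rewrite exprS; apply: le_trans (_ : (1 - e) * (1 - e *+ n) <= _).
      rewrite mulrBr mulr1 mulrBl mul1r mulrSr; have : 0 <= e * (e *+ n) by rewrite mulr_ge0 ?mulrn_wge0 ?ltW.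
      lra.
    by apply: ler_pM => //; rewrite ?subr_ge0 // ltW.
  apply: (@le_trans _ _ 0); last exact: exprn_ge0.
  by rewrite mulrSr; move: h0 e0; lra.
apply: lt_le_trans (B j).
rewrite ltrBrDl -ltrBrDr.
apply: le_lt_trans (_ : e *+ k < _).
  by rewrite ler_pMn2l.
apply: lt_le_trans (_ : e *+ k.+1 <= _); first by rewrite ltr_pMn2l.
by rewrite -mulr_natr /e divfK ?gt_eqF // ge_min lexx.
Qed.
End RealAux.

(** * Laurent series on the annulus and points of the cover *)

Section Annulus.
Variables (R : realType) (K : closedFieldType) (absK : K -> R).
Hypothesis hK : is_complete_rank1 absK.
Variables (a b : R) (ha : value_group absK a) (hb : value_group absK b).
Hypothesis hab : a < b.
Variables (A : comAlgType K) (coef : A -> int -> K).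
Hypothesis hA : is_annulus_algebra absK a b coef.
Let hN : is_nonarch_abs absK := rank1_abs hK.

Section Coefficients.
Implicit Types (f g : A) (r : R) (i l m n : int).

Lemma ann_a0 : 0 < a. Proof. exact: value_group_gt0 ha. Qed.
Lemma ann_b0 : 0 < b. Proof. exact: value_group_gt0 hb. Qed.

Lemma acoef0 n : coef 0 n = 0.
Proof.
have := ann_linear hA (-1) 0 0 n.
by rewrite scaler0 addr0 mulN1r => /eqP; rewrite addNr => /eqP.
Qed.
Lemma acoefD f g n : coef (f + g) n = coef f n + coef g n.
Proof. by have := ann_linear hA 1 f g n; rewrite scale1r mul1r. Qed.
Lemma acoefZ k f n : coef (k *: f) n = k * coef f n.
Proof. by have := ann_linear hA k f 0 n; rewrite addr0 acoef0 addr0. Qed.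
Lemma acoefN f n : coef (- f) n = - coef f n.
Proof. by rewrite -scaleN1r acoefZ mulN1r. Qed.
Lemma acoefB f g n : coef (f - g) n = coef f n - coef g n.
Proof. by rewrite acoefD acoefN. Qed.
Lemma acoef_sum (I : Type) (s : seq I) (P : pred I) (F : I -> A) n :
  coef (\sum_(i <- s | P i) F i) n = \sum_(i <- s | P i) coef (F i) n.
Proof. by apply: (big_morph (coef^~ n)) => [f g|]; [exact: acoefD|exact: acoef0]. Qed.
Lemma acoef1 n : coef 1 n = (n == 0)%:R. Proof. exact: (ann_one hA). Qed.
Lemma acoef_neq0 f : f != 0 -> exists n, coef f n != 0.
Proof.
move=> f0; apply: contrapT => h; case/eqP: f0; apply: (ann_inj hA) => n.
rewrite acoef0; apply/eqP; apply: contrapT => h'; apply: h; exists n; exact/negP.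
Qed.

Definition nrm r f i : R := absK (coef f i) * r ^ i.
Lemma nrm_ge0 r f i : 0 < r -> 0 <= nrm r f i.
Proof. by move=> r0; rewrite mulr_ge0 ?(abs_ge0 hN) // ltW // exprz_gt0. Qed.
Lemma in_gt0 r : a <= r -> 0 < r. Proof. exact: lt_le_trans ann_a0. Qed.

(** On [[a, b]] a term of index [n >= 0] is largest at [b] and one of negative index at [a], so
    convergence at the two boundary radii makes the tails small uniformly. *)
Lemma decay f (e : R) : 0 < e -> exists N : nat, forall r, a <= r <= b -> forall i,
  (N <= `|i|)%N -> nrm r f i < e.
Proof.
move=> e0.
have [/cvg0P h1 /cvg0P h2] : (fun n : nat => absK (coef f n%:Z) * b ^+ n) @ \oo --> (0 : R) /\
  (fun n : nat => absK (coef f (- n%:Z)) * a ^- n) @ \oo --> (0 : R).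
  by apply/(ann_range hA); exists f.
have [N1 hN1] := h1 _ e0; have [N2 hN2] := h2 _ e0.
exists (maxn N1 N2) => r /andP[ar rb] i.
have r0 := in_gt0 ar; rewrite /nrm; case: i => n /= hn.
  apply: le_lt_trans (_ : absK (coef f n%:Z) * b ^+ n < _).
    by rewrite ler_wpM2l ?(abs_ge0 hN) // -exprnP lerXn2r ?nnegrE ?(ltW r0) ?(ltW ann_b0).
  by apply: le_lt_trans (hN1 n _); [exact: ler_norm|apply: leq_trans hn; rewrite leq_maxl].
apply: le_lt_trans (_ : absK (coef f (- n.+1%:Z)) * a ^- n.+1 < _).
  rewrite ler_wpM2l ?(abs_ge0 hN) // /exprz /= lef_pV2 ?posrE ?exprn_gt0 ?ann_a0 //.
  by rewrite lerXn2r ?nnegrE ?(ltW r0) ?(ltW ann_a0).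
by apply: le_lt_trans (hN2 n.+1 _); [exact: ler_norm|apply: leq_trans hn; rewrite leq_maxr].
Qed.

Lemma nrm_bounded f r : a <= r <= b -> exists2 c, 0 < c & forall i, nrm r f i <= c.
Proof.
move=> rab; have [N hN'] := decay f ltr01.
have r0 : 0 < r by apply: in_gt0; case/andP: rab.
exists (1 + \sum_(i < N) (nrm r f i%:Z + nrm r f (- i%:Z))).
  by rewrite ltr_pwDl // sumr_ge0 // => i _; rewrite addr_ge0 ?nrm_ge0.
move=> i; have [h|h] := ltnP `|i| N; last first.
  apply: le_trans (ltW (hN' _ rab _ h)) _.
  by rewrite lerDl sumr_ge0 // => j _; rewrite addr_ge0 ?nrm_ge0.
rewrite (bigD1 (Ordinal h)) //=.
have : nrm r f i <= nrm r f `|i|%N%:Z + nrm r f (- `|i|%N%:Z).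
  case: i {h} => n /=; first by rewrite lerDl nrm_ge0.
  by rewrite NegzE lerDr nrm_ge0.
have : 0 <= \sum_(j < N | j != Ordinal h) (nrm r f j%:Z + nrm r f (- j%:Z)).
  by rewrite sumr_ge0 // => j _; rewrite addr_ge0 ?nrm_ge0.
lra.
Qed.

Definition vterm r f i : val2 R :=
  if coef f i == 0 then None else Some (nrm r f i, i%:~R).

Lemma vterm_maxP f r : a <= r <= b -> f != 0 ->
  exists2 m, coef f m != 0 & forall i, (vterm r f i <= vterm r f m)%O.
Proof.
move=> rab f0; have r0 : 0 < r by apply: in_gt0; case/andP: rab.
have [i0 hi0] := acoef_neq0 f0.
have e0 : 0 < nrm r f i0 by rewrite mulr_gt0 ?exprz_gt0 // (nabs_gt0 hN).
have [N hN'] := decay f e0.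
have i0N : (`|i0| < N)%N.
  by rewrite ltnNge; apply/negP => /(hN' _ rab); rewrite ltxx.
pose t (j : 'I_N.*2.+1) : int := j%:Z - N%:Z.
have tP i : (`|i| < N)%N -> exists j, t j = i.
  move=> hi; have hj : (absz (i + N%:Z)%R < N.*2.+1)%N by lia.
  by exists (Ordinal hj); rewrite /t /=; lia.
have [j0 tj0] := tP _ i0N.
case: (@arg_maxP _ _ _ j0 xpredT (fun j => vterm r f (t j))) => // m _ hm.
have h0 : (vterm r f i0 <= vterm r f (t m))%O by rewrite -tj0; apply: hm.
have m0 : coef f (t m) != 0.
  apply/negP => h; move: h0; rewrite {2}/vterm h vle_Nnone.
  by rewrite /vterm (negPf hi0).
exists (t m) => // i; have [hi|hi] := ltnP `|i| N.
  by have [j <-] := tP _ hi; apply: hm.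
apply: le_trans h0; rewrite /vterm (negPf hi0); case: ifP => // _.
by rewrite vle_some hN'.
Qed.

Lemma etaP f r : a <= r <= b -> f != 0 ->
  exists m, [/\ coef f m != 0, Defs.eta absK coef r f = Some (nrm r f m, m%:~R)
              & forall i, (vterm r f i <= Defs.eta absK coef r f)%O].
Proof.
move=> rab f0; have [m m0 hm] := vterm_maxP rab f0.
suff e : Defs.eta absK coef r f = vterm r f m.
  by exists m; rewrite e {1}/vterm (negPf m0).
have E : is_vmax (range (fun i : int =>
    if coef f i == 0 then None else Some (absK (coef f i) * r ^ i, i%:~R))) (vterm r f m).
  by split; [exists m|move=> _ [i _ <-]; exact: hm].
have [[i _ ei] h] : is_vmax (range (fun i : int =>
    if coef f i == 0 then None else Some (absK (coef f i) * r ^ i, i%:~R))) (Defs.eta absK coef r f).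
  by rewrite /eta /vmax; apply: xgetPex; exists (vterm r f m).
apply/le_anti/andP; split; first by rewrite -ei; exact: hm.
by apply: h; exists m.
Qed.

Lemma eta_lead f r : a <= r <= b -> f != 0 ->
  exists m, [/\ coef f m != 0, Defs.eta absK coef r f = Some (nrm r f m, m%:~R),
    forall i, nrm r f i <= nrm r f m & forall i, (i < m)%R -> nrm r f i < nrm r f m].
Proof.
move=> rab f0; have r0 : 0 < r by apply: in_gt0; case/andP: rab.
have [m [m0 em hm]] := etaP rab f0; exists m; split=> // i.
  move: (hm i); rewrite em /vterm; case: eqP => [e _|_].
    by rewrite {1}/nrm e (abs_zero hN) mul0r nrm_ge0.
  by rewrite vle_some => /orP[/ltW//|/andP[/eqP->]].
move=> im; move: (hm i); rewrite em /vterm; case: eqP => [e _|_].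
  by rewrite {1}/nrm e (abs_zero hN) mul0r mulr_gt0 ?exprz_gt0 // (nabs_gt0 hN).
rewrite vle_some => /orP[//|/andP[_]].
by rewrite ler_int leNgt im.
Qed.

Lemma gauss_max f r m : (forall i, nrm r f i <= nrm r f m) ->
  gauss absK coef r f = nrm r f m.
Proof.
move=> h; apply/le_anti/andP; split.
  by apply: ge_sup; [exists (nrm r f m); exists m|move=> _ [i _ <-]; exact: h].
apply: ub_le_sup; last by exists m.
by exists (nrm r f m) => _ [i _ <-]; exact: h.
Qed.
Lemma gauss_ub f r i : a <= r <= b -> nrm r f i <= gauss absK coef r f.
Proof.
move=> /(nrm_bounded f)[c _ hc]; apply: ub_le_sup; last by exists i.
by exists c => _ [j _ <-]; exact: hc.
Qed.

(** The coefficient is a limit of finite sums, each of which obeys the ultrametric inequality; the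
    error [e] absorbs the passage to the limit. *)
Lemma coef_mul_le f g r c n : 0 < r ->
  (forall i, nrm r f i * nrm r g (n - i) <= c) -> nrm r (f * g) n <= c.
Proof.
move=> r0 h; have c0 : 0 <= c.
  by apply: le_trans (h 0); rewrite mulr_ge0 ?nrm_ge0.
have rn0 : 0 < r ^ n by rewrite exprz_gt0.
rewrite /nrm -ler_pdivlMr //; apply: gt_ge0 => e e0.
have /cvg0P/(_ _ e0)[N /(_ N (leqnn N))] := ann_mul hA f g n.
set S := \sum_(_ < _) _ => hS.
have SS : absK S <= c / r ^ n.
  apply: (nabs_sum hN) => [|i _]; first by rewrite divr_ge0 // ltW.
  rewrite ler_pdivlMr // (abs_mul hN); apply: le_trans (h (i%:Z - N%:Z)).
  set k := _ - _; rewrite /nrm mulrACA -expfzDr ?gt_eqF //.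
  by rewrite (_ : k + (n - k) = n) //; lia.
rewrite -[coef _ _](subrK S); apply: le_trans (abs_add hN _ _) _.
rewrite ge_max; apply/andP; split.
  have := ler_norm (absK (coef (f * g) n - S)).
  have : 0 <= c / r ^ n by rewrite divr_ge0 // ltW.
  move: hS; lra.
by move: SS e0; lra.
Qed.

Lemma mono_ex m : exists f, forall n, coef f n = (n == m)%:R.
Proof.
have [|f hf] := (ann_range hA (fun n => (n == m)%:R)).2; last by exists f.
split; apply/cvg0P => e e0; exists `|m|.+1 => n hn.
  by rewrite (_ : (n%:Z == m) = false) ?(abs_zero hN) ?mul0r ?normr0 //; lia.
by rewrite (_ : (- n%:Z == m) = false) ?(abs_zero hN) ?mul0r ?normr0 //; lia.
Qed.
Definition xi m : A := sval (cid (mono_ex m)).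
Lemma coef_xi m n : coef (xi m) n = (n == m)%:R.
Proof. by rewrite /xi; case: cid. Qed.
Lemma coef_xiM m g n : coef (xi m * g) n = coef g (n - m).
Proof.
apply/subr0_eq/(abs_eq0 hN)/(cvg_cst0 (ann_mul hA (xi m) g n)).
exists `|m|%N => N hN'.
have hj : (absz (m + N%:Z)%R < N.*2.+1)%N by lia.
congr (absK (_ - _)); rewrite (bigD1 (Ordinal hj)) //= big1 ?addr0.
  by rewrite coef_xi (_ : _ == m = true) ?mul1r; [congr (coef g _)|]; lia.
move=> i /eqP hi; rewrite coef_xi (_ : _ == m = false) ?mul0r //.
by apply/negP => /eqP h; apply: hi; apply/val_inj => /=; lia.
Qed.
Lemma xi0 : xi 0 = 1.
Proof. by apply: (ann_inj hA) => n; rewrite coef_xi acoef1. Qed.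
Lemma xiD m n : xi (m + n) = xi m * xi n.
Proof.
apply: (ann_inj hA) => l; rewrite coef_xiM !coef_xi; congr (nat_of_bool _)%:R.
by apply/eqP/eqP; lia.
Qed.
Lemma xi_neq0 m : xi m != 0.
Proof.
apply/negP => /eqP h; have := coef_xi m m.
by rewrite h acoef0 eqxx => /esym/eqP; rewrite oner_eq0.
Qed.

Definition trunc (N : nat) f : A :=
  \sum_(i < N.*2.+1) coef f (i%:Z - N%:Z) *: xi (i%:Z - N%:Z).
Lemma coef_trunc N f n : coef (trunc N f) n = if (`|n| <= N)%N then coef f n else 0.
Proof.
rewrite acoef_sum; case: ifP => h; last first.
  rewrite big1 // => i _; rewrite acoefZ coef_xi (_ : _ == _ = false) ?mulr0 //.
  by apply/negP => /eqP e; move: h; rewrite e; have := ltn_ord i; lia.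
have hj : (absz (n + N%:Z)%R < N.*2.+1)%N by lia.
rewrite (bigD1 (Ordinal hj)) //= big1 ?addr0.
  rewrite acoefZ coef_xi (_ : (absz (n + N%:Z))%:Z - N%:Z = n) ?eqxx ?mulr1 //; lia.
move=> i /eqP hi; rewrite acoefZ coef_xi (_ : _ == _ = false) ?mulr0 //.
by apply/negP => /eqP e; apply: hi; apply/val_inj => /=; lia.
Qed.
Lemma trunc_approx f (e : R) : 0 < e -> exists N0, forall N, (N0 <= N)%N ->
  forall r, a <= r <= b -> forall i, nrm r (f - trunc N f) i < e.
Proof.
move=> e0; have [N hN'] := decay f e0.
exists N => M hM r rab i; rewrite /nrm acoefB coef_trunc; case: ifP => h.
  by rewrite subrr (abs_zero hN) mul0r.
by rewrite subr0; apply: hN' => //; lia.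
Qed.
End Coefficients.

(** * Evaluation on the circle of radius r *)

Variables (r : R) (hr : value_group absK r) (har : a < r) (hrb : r <= b).
Section Evaluations.
Implicit Types (f g : A) (i l m n : int).
Lemma rab : a <= r <= b. Proof. by rewrite ltW. Qed.
Lemma r_gt0 : 0 < r. Proof. exact: value_group_gt0 hr. Qed.

Lemma gaussP f : f != 0 -> exists2 m, coef f m != 0 & gauss absK coef r f = nrm r f m.
Proof.
move=> f0; have [m [m0 _ h _]] := eta_lead rab f0.
by exists m => //; apply: gauss_max.
Qed.
Lemma gauss_gt0 f : f != 0 -> 0 < gauss absK coef r f.
Proof.
move=> /gaussP[m m0 ->].
by rewrite mulr_gt0 ?(nabs_gt0 hN) // exprz_gt0 // r_gt0.
Qed.
Lemma gauss0 : gauss absK coef r 0 = 0.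
Proof.
rewrite (@gauss_max _ _ 0); last by move=> i; rewrite /nrm !acoef0 (abs_zero hN) !mul0r.
by rewrite /nrm acoef0 (abs_zero hN) mul0r.
Qed.
Lemma gauss_ge0 f : 0 <= gauss absK coef r f.
Proof. by apply: le_trans (gauss_ub f 0 rab); rewrite nrm_ge0 // r_gt0. Qed.

Section Evaluation.
Variable x0 : K.
Hypothesis hx0 : absK x0 = r.

Lemma x0_neq0 : x0 != 0.
Proof.
by apply/eqP => e; have := r_gt0; rewrite -hx0 e (abs_zero hN) ltxx.
Qed.
Lemma abs_x0 i : absK (x0 ^ i) = r ^ i.
Proof. by case: i => n; rewrite /exprz /= ?(nabsV hN) (nabsX hN) hx0. Qed.
Lemma abs_cx0 f i : absK (coef f i * x0 ^ i) = nrm r f i.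
Proof. by rewrite (abs_mul hN) abs_x0. Qed.

Definition evs (N : nat) f : K := coef f 0 +
  \sum_(n < N) (coef f n.+1%:Z * x0 ^ n.+1%:Z + coef f (- n.+1%:Z) * x0 ^ (- n.+1%:Z)).

Lemma evs_le N f c : (forall i, nrm r f i <= c) -> absK (evs N f) <= c.
Proof.
move=> h; have c0 : 0 <= c by apply: le_trans (h 0); rewrite nrm_ge0 // r_gt0.
apply: (nabs_addle hN).
  by apply: le_trans (h 0); rewrite /nrm expr0z mulr1.
by apply: (nabs_sum hN) => // n _; apply: (nabs_addle hN); rewrite abs_cx0.
Qed.

Lemma evsP N k f g : evs N (k *: f + g) = k * evs N f + evs N g.
Proof.
rewrite /evs mulrDr mulr_sumr [RHS]addrACA -big_split /= (ann_linear hA); congr (_ + _).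
by apply: eq_bigr => n _; rewrite !(ann_linear hA); ring.
Qed.

Lemma evs_cvg f : exists c, forall e : R, 0 < e ->
  exists N : nat, forall n : nat, (N <= n)%N -> absK (evs n f - c) < e.
Proof.
have [|c hc] := @rank1_complete _ _ _ hK (evs^~ f).
  move=> e e0; have [N hN'] := decay f e0; exists N.
  have h (n : nat) : absK (evs (N + n)%N f - evs N f) < e.
    elim: n => [|n IH]; first by rewrite addn0 subrr (abs_zero hN).
    rewrite addnS.
    have -> (M : nat) : evs M.+1 f = evs M f +
        (coef f M.+1%:Z * x0 ^ M.+1%:Z + coef f (- M.+1%:Z) * x0 ^ (- M.+1%:Z)).
      by rewrite /evs big_ord_recr addrA.
    rewrite addrAC; apply: (nabs_addlt hN) => //.
    by apply: (nabs_addlt hN); rewrite abs_cx0 hN' ?rab //; lia.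
  move=> m n hm hn; rewrite -(subrKA (evs N f)) -(subnKC hm) -(subnKC hn).
  by apply: (nabs_addlt hN) => //; rewrite (nabs_subC hN).
exists c => e e0; have /cvg0P/(_ _ e0)[N hN'] := hc.
by exists N => n hn; apply: le_lt_trans (hN' n hn); exact: ler_norm.
Qed.

Definition ev f : K := sval (cid (evs_cvg f)).
Lemma evP f (e : R) : 0 < e -> exists N : nat, forall n : nat, (N <= n)%N -> absK (evs n f - ev f) < e.
Proof. by rewrite /ev; case: cid => c /= h; exact: h. Qed.
Lemma ev_uniq f c : (forall e : R, 0 < e -> exists N : nat, forall n : nat, (N <= n)%N ->
  absK (evs n f - c) < e) -> ev f = c.
Proof.
move=> h; apply/subr0_eq/(abs_eq0 hN)/le_anti; rewrite (abs_ge0 hN) andbT.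
apply: gt_ge0 => e e0; rewrite add0r.
have [N1 h1] := h _ e0; have [N2 h2] := evP f e0.
rewrite -(subrKA (evs (maxn N1 N2) f)); apply/ltW/(nabs_addlt hN).
  by rewrite (nabs_subC hN) h2 // leq_maxr.
by rewrite h1 // leq_maxl.
Qed.
Lemma ev_lin k f g : ev (k *: f + g) = k * ev f + ev g.
Proof.
apply: ev_uniq => e e0.
have ek : 0 < e / (1 + absK k) by rewrite divr_gt0 // ltr_pwDl ?(abs_ge0 hN).
have [N1 h1] := evP f ek; have [N2 h2] := evP g e0.
exists (maxn N1 N2) => n; rewrite geq_max => /andP[n1 n2].
rewrite evsP opprD addrACA -mulrBr; apply: (nabs_addlt hN); last exact: h2.
rewrite (abs_mul hN).
have := h1 _ n1; rewrite ltr_pdivlMr ?ltr_pwDl ?(abs_ge0 hN) // => h.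
apply: le_lt_trans h; rewrite mulrC ler_wpM2l ?(abs_ge0 hN) //.
by rewrite lerDr.
Qed.
Lemma ev0 : ev 0 = 0.
Proof.
have := ev_lin (-1) 0 0.
by rewrite scaler0 addr0 mulN1r => /eqP; rewrite addNr => /eqP.
Qed.
Lemma evD f g : ev (f + g) = ev f + ev g.
Proof. by have := ev_lin 1 f g; rewrite scale1r mul1r. Qed.
Lemma evZ k f : ev (k *: f) = k * ev f.
Proof. by have := ev_lin k f 0; rewrite addr0 ev0 addr0. Qed.
Lemma evB f g : ev (f - g) = ev f - ev g.
Proof. by rewrite -scaleN1r addrC ev_lin mulN1r addrC. Qed.
Lemma ev_sum (I : Type) (s : seq I) (P : pred I) (F : I -> A) :
  ev (\sum_(i <- s | P i) F i) = \sum_(i <- s | P i) ev (F i).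
Proof. by apply: (big_morph ev) => [f g|]; [exact: evD|exact: ev0]. Qed.
Lemma ev_le f c : (forall i, nrm r f i <= c) -> absK (ev f) <= c.
Proof.
move=> h; apply: gt_ge0 => e e0; have [N hN'] := evP f e0.
have c0 : 0 <= c by apply: le_trans (h 0); rewrite nrm_ge0 // r_gt0.
rewrite -[ev f](subKr (evs N f)); apply: (nabs_suble hN).
  by apply: le_trans (evs_le N h) _; rewrite lerDl ltW.
by apply: le_trans (ltW (hN' N (leqnn N))) _; rewrite lerDr.
Qed.
Lemma ev_xi m : ev (xi m) = x0 ^ m.
Proof.
apply: ev_uniq => e e0; exists `|m|%N => N hN'.
suff -> : evs N (xi m) = x0 ^ m by rewrite subrr (abs_zero hN).
rewrite /evs coef_xi; case: m hN' => [[|m]|m] /= hN'.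
- rewrite big1 ?addr0 ?expr0z // => n _; rewrite !coef_xi.
  have -> : (n.+1%:Z == 0) = false by lia.
  have -> : (- n.+1%:Z == 0) = false by lia.
  by rewrite !mul0r addr0.
- rewrite add0r (bigD1 (Ordinal hN')) //= !coef_xi eqxx mul1r.
  have -> : (- m.+1%:Z == m.+1%:Z) = false by lia.
  rewrite mul0r addr0 big1 ?addr0 // => i /eqP hi; rewrite !coef_xi.
  have -> : (- i.+1%:Z == m.+1%:Z) = false by lia.
  have -> : (i.+1%:Z == m.+1%:Z) = false.
    by apply/negP => /eqP[h]; apply: hi; apply/val_inj.
  by rewrite !mul0r addr0.
- rewrite add0r (bigD1 (Ordinal hN')) //= !coef_xi NegzE eqxx mul1r.
  have -> : (m.+1%:Z == - m.+1%:Z) = false by lia.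
  rewrite mul0r add0r big1 ?addr0 // => i /eqP hi; rewrite !coef_xi.
  have -> : (i.+1%:Z == - m.+1%:Z) = false by lia.
  have -> : (- i.+1%:Z == - m.+1%:Z) = false.
    by apply/negP => /eqP/oppr_inj[h]; apply: hi; apply/val_inj.
  by rewrite !mul0r addr0.
Qed.
Lemma ev1 : ev 1 = 1. Proof. by rewrite -xi0 ev_xi expr0z. Qed.
Lemma ev_trunc N f : ev (trunc N f) =
  \sum_(i < N.*2.+1) coef f (i%:Z - N%:Z) * x0 ^ (i%:Z - N%:Z).
Proof. by rewrite ev_sum; apply: eq_bigr => i _; rewrite evZ ev_xi. Qed.

(** The identity is exact on Laurent polynomials, by [xiD]. Truncating both factors changes each
    side by at most [e], the bounds [c1] and [c2] controlling the factor that is not truncated. *)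
Lemma evM f g : ev (f * g) = ev f * ev g.
Proof.
have [c1 c10 h1] := nrm_bounded f rab; have [c2 c20 h2] := nrm_bounded g rab.
apply/subr0_eq/(abs_eq0 hN)/le_anti; rewrite (abs_ge0 hN) andbT.
apply: gt_ge0 => e e0; rewrite add0r.
pose d := Num.min (Num.min (e / c1) (e / c2)) c1.
have d0 : 0 < d by rewrite !lt_min c10 !divr_gt0.
have dc1 : d * c1 <= e by rewrite -ler_pdivlMr // /d !ge_min lexx.
have dc2 : d * c2 <= e by rewrite -ler_pdivlMr // /d !ge_min lexx !orbT.
have dc : d <= c1 by rewrite ge_min lexx orbT.
have [N1 hN1] := trunc_approx f d0; have [N2 hN2] := trunc_approx g d0.
pose N := maxn N1 N2; pose f' := trunc N f; pose g' := trunc N g.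
have hf i : nrm r (f - f') i <= d by rewrite ltW // hN1 ?rab ?leq_maxl.
have hg i : nrm r (g - g') i <= d by rewrite ltW // hN2 ?rab ?leq_maxr.
have hf' i : nrm r f' i <= c1.
  rewrite /nrm coef_trunc; case: ifP => _; first exact: h1.
  by rewrite (abs_zero hN) mul0r ltW.
have E : ev (f' * g') = ev f' * ev g'.
  rewrite mulr_suml [ev g']ev_sum ev_sum ev_sum mulr_suml; apply: eq_bigr => i _.
  rewrite mulr_sumr ev_sum mulr_sumr; apply: eq_bigr => j _.
  rewrite -scalerAl -scalerAr -xiD !evZ !ev_xi expfzDr ?x0_neq0 //; ring.
have n0 q i : 0 <= nrm r q i by rewrite nrm_ge0 // r_gt0.
have -> : ev (f * g) - ev f * ev g =
  ev ((f - f') * g) + ev (f' * (g - g')) - (ev (f - f') * ev g + ev f' * ev (g - g')).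
  by rewrite !evB mulrBl mulrBr !evB E; ring.
apply: (nabs_suble hN); apply: (nabs_addle hN).
- apply: ev_le => n; apply: (coef_mul_le r_gt0) => i.
  by apply: le_trans dc2; apply: ler_pM.
- apply: ev_le => n; apply: (coef_mul_le r_gt0) => i.
  by apply: le_trans dc1; rewrite mulrC; apply: ler_pM.
- rewrite (abs_mul hN); apply: le_trans dc2.
  by apply: ler_pM; rewrite ?(abs_ge0 hN) // ev_le.
- rewrite (abs_mul hN) mulrC; apply: le_trans dc1.
  by apply: ler_pM; rewrite ?(abs_ge0 hN) // ev_le.
Qed.
HB.instance Definition _ := GRing.isZmodMorphism.Build A K ev evB.
HB.instance Definition _ := GRing.isMonoidMorphism.Build A K ev (ev1, evM).
Lemma ev_gauss f : absK (ev f) <= gauss absK coef r f.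
Proof. by apply: ev_le => i; apply: gauss_ub; exact: rab. Qed.
End Evaluation.

(** On the circle write [x0 = rho * u]. Up to a factor of absolute value 1, a truncated series is a
    polynomial in the unit [u], whose Gauss norm is attained for generic [u]; the truncation error
    is at most half of that norm. *)
Lemma ev_generic (fs : seq A) : exists x0 (hx0 : absK x0 = r),
  forall f, f \in fs -> absK (ev hx0 f) = gauss absK coef r f.
Proof.
have [N hN'] : exists N, forall f, f \in fs -> f != 0 ->
   forall i, nrm r (f - trunc N f) i < gauss absK coef r f / 2.
  suff [N hN'] : exists N0, forall N, (N0 <= N)%N -> forall f, f \in fs -> f != 0 ->
     forall i, nrm r (f - trunc N f) i < gauss absK coef r f / 2 by exists N; apply: hN'.
  elim: fs => [|f fs [N0 IH]]; first by exists 0%N.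
  have [f0|f0] := eqVneq f 0.
    exists N0 => N h g; rewrite in_cons => /predU1P[-> /eqP //|gs g0]; exact: IH.
  have [N1 h1] := trunc_approx f (divr_gt0 (gauss_gt0 f0) (ltr0n _ 2)).
  exists (maxn N0 N1) => N; rewrite geq_max => /andP[n1 n2] g.
  rewrite in_cons => /predU1P[-> _|gs g0] i; last exact: IH.
  by apply: h1 => //; exact: rab.
have [rho /= rho0 hrho] := hr.
pose P f : {poly K} := \poly_(i < N.*2.+1) (coef f (i%:Z - N%:Z) * rho ^ (i%:Z - N%:Z)).
have [u u1 hu] := poly_unit_generic hN [seq P f | f <- fs].
have hx0 : absK (rho * u) = r by rewrite (abs_mul hN) hrho u1 mulr1.
have u0 : u != 0 by apply/eqP => e; move: u1; rewrite e (abs_zero hN) => /eqP; rewrite eq_sym oner_eq0.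
exists (rho * u), hx0 => f ffs.
apply/le_anti; rewrite ev_gauss /=.
have [->|f0] := eqVneq f 0; first by rewrite gauss0 (abs_ge0 hN).
have hlt : absK (ev hx0 (f - trunc N f)) < gauss absK coef r f.
  apply: le_lt_trans (_ : gauss absK coef r f / 2 < _).
    by apply: ev_le => i; apply/ltW/hN'.
  by have := gauss_gt0 f0; lra.
have [m m0 em] := gaussP f0.
have mN : (`|m| <= N)%N.
  rewrite leqNgt; apply/negP => h.
  have := hN' f ffs f0 m; rewrite /nrm acoefB coef_trunc leqNgt h /= subr0 -/(nrm r f m) -em.
  by have := gauss_gt0 f0; lra.
have : gauss absK coef r f <= absK (ev hx0 (trunc N f)).
  have -> : ev hx0 (trunc N f) = u ^ (- N%:Z) * (P f).[u].
    rewrite ev_trunc horner_poly mulr_sumr; apply: eq_bigr => i _.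
    have -> : u ^+ i = u ^ N%:Z * u ^ (i%:Z - N%:Z).
      by rewrite -expfzDr // addrC subrK.
    have : u ^ (- N%:Z) * u ^ N%:Z = 1 by rewrite -expfzDr // addNr expr0z.
    rewrite expfzMl; set v := u ^ _; set t := u ^ N%:Z; set z := u ^ _ => h.
    rewrite [in RHS]mulrA mulrA -mulrA [RHS]mulrA; rewrite -[LHS]mul1r -h; ring.
  rewrite (abs_mul hN) (_ : absK (u ^ _) = 1) ?mul1r; last first.
    by rewrite /exprz; case: N {hN' P hu mN hlt} => [|N] /=; rewrite ?(nabsV hN) (nabsX hN) u1 expr1n ?invr1.
  have hj : (absz (m + N%:Z)%R < N.*2.+1)%N by lia.
  have := hu (P f) (absz (m + N%:Z)) (map_f _ ffs).
  rewrite coef_poly hj (_ : (absz (m + N%:Z))%:Z - N%:Z = m); last lia.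
  by rewrite (abs_mul hN) em /nrm abs_x0.
move=> h; rewrite -[f](subrK (trunc N f)) evD.
by rewrite (nabs_dom hN) ?(lt_le_trans hlt h) // subrK.
Qed.
End Evaluations.

(** * The Galois cover and its points over the circle *)

Variables (B : comAlgType A) (gT : finGroupType) (act : gT -> {lrmorphism B -> B}).
Hypothesis hB : is_galois_cover act.
Implicit Types (c d : B) (s g : gT) (f : A).

Lemma act_alg s f : act s f%:A = f%:A.
Proof. by rewrite linearZ /= rmorph1. Qed.
Lemma in_algB_inj : injective (in_alg B).
Proof.
move=> f g /= e; apply/eqP; rewrite -subr_eq0; apply/eqP/(gal_inj hB).
by rewrite scalerBl e subrr.
Qed.

Definition chiB c : {poly B} := \prod_(z <- [seq act g c | g : gT]) ('X - z%:P).
Lemma chi_ex c : exists P : {poly A}, map_poly (in_alg B) P = chiB c.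
Proof.
have inv s : map_poly (act s) (chiB c) = chiB c.
  rewrite /chiB rmorph_prod !big_image /= [RHS](reindex_inj (mulgI s)).
  apply: eq_bigr => g _.
  by rewrite rmorphB /= map_polyX map_polyC /= (gal_actM hB).
have /choice[P hP] i : exists f : A, (chiB c)`_i = f%:A.
  by apply: (gal_inv hB) => s; rewrite -coef_map inv.
exists (\poly_(i < size (chiB c)) P i); apply/polyP => i.
rewrite coef_map coef_poly; case: ltnP => h /=; first by rewrite hP.
by rewrite scale0r nth_default.
Qed.
Definition chi c : {poly A} := sval (cid (chi_ex c)).
Lemma chiE c : map_poly (in_alg B) (chi c) = chiB c.
Proof. by rewrite /chi; case: cid. Qed.
Lemma size_chi c : size (chi c) = #|gT|.+1.
Proof.
rewrite -(size_map_inj_poly in_algB_inj) ?rmorph0 // chiE /chiB.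
by rewrite size_prod_XsubC size_map -cardE.
Qed.
Lemma chi_monic c : chi c \is monic.
Proof.
rewrite monicE; apply/eqP/in_algB_inj; rewrite /lead_coef size_chi.
have /= := congr1 (fun P : {poly B} => P`_#|gT|) (chiE c); rewrite coef_map /= => ->.
rewrite /= scale1r.
have := monic_prod_XsubC [seq act g c | g : gT] xpredT id.
by rewrite monicE /lead_coef size_prod_XsubC size_map -cardE => /eqP.
Qed.
Lemma chi_map (F : comNzRingType) (p : {rmorphism B -> F}) c :
  map_poly (p \o in_alg B) (chi c) = \prod_(z <- [seq p (act g c) | g : gT]) ('X - z%:P).
Proof.
rewrite map_poly_comp chiE rmorph_prod !big_image; apply: eq_bigr => g _.
by rewrite rmorphB /= map_polyX map_polyC.
Qed.

(** After exchanging the sums the Galois relation kills all terms with [s != 1]. So the [u i] and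
    [v i] are dual systems for the trace. *)
Lemma gal_span : exists n (u v : 'I_n -> B),
  (forall s, \sum_i u i * act s (v i) = (s == 1%g)%:R) /\
  forall c, c = \sum_i u i * \sum_s act s (v i * c).
Proof.
have [n [u [v h]]] := gal_etale hB; exists n, u, v; split=> // c.
under eq_bigr do rewrite mulr_sumr.
rewrite exchange_big /= (bigD1 1%g) //= [X in _ + X]big1 ?addr0.
  under eq_bigr do rewrite rmorphM /= mulrA.
  by rewrite -mulr_suml h eqxx mul1r (gal_act1 hB).
move=> s /negPf s1; under eq_bigr do rewrite rmorphM /= mulrA.
by rewrite -mulr_suml h s1 mul0r.
Qed.
Lemma trace_alg c : exists f : A, \sum_s act s c = f%:A.
Proof.
apply: (gal_inv hB) => s; rewrite rmorph_sum /= [RHS](reindex_inj (mulgI s)).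
by apply: eq_bigr => t _; rewrite (gal_actM hB).
Qed.
Lemma fin_span : exists n (u : 'I_n -> B), forall c, exists m : 'I_n -> A,
  c = \sum_i (m i)%:A * u i.
Proof.
have [n [u [v [_ h]]]] := gal_span; exists n, u => c.
have /choice[m hm] i := trace_alg (v i * c).
by exists m; rewrite {1}[c]h; apply: eq_bigr => i _; rewrite hm mulrC.
Qed.

Lemma algM f (h : A) : (f * h)%:A = f%:A * h%:A :> B.
Proof. by rewrite -scalerAl mul1r scalerA. Qed.

Definition kB (k : K) : B := (k%:A : A)%:A.
Lemma kBM k l : kB (k * l) = kB k * kB l.
Proof. by rewrite /kB -algM -scalerAl mul1r scalerA. Qed.
Lemma kB1 : kB 1 = 1. Proof. by rewrite /kB !scale1r. Qed.
Lemma kB0 : kB 0 = 0. Proof. by rewrite /kB !scale0r. Qed.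
Lemma kBB (k l : K) : kB (k - l) = kB k - kB l. Proof. by rewrite /kB !scalerBl. Qed.
HB.instance Definition _ := GRing.isZmodMorphism.Build K B kB kBB.
HB.instance Definition _ := GRing.isMonoidMorphism.Build K B kB (kB1, kBM).
Lemma kBN k : kB (- k) = - kB k. Proof. by rewrite /kB !scaleNr. Qed.

Section ExtendEvaluation.
Variable x0 : K.
Hypothesis hx0 : absK x0 = r.
Local Notation ev := (ev hx0).

(** Proper ideals of the fibre of [B] over [x0], viewed as ideals of [B] that contain the kernel of
    [ev]. *)
Definition proper_ideal (P : B -> Prop) : Prop :=
  [/\ forall c d, P c -> P d -> P (c + d), forall c d, P d -> P (c * d), ~ P 1
    & forall f, ev f = 0 -> P f%:A].

(** Nakayama's determinant trick: if 1 lay in the ideal generated by the kernel of [ev], a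
    determinant congruent to 1 modulo this kernel would annihilate [B]. It would vanish, as [A]
    embeds in [B], although [ev] maps it to 1. *)
Lemma proper_ideal0 : exists P, proper_ideal P.
Proof.
have [n [u hu]] := fin_span.
pose P c := exists m : 'I_n -> A, (forall i, ev (m i) = 0) /\ c = \sum_i (m i)%:A * u i.
have Pa m c : ev m = 0 -> P (m%:A * c).
  move=> hm; have [q ->] := hu c; exists (fun i => m * q i); split.
    by move=> i; rewrite evM hm mul0r.
  by rewrite mulr_sumr; apply: eq_bigr => i _; rewrite algM mulrA.
have PD c d : P c -> P d -> P (c + d).
  move=> [m1 [h1 ->]] [m2 [h2 ->]]; exists (fun i => m1 i + m2 i); split.
    by move=> i; rewrite evD h1 h2 addr0.
  by rewrite -big_split; apply: eq_bigr => i _; rewrite /= scalerDl mulrDl.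
have P0 : P 0 by rewrite -(mulr0 (0 : A)%:A); apply: Pa; rewrite ev0.
exists P; split=> //.
- move=> c d [m [hm ->]]; rewrite mulr_sumr; elim/big_ind: _ => // i _.
  by rewrite mulrCA; apply: Pa.
- move=> [m [hm h1]].
  have /choice[q hq] : forall j, exists q : 'I_n -> A, \sum_i (m i)%:A * u i * u j = \sum_k (q k)%:A * u k /\ forall k, ev (q k) = 0.
    move=> j; have : P (\sum_i (m i)%:A * u i * u j).
      by elim/big_ind: _ => // i _; rewrite -mulrA; apply: Pa.
    by move=> [q [q0 e]]; exists q.
  pose M : 'M[A]_n := \matrix_(j, k) ((j == k)%:R - q j k).
  have Mu : map_mx (in_alg B) M *m (\col_k u k) = 0.
    apply/matrixP => j k; rewrite !mxE.
    under eq_bigr do rewrite !mxE /= scalerBl mulrBl.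
    rewrite sumrB -(hq j).1 -mulr_suml -h1 mul1r (bigD1 j) //= big1 ?addr0.
      by rewrite eqxx scale1r mul1r subrr.
    by move=> i /negPf ij; rewrite eq_sym ij scale0r mul0r.
  have detu j : (\det M)%:A * u j = 0.
    have := congr1 (fun X : 'M[B]_(n, 1) => X j 0)
      (mulmxA (\adj (map_mx (in_alg B) M)) (map_mx (in_alg B) M) (\col_k u k)).
    by rewrite Mu mulmx0 mul_adj_mx mul_scalar_mx det_map_mx !mxE => <-.
  have det0 : \det M = 0.
    apply: (gal_inj hB); rewrite -[LHS]mulr1 [X in _ * X]h1 mulr_sumr big1 // => i _.
    by rewrite mulrCA detu mulr0.
  have : ev (\det M) = 1.
    rewrite ev_sum (bigD1 1%g) //= [X in _ + X]big1 ?addr0.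
      rewrite odd_perm1 expr0 mul1r.
      rewrite (big_morph ev (evM hx0) (ev1 hx0)) big1 // => i _.
      by rewrite mxE perm1 eqxx evB ev1 (hq i).2 subr0.
    move=> s s1.
    have [i si] : exists i, s i != i.
      apply: contrapT => h; case/eqP: s1; apply/permP => i; rewrite perm1.
      by apply/eqP; apply: contrapT => h'; apply: h; exists i; exact/negP.
    rewrite (bigD1 i) //= mulrCA evM mxE eq_sym (negPf si) sub0r.
    by rewrite -[- _]add0r evB (hq i).2 ev0 subr0 mul0r.
  by rewrite det0 ev0 => /eqP; rewrite eq_sym oner_eq0.
- by move=> f hf; rewrite -[f%:A]mulr1; apply: Pa.
Qed.

(** Modulo [P] the element [c] is a root of [chi c] evaluated at [x0], and this polynomial splits
    over [K]. If every [c - kB z] were invertible modulo [P], so would be their product over the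
    roots, which lies in [P]. *)
Lemma ideal_step P c : proper_ideal P -> exists P', [/\ proper_ideal P',
  forall d, P d -> P' d & exists k, P' (c - kB k)].
Proof.
move=> [PD PM P1 Pe].
have P0 : P 0 by rewrite -(scale0r (1 : B)); apply: Pe; rewrite ev0.
have evk f : P (f%:A - kB (ev f)).
  rewrite /kB -scalerBl; apply: Pe.
  by rewrite evB evZ ev1 mulr1 subrr.
pose Q : {poly K} := \poly_(i < #|gT|.+1) ev (chi c)`_i.
have Qc : P (\sum_(i < #|gT|.+1) kB Q`_i * c ^+ i).
  have e : \sum_(i < #|gT|.+1) ((chi c)`_i)%:A * c ^+ i = 0.
    have : (map_poly (in_alg B) (chi c)).[c] = 0.
      rewrite chiE /chiB horner_prod big_image (bigD1 1%g) //= !hornerE.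
      by rewrite (gal_act1 hB) subrr mul0r.
    rewrite horner_coef (size_map_inj_poly in_algB_inj) ?rmorph0 // size_chi.
    by under eq_bigr do rewrite coef_map.
  have -> : \sum_(i < #|gT|.+1) kB Q`_i * c ^+ i =
      \sum_(i < #|gT|.+1) (kB Q`_i * c ^+ i - ((chi c)`_i)%:A * c ^+ i).
    by rewrite sumrB e subr0.
  elim/big_ind: _ => // i _.
  rewrite -mulrBl mulrC; apply: (PM); rewrite coef_poly ltn_ord -opprB -mulN1r.
  exact/PM/evk.
have sQ : size Q = #|gT|.+1.
  apply: size_poly_eq; have := chi_monic c.
  by rewrite monicE /lead_coef size_chi /= => /eqP ->; rewrite ev1 oner_eq0.
have [rs eQ] := closed_field_poly_normal Q.
have lQ : lead_coef Q = 1.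
  rewrite /lead_coef sQ coef_poly ltnSn /=; have := chi_monic c.
  by rewrite monicE /lead_coef size_chi /= => /eqP ->; rewrite ev1.
rewrite lQ scale1r in eQ.
have Pprod : P (\prod_(z <- rs) (c - kB z)).
  suff <- : \sum_(i < #|gT|.+1) kB Q`_i * c ^+ i = \prod_(z <- rs) (c - kB z) by [].
  transitivity (map_poly kB Q).[c].
    rewrite horner_coef size_map_poly_id0 ?sQ; last first.
      by rewrite lQ kB1 oner_eq0.
    by apply: eq_bigr => i _; rewrite coef_map.
  rewrite {1}eQ rmorph_prod horner_prod; apply: eq_bigr => z _.
  by rewrite rmorphB /= map_polyX map_polyC !hornerE.
have [z hz] : exists z, forall q e, P q -> q + e * (c - kB z) != 1.
  apply: contrapT => /forallNP h; apply: P1.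
  have [e he] : exists e, P (1 - e * \prod_(z <- rs) (c - kB z)).
    elim: (rs) => [|z zs [e he]]; first by exists 1; rewrite big_nil mulr1 subrr.
    have /existsNP[q /existsNP[t /not_implyP[Pq]]] := h z.
    move=> /negP; rewrite negbK => /eqP h1.
    exists (t * e); rewrite big_cons.
    have -> : 1 - t * e * ((c - kB z) * \prod_(j <- zs) (c - kB j)) =
       t * (c - kB z) * (1 - e * \prod_(j <- zs) (c - kB j)) + q.
      by rewrite -[X in X - _]h1; ring.
    by apply: PD => //; apply: PM.
  have := PD _ _ he (PM e _ Pprod).
  by rewrite subrK.
exists (fun d => exists q e, P q /\ d = q + e * (c - kB z)); split.
- split.
  + move=> d1 d2 [q1 [e1 [p1 ->]]] [q2 [e2 [p2 ->]]]; exists (q1 + q2), (e1 + e2).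
    by split; [exact: PD|ring].
  + move=> d1 d2 [q [e [p ->]]]; exists (d1 * q), (d1 * e).
    by split; [exact: PM|ring].
  + by move=> [q [e [p /esym/eqP]]]; rewrite (negPf (hz q e p)).
  + by move=> f hf; exists f%:A, 0; rewrite mul0r addr0; split=> //; apply: Pe.
- by move=> d Pd; exists d, 0; rewrite mul0r addr0.
- by exists z, 0, 1; rewrite mul1r add0r.
Qed.

(** It suffices to make the finitely many generators of [B] over [A] congruent to constants, one
    [ideal_step] for each. *)
Lemma ideal_max : exists P, proper_ideal P /\ forall c, exists k, P (c - kB k).
Proof.
have [n [u hu]] := fin_span.
have [P [hP hPu]] : exists P, proper_ideal P /\ forall i, exists k, P (u i - kB k).
  suff [P [hP h]] : exists P, proper_ideal P /\ forall i, i \in enum 'I_n -> exists k, P (u i - kB k).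
    by exists P; split=> // i; apply: h; rewrite mem_enum.
  elim: (enum _) => [|i s [P [hP IH]]]; first by have [P hP] := proper_ideal0; exists P.
  have [P' [hP' sub hi]] := ideal_step (u i) hP.
  exists P'; split=> // j; rewrite in_cons => /predU1P[->//|/IH[k hk]].
  by exists k; apply: sub.
exists P; split=> // c; have [PD PM P1 Pe] := hP.
have [m ->] := hu c; have /choice[k hk] := hPu.
exists (\sum_i ev (m i) * k i).
rewrite rmorph_sum -sumrB; elim/big_ind: _ => [||i _].
- by rewrite -(scale0r (1 : B)); apply: Pe; rewrite ev0.
- by move=> *; exact: PD.
- rewrite rmorphM /=.
  have -> : (m i)%:A * u i - kB (ev (m i)) * kB (k i) =
     u i * ((m i)%:A - kB (ev (m i))) + kB (ev (m i)) * (u i - kB (k i)) by ring.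
  apply: PD; apply: PM => //.
  by rewrite /kB -scalerBl; apply: Pe; rewrite evB evZ ev1 mulr1 subrr.
Qed.

Lemma point_ex : exists p : {rmorphism B -> K}, forall f, p f%:A = ev f.
Proof.
have [P [[PD PM P1 Pe] hP]] := ideal_max.
have /choice[p hp] := hP.
have PN c : P c -> P (- c) by rewrite -mulN1r; exact: PM.
have uniq c k : P (c - kB k) -> p c = k.
  move=> h; apply/subr0_eq; apply: contrapT => /eqP h0; apply: P1.
  have := PM (kB (p c - k)^-1) _ (PD _ _ h (PN _ (hp c))).
  have -> : c - kB k - (c - kB (p c)) = kB (p c - k) by rewrite kBB; ring.
  by rewrite -kBM mulVf // kB1.
have pB : zmod_morphism p.
  move=> c d; apply: uniq; rewrite kBB.
  have -> : c - d - (kB (p c) - kB (p d)) = (c - kB (p c)) - (d - kB (p d)) by ring.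
  by apply: PD => //; apply: PN.
have pM : monoid_morphism p.
  split=> [|c d]; apply: uniq.
    by rewrite kB1 subrr -(scale0r (1 : B)); apply: Pe; rewrite ev0.
  rewrite kBM.
  have -> : c * d - kB (p c) * kB (p d) = d * (c - kB (p c)) + kB (p c) * (d - kB (p d)) by ring.
  by apply: PD; apply: PM.
pose pa := GRing.isZmodMorphism.Build B K p pB.
pose pm := GRing.isMonoidMorphism.Build B K p pM.
pose pr : {rmorphism B -> K} := HB.pack p pa pm.
exists pr => f; rewrite /=; apply: uniq.
by rewrite /kB -scalerBl; apply: Pe; rewrite evB evZ ev1 mulr1 subrr.
Qed.
End ExtendEvaluation.

Section Points.

Definition is_point (p : {rmorphism B -> K}) : Prop :=
  exists x0 (hx0 : absK x0 = r), forall f, p f%:A = ev hx0 f.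

Lemma point_kB p k : is_point p -> p (kB k) = k.
Proof. by move=> [x0 [hx0 h]]; rewrite h evZ ev1 mulr1. Qed.
Lemma point_act p g : is_point p -> is_point (p \o act g : {rmorphism B -> K}).
Proof.
by move=> [x0 [hx0 h]]; exists x0, hx0 => f; rewrite /= act_alg h.
Qed.
Lemma point_gauss p f : is_point p -> absK (p f%:A) <= gauss absK coef r f.
Proof. by move=> [x0 [hx0 h]]; rewrite h ev_gauss. Qed.
Lemma point_generic (fs : seq A) : exists2 p, is_point p &
  forall f, f \in fs -> absK (p f%:A) = gauss absK coef r f.
Proof.
have [x0 [hx0 h]] := ev_generic fs; have [p hp] := point_ex hx0.
by exists p => [|f /h <-]; [exists x0, hx0|rewrite hp].
Qed.

Lemma point_chi p c : is_point p ->
  let Q := map_poly (p \o in_alg B) (chi c) in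
  [/\ Q \is monic, size Q = #|gT|.+1 & root Q (p c)].
Proof.
move=> hp Q; have mQ : Q \is monic by rewrite monic_map ?chi_monic.
split=> //.
  by rewrite /Q chi_map size_prod_XsubC size_map -cardE.
rewrite /Q chi_map /root horner_prod big_image (bigD1 1%g) //= !hornerE.
by rewrite (gal_act1 hB) subrr mul0r.
Qed.

Lemma point_le_of_chi c m p : 0 <= m -> is_point p ->
  (forall i, (i < #|gT|)%N -> gauss absK coef r (chi c)`_i <= m ^+ (#|gT| - i)) ->
  absK (p c) <= m.
Proof.
move=> m0 hp h; have [mQ sQ rQ] := point_chi c hp.
apply: (nabs_root_le hN m0 sQ mQ rQ) => i hi.
by rewrite coef_map; apply: le_trans (h i hi); exact: point_gauss.
Qed.
Lemma point_lt1_of_chi c p : is_point p ->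
  (forall i, (i < #|gT|)%N -> gauss absK coef r (chi c)`_i < 1) -> absK (p c) < 1.
Proof.
move=> hp h; have [mQ sQ rQ] := point_chi c hp.
apply: (nabs_root_lt1 hN sQ mQ rQ) => i hi.
by rewrite coef_map; apply: le_lt_trans (h i hi); exact: point_gauss.
Qed.
Lemma chi_le_of_point c m p : 0 <= m -> is_point p ->
  (forall g, absK (p (act g c)) <= m) ->
  forall i, absK (p ((chi c)`_i)%:A) <= m ^+ (#|gT| - i).
Proof.
move=> m0 hp h i.
have -> : p ((chi c)`_i)%:A = (map_poly (p \o in_alg B) (chi c))`_i by rewrite coef_map.
rewrite chi_map.
have := nabs_prod_coef hN (s := [seq p (act g c) | g : gT]) i m0.
rewrite size_map -cardE; apply=> z /mapP[g _ ->]; exact: h.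
Qed.
(** At a generic point the coefficients of [chi c] have their Gauss norms, and these are bounded by
    powers of the largest conjugate of [c] there. The root bound then applies at every other
    point. *)
Lemma point_maxP c : exists2 p0, is_point p0 &
  forall p, is_point p -> absK (p c) <= absK (p0 c).
Proof.
have [p1 hp1 hg] := point_generic (chi c).
have [g0 _ hmax] := @arg_maxP _ _ _ (1%g : gT) xpredT (fun g => absK (p1 (act g c))) isT.
exists (p1 \o act g0 : {rmorphism B -> K}); first exact: point_act.
move=> p hp /=; apply: point_le_of_chi => //; first exact: abs_ge0.
move=> i hi; rewrite -hg; last by rewrite mem_nth // size_chi ltnS ltnW.
by apply: chi_le_of_point => // [|g]; [exact: abs_ge0|exact: hmax].
Qed.
Lemma gauss_chi_le c m : 0 <= m -> (forall p, is_point p -> absK (p c) <= m) ->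
  forall i, (i < #|gT|)%N -> gauss absK coef r (chi c)`_i <= m ^+ (#|gT| - i).
Proof.
move=> m0 h i hi; have [p hp hg] := point_generic (chi c).
rewrite -hg; last by rewrite mem_nth // size_chi ltnS ltnW.
by apply: chi_le_of_point => // g; apply: (h _ (point_act g hp)).
Qed.
(** The traces of all multiples of [c] vanish at every point, hence are zero because Gauss norms are
    attained; the trace expansion of [c] concludes. *)
Lemma point_eq0 c : (forall p, is_point p -> p c = 0) -> c = 0.
Proof.
move=> h; have [n [u [v [_ e]]]] := gal_span; rewrite [c]e big1 // => i _.
have [f hf] := trace_alg (v i * c); rewrite hf.
suff -> : f = 0 by rewrite scale0r mulr0.
apply/eqP/negPn/negP => f0; have := gauss_gt0 f0.
have [p hp hg] := point_generic [:: f].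
rewrite -hg ?mem_head // -hf rmorph_sum big1 ?(abs_zero hN) ?ltxx // => s _.
rewrite !rmorphM /= (_ : p (act s c) = 0) ?mulr0 //.
exact: (h _ (point_act s hp)).
Qed.

(* Leja points: each new point maximizes the next function, once this function has
   been made to vanish at the previous points. *)
Lemma leja (v : nat -> B) N :
  (forall k : nat -> K, \sum_(i < N) kB (k i) * v i = 0 -> forall i, (i < N)%N -> k i = 0) ->
  exists (l : nat -> B) (p : nat -> {rmorphism B -> K}),
  [/\ forall i, (i < N)%N -> is_point (p i),
      forall i j, (i < N)%N -> (j < N)%N -> p j (l i) = (i == j)%:R,
      forall i q, (i < N)%N -> is_point q -> absK (q (l i)) <= 1
    & forall i, (i < N)%N -> exists k : nat -> K, l i = \sum_(j < N) kB (k j) * v j].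
Proof.
elim: N => [|N IH] ind.
  by have [p _ _] := point_generic [::]; exists (fun=> 0), (fun=> p).
have [k hk i iN|l [p [hp hpl hl hlk]]] := IH.
  have := ind (fun j => if (j < N)%N then k j else 0) _ i (ltnW iN).
  rewrite iN; apply; rewrite big_ord_recr /= ltnn kB0 mul0r addr0 -[RHS]hk.
  by apply: eq_bigr => j _; rewrite ltn_ord.
(* [v N] minus its interpolation by the earlier functions; the independence of the [v i] keeps it
   nonzero. *)
pose v' := v N - \sum_(j < N) kB (p j (v N)) * l j.
have /choice[kk hkk] : forall i : 'I_N, exists k : nat -> K, l i = \sum_(j < N) kB (k j) * v j.
  by move=> i; exact: hlk.
pose kv (j : nat) := if (j == N :> nat) then 1 else - \sum_(i < N) p i (v N) * kk i j.
have v'E : v' = \sum_(j < N.+1) kB (kv j) * v j.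
  rewrite big_ord_recr /= /kv eqxx kB1 mul1r addrC /v'; congr (_ + _).
  rewrite -sumrN (eq_bigr (fun i : 'I_N => \sum_(j < N) - (kB (p i (v N)) * (kB (kk i j) * v j)))); last first.
    by move=> i _; rewrite {1}hkk mulr_sumr sumrN.
  rewrite exchange_big /=; apply: eq_bigr => j _.
  rewrite (ltn_eqF (ltn_ord j)) kBN mulNr rmorph_sum mulr_suml -sumrN /=.
  by apply: eq_bigr => i _; rewrite kBM mulrA.
have v'0 : v' != 0.
  apply/negP => /eqP e0; have := ind _ (etrans (esym v'E) e0) N (ltnSn N).
  by rewrite /kv eqxx => /eqP; rewrite oner_eq0.
have [p0 hp0 hmax] := point_maxP v'.
have p0v : p0 v' != 0.
  apply: contraNneq v'0 => e; apply/eqP/point_eq0 => q /hmax.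
  by rewrite e (abs_zero hN) => h; apply: (abs_eq0 hN); apply/le_anti; rewrite h (abs_ge0 hN).
have pv' j : (j < N)%N -> p j v' = 0.
  move=> jN; rewrite rmorphB rmorph_sum (bigD1 (Ordinal jN)) //= big1.
    by rewrite rmorphM /= hpl // eqxx mulr1 addr0 point_kB ?subrr //; exact: hp.
  move=> i hi; rewrite rmorphM /= hpl // (_ : (i == j :> nat) = false) ?mulr0 //.
  by apply/negP => /eqP e; case/eqP: hi; apply/val_inj.
pose lN := kB (p0 v')^-1 * v'.
have lN1 q : is_point q -> absK (q lN) <= 1.
  move=> hq; rewrite rmorphM /= point_kB // (abs_mul hN) (nabsV hN).
  by rewrite mulrC ler_pdivrMr ?mul1r ?(nabs_gt0 hN) // hmax.
have p0lN : p0 lN = 1 by rewrite rmorphM /= point_kB // mulVf.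
have plN j : (j < N)%N -> p j lN = 0 by move=> jN; rewrite rmorphM /= pv' ?mulr0.
(* The earlier functions are corrected so as to vanish at the new point; the correction has sup norm
   at most 1. *)
pose l' i := if i == N then lN else l i - kB (p0 (l i)) * lN.
pose p' j := if j == N then p0 else p j.
have ltNE i : (i < N.+1)%N -> (i == N) = false -> (i < N)%N.
  by move=> h1 h2; rewrite ltn_neqAle h2 -ltnS.
exists l', p'; split.
- by move=> i iN; rewrite /p'; case: eqP => // /eqP/negPf h; apply/hp/ltNE.
- move=> i j iN jN; rewrite /l' /p'.
  case hi: (i == N); case hj: (j == N).
  + by rewrite p0lN (eqP hi) (eqP hj) eqxx.
  + by rewrite plN ?ltNE // (eqP hi) eq_sym hj.
  + by rewrite rmorphB rmorphM /= p0lN point_kB // mulr1 subrr (eqP hj) hi.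
  + by rewrite rmorphB rmorphM /= plN ?ltNE // mulr0 subr0 hpl // ltNE.
- move=> i q iN hq; rewrite /l'; case hi: (i == N); first exact: lN1.
  rewrite rmorphB rmorphM /= point_kB //; apply: (nabs_suble hN).
    by apply: hl; rewrite ?ltNE.
  rewrite (abs_mul hN) mulr_ile1 ?(abs_ge0 hN) ?lN1 //.
  by apply: hl; rewrite ?ltNE.
- have [kN hkN] : exists k : nat -> K, lN = \sum_(j < N.+1) kB (k j) * v j.
    rewrite /lN v'E mulr_sumr.
    exists (fun j => (p0 v')^-1 * kv j).
    by apply: eq_bigr => j _; rewrite kBM mulrA -v'E.
  move=> i iN; rewrite /l'; case hi: (i == N); first by exists kN.
  have [k hk] := hlk i (ltNE _ iN hi).
  exists (fun j => (if (j < N)%N then k j else 0) - p0 (l i) * kN j).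
  rewrite {1}hk {1}hkN big_ord_recr [RHS]big_ord_recr /= ltnn mulrDr opprD addrA.
  rewrite mulr_sumr -sumrB; congr (_ + _).
    by apply: eq_bigr => j _; rewrite ltn_ord kBB kBM mulrBl mulrA.
  by rewrite sub0r kBN kBM mulNr mulrA.
Qed.
End Points.

(** * Valuations over eta(r) *)

Variables (E : fieldType) (w : E -> val2 R) (hw : is_field_valuation absK w).
Variable iota : {rmorphism B -> E}.
Hypothesis hiota : forall f : A, w (iota f%:A) = Defs.eta absK coef r f.

Definition aE : A -> E := iota \o in_alg B.
HB.instance Definition _ := GRing.RMorphism.on aE.
Definition kE : K -> E := iota \o kB.
HB.instance Definition _ := GRing.RMorphism.on kE.
(* The points of X over eta(r) are the valuations w \o phi g. *)
Definition phi (g : gT) : B -> E := iota \o act g.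
HB.instance Definition _ g := GRing.RMorphism.on (phi g).

Lemma w_aE f : w (aE f) = Defs.eta absK coef r f. Proof. exact: hiota. Qed.
Lemma phi_aE g f : phi g f%:A = aE f.
Proof. by rewrite /phi /= act_alg. Qed.
Lemma phi_kB g k : phi g (kB k) = kE k. Proof. exact: phi_aE. Qed.
Lemma kE_aE k : kE k = aE k%:A. Proof. by []. Qed.
Lemma aE_scale k f : aE (k *: f) = kE k * aE f.
Proof. by rewrite kE_aE -rmorphM /= -scalerAl mul1r. Qed.
Lemma aE_subscale f k h : aE (f - k *: h) = aE f - kE k * aE h.
Proof. by rewrite -aE_scale; exact: rmorphB. Qed.
Lemma aE_eqn f : (w (aE f) == None) = (f == 0).
Proof.
have [->|f0] := eqVneq f 0; first by rewrite rmorph0 (w0 hw).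
by rewrite w_aE; have [m [_ -> _ _]] := eta_lead rab f0.
Qed.
Lemma aE_inj : injective aE.
Proof.
move=> f h e; apply/eqP; rewrite -subr_eq0 -aE_eqn rmorphB /= e subrr.
by rewrite (w0 hw).
Qed.
Definition mono (k : K) (m : int) : A := k *: xi m.
Lemma coef_mono k m i : coef (mono k m) i = k * (i == m)%:R.
Proof. by rewrite acoefZ coef_xi. Qed.
Lemma mono_eq0 k m : (mono k m == 0) = (k == 0).
Proof. by rewrite scaler_eq0 (negPf (xi_neq0 m)) orbF. Qed.
Lemma w_mono k m : k != 0 -> w (aE (mono k m)) = Some (absK k * r ^ m, m%:~R).
Proof.
move=> k0; rewrite w_aE.
have /(eta_lead rab)[i [hi -> _ _]] : mono k m != 0 by rewrite mono_eq0.
move: hi; rewrite /nrm !coef_mono; have [->|im] := eqVneq i m; last by rewrite mulr0 eqxx.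
by rewrite mulr1.
Qed.
Lemma monoM k l m n : mono k m * mono l n = mono (k * l) (m + n).
Proof. by rewrite /mono xiD -scalerAl -scalerAr scalerA. Qed.
Lemma mono1 : mono 1 0 = 1. Proof. by rewrite /mono scale1r xi0. Qed.
Lemma w_kE k : k != 0 -> w (kE k) = Some (absK k, 0).
Proof.
move=> k0; have -> : kE k = aE (mono k 0) by rewrite /mono aE_scale xi0 rmorph1 mulr1.
by rewrite w_mono // expr0z mulr1.
Qed.
Lemma w_kE_le1 k : (w (kE k) <= vone R)%O = (absK k <= 1).
Proof.
have [->|k0] := eqVneq k 0; first by rewrite rmorph0 (w0 hw) (abs_zero hN) ler01.
by rewrite w_kE // vle_some lexx andbT orbC -le_eqVlt.
Qed.
Lemma w_kE_lt1 k : (w (kE k) < vone R)%O = (absK k < 1).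
Proof.
have [->|k0] := eqVneq k 0; first by rewrite rmorph0 (w0 hw) vlt_none (abs_zero hN) ltr01.
by rewrite w_kE // vlt_some ltxx andbF orbF.
Qed.
Lemma w_kE1 k : absK k = 1 -> w (kE k) = vone R.
Proof.
move=> e; rewrite w_kE ?e //; apply: contra_eq_neq e => ->.
by rewrite (abs_zero hN) eq_sym oner_eq0.
Qed.
Lemma flat_aE f : vflat (w (aE f)) = gauss absK coef r f.
Proof.
have [->|f0] := eqVneq f 0; first by rewrite rmorph0 (w0 hw) gauss0.
rewrite w_aE; have [m [_ -> h _]] := eta_lead rab f0.
by rewrite (gauss_max h).
Qed.

(** The remaining terms have other exponents, hence other natural parts, so none of them can tie
    with the leading one. *)
Lemma lead_mono f : f != 0 -> exists k m, [/\ k != 0, w (aE f) = w (aE (mono k m))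
  & (w (aE (f - mono k m)%R) < w (aE f))%O].
Proof.
move=> f0; have [m [m0 em hle hlt]] := eta_lead rab f0.
exists (coef f m), m; split=> //.
  by rewrite w_mono // w_aE em.
have [e0|g0] := eqVneq (f - mono (coef f m) m) 0.
  by rewrite e0 rmorph0 (w0 hw) vlt_none aE_eqn.
have [l [l0 el _ _]] := eta_lead rab g0.
have lm : l != m.
  by apply: contraNneq l0 => ->; rewrite acoefB coef_mono eqxx mulr1 subrr.
have cl : coef (f - mono (coef f m) m) l = coef f l.
  by rewrite acoefB coef_mono (negPf lm) mulr0 subr0.
rewrite !w_aE em el vlt_some /nrm cl -!/(nrm _ _ _).
case: ltgtP (hle l) => //= e _; rewrite ltr_int lt_neqAle eq_sym lm /=.
by rewrite leNgt; apply/negP => /hlt; rewrite e ltxx.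
Qed.

(* The residue field of aE A is that of K. *)
Lemma res_ratio f k m : k != 0 -> (w (aE f) <= w (aE (mono k m)))%O ->
  exists2 l, absK l <= 1 & (w (aE (f - l *: mono k m)%R) < w (aE (mono k m)))%O.
Proof.
move=> k0; rewrite le_eqVlt => /predU1P[e|h]; last first.
  by exists 0; rewrite ?scale0r ?subr0 // (abs_zero hN).
have f0 : f != 0 by rewrite -aE_eqn e aE_eqn mono_eq0.
have [k' [m' [k'0 e' h]]] := lead_mono f0.
move: (etrans (esym e') e); rewrite !w_mono // => -[e1 e2].
have em : m' = m by apply/eqP; rewrite -(@eqr_int rat) e2.
subst m'; have ek : absK k' = absK k.
  by apply: (mulIf _ e1); rewrite gt_eqF // exprz_gt0 // r_gt0.
exists (k' / k); first by rewrite (abs_mul hN) (nabsV hN) ek mulfV // nabs_neq0.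
by move: h; rewrite e w_mono // /mono scalerA divfK.
Qed.
(** Natural parts on [A] are integers, so nothing lies strictly between [(1, 1)] and 1. *)
Lemma w_aE_lt1 f : (w (aE f) < vone R)%O -> (w (aE f) <= Some (1, 1))%O.
Proof.
have [->|f0] := eqVneq f 0; first by rewrite rmorph0 (w0 hw).
rewrite w_aE; have [m [_ -> _ _]] := eta_lead rab f0.
rewrite vlt_some vle_some => /orP[->//|/andP[-> h]]; rewrite orbC /=.
by rewrite ler1z; move: h; rewrite ltr0z => h; rewrite (_ : (1 <= m)%R) //; lia.
Qed.

Lemma phi_chi g c : let Q := map_poly aE (chi c) in
  [/\ Q \is monic, size Q = #|gT|.+1 & root Q (phi g c)].
Proof.
move=> Q; have mQ : Q \is monic by rewrite monic_map ?chi_monic.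
split=> //.
  by rewrite /Q (chi_map iota) size_prod_XsubC size_map -cardE.
rewrite /Q (chi_map iota) /root horner_prod big_image (bigD1 g) //= !hornerE.
by rewrite subrr mul0r.
Qed.
Lemma chi_prod c : map_poly aE (chi c) = \prod_(z <- [seq phi g c | g : gT]) ('X - z%:P).
Proof. exact: (chi_map iota). Qed.
Lemma phi_chi_sum g c : \sum_(i < #|gT|.+1) aE (chi c)`_i * phi g c ^+ i = 0.
Proof.
have [_ sQ /eqP] := phi_chi g c; rewrite horner_coef sQ => e.
by rewrite -[RHS]e; apply: eq_bigr => i _; rewrite coef_map.
Qed.
Lemma chi_lead c : (chi c)`_#|gT| = 1.
Proof. by have := chi_monic c; rewrite monicE /lead_coef size_chi => /eqP. Qed.

Lemma w_sub_far (z : E) k : (w z <= vone R)%O -> 1 < absK k ->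
  w (z - kE k) = w (kE k).
Proof.
move=> z1 k1; rewrite (w_dom hK.(rank1_abs) hw) (wN hN hw) //.
by apply: le_lt_trans z1 _; rewrite ltNge w_kE_le1 -ltNge.
Qed.

(** Divided by the leading monomial of a largest coefficient, the equation of [z] reduces to a
    polynomial [P] over [K] with a coefficient of norm 1 and [w (P(z)) < 1]. Were [z] not close to a
    root of [P], the value of [P(z)] would bound the coefficients of [P]. *)
Lemma residue g c : (w (phi g c) <= vone R)%O ->
  exists2 k, absK k <= 1 & (w (phi g c - kE k)%R < vone R)%O.
Proof.
set z := phi g c => z1; pose n := #|gT|.
have [i0 _ hi0] := @arg_maxP _ _ _ (ord_max : 'I_n.+1) xpredT
  (fun i : 'I_n.+1 => w (aE (chi c)`_i)) isT.
have f0 : (chi c)`_i0 != 0.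
  rewrite -aE_eqn -vlt_none; apply: lt_le_trans (hi0 ord_max isT).
  by rewrite chi_lead rmorph1 (w1 hw).
have [k [m [k0 ek _]]] := lead_mono f0; rewrite ek in hi0.
have /choice[l hl] (i : 'I_n.+1) : exists l, absK l <= 1 /\
   (w (aE ((chi c)`_i - l *: mono k m)%R) < w (aE (mono k m)))%O.
  by have [l l1 l2] := res_ratio k0 (hi0 i isT); exists l.
have mn : w (aE (mono k m)) != None by rewrite aE_eqn mono_eq0.
have li0 : absK (l i0) = 1.
  apply/le_anti; rewrite (hl i0).1 /= leNgt; apply/negP => l1.
  have : (w (aE ((chi c)`_i0 - l i0 *: mono k m + l i0 *: mono k m)%R) < w (aE (mono k m)))%O.
    rewrite [aE _]rmorphD /=; apply: (w_addlt hw); first exact: (hl i0).2.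
    rewrite aE_scale (wM hw) -[ltRHS]vmul1; apply: vltM2r => //; first exact: (w_pos hN hw).
    by rewrite w_kE_lt1.
  by rewrite subrK ek ltxx.
pose P : {poly K} := \poly_(i < n.+1) l (inord i).
have Pi (i : 'I_n.+1) : P`_i = l i by rewrite coef_poly ltn_ord inord_val.
have sP : (size P <= n.+1)%N by apply: size_poly.
have hP : (w ((map_poly kE P).[z]) < vone R)%O.
  rewrite -(vltM2rE _ _ (w_pos hN hw (aE (mono k m))) mn) vmul1 -(wM hw).
  rewrite (horner_coef_wide _ (leq_trans (size_poly _ _) sP)) mulr_suml.
  rewrite -[X in w X]subr0 -[X in _ - X](phi_chi_sum g c) -sumrB.
  apply: (w_sum_lt hw) => // i _; rewrite coef_map Pi -/z mulrAC -mulrBl.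
  apply: le_lt_trans (hl i).2.
  rewrite mulrC; apply: (w_mull hN hw).
    by rewrite (wX hw); apply: vexp_le1 => //; exact: (w_pos hN hw).
  rewrite (_ : _ - _ = - aE ((chi c)`_i - l i *: mono k m)) ?(wN hN hw) //.
  by rewrite aE_subscale opprB.
have [rs eP] := closed_field_poly_normal P.
apply: contrapT => /forall2NP hno.
have hw' y : y \in rs -> w (z - kE y) = Some (Num.max 1 (absK y), 0).
  move=> _; have [y1|y1] := leP (absK y) 1; last first.
    rewrite w_sub_far // w_kE //; apply: contraTneq y1 => ->.
    by rewrite (abs_zero hN) -leNgt ler01.
  have [//|/negP] := hno y; rewrite -leNgt => h.
  apply/le_anti; rewrite h andbT; apply: (w_suble hN hw) => //.
  by rewrite w_kE_le1.
have P0 : lead_coef P != 0.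
  rewrite lead_coef_eq0; apply/eqP => e; have := Pi i0.
  by rewrite e coef0 => /esym e0; move: li0; rewrite e0 (abs_zero hN) => /eqP; rewrite eq_sym oner_eq0.
have hval : w ((map_poly kE P).[z]) = Some (absK (lead_coef P) * \prod_(y <- rs) Num.max 1 (absK y), 0).
  rewrite {1}eP map_polyZ rmorph_prod hornerZ horner_prod (wM hw) w_kE // (w_prod hw).
  have -> : \big[@vmul R/vone R]_(y <- rs) w (map_poly kE ('X - y%:P)).[z] =
     Some (\prod_(y <- rs) Num.max 1 (absK y), 0).
    rewrite big_seq [in RHS]big_seq.
    rewrite (eq_bigr (fun y => Some (Num.max 1 (absK y), 0))); last first.
      by move=> y hy; rewrite rmorphB /= map_polyX map_polyC !hornerE hw'.
    elim/big_rec2: _ => // y u v _ ->.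
    by rewrite /= addr0.
  by rewrite /= addr0.
move: hP; rewrite hval vlt_some ltxx andbF orbF ltNge => /negP; apply.
have : absK P`_i0 <= absK (lead_coef P) * \prod_(y <- rs) Num.max 1 (absK y).
  rewrite {1}eP coefZ (abs_mul hN) ler_wpM2l ?(abs_ge0 hN) //.
  exact: nabs_coef_prod.
by rewrite Pi li0.
Qed.

Definition Gval (v : val2 R) := exists k m, k != 0 /\ v = w (aE (mono k m)).
Lemma Gval_mul u v : Gval u -> Gval v -> Gval (vmul u v).
Proof.
move=> [k [m [k0 ->]]] [l [n [l0 ->]]]; exists (k * l), (m + n).
by rewrite mulf_neq0 // -monoM rmorphM (wM hw).
Qed.
Lemma Gval_inv u : Gval u -> Gval (vinv u).
Proof.
move=> [k [m [k0 ->]]]; exists k^-1, (- m).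
rewrite invr_eq0 k0 !w_mono ?invr_eq0 //=; split=> //; congr (Some (_, _)).
  by rewrite (nabsV hN) invfM invr_expz.
by rewrite rmorphN.
Qed.
Lemma Gval_exp u n : Gval u -> Gval (vexp u n).
Proof.
move=> h; elim: n => [|n IH] /=; last exact: Gval_mul.
by exists 1, 0; rewrite oner_eq0 mono1 rmorph1 (w1 hw).
Qed.
Lemma Gval_aE f : f != 0 -> Gval (w (aE f)).
Proof. by move=> /lead_mono[k [m [k0 -> _]]]; exists k, m. Qed.

(** Two terms of the equation of [z] tie for the largest value, so a power of [w z] with exponent at
    most [#|gT|] is a quotient of values of [A]. The factorial is a multiple of all such
    exponents. *)
Lemma w_phi_pow g c : phi g c != 0 -> Gval (vexp (w (phi g c)) (factorial #|gT|)).
Proof.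
set z := phi g c => z0; pose n := #|gT|.
have zn : w z != None by rewrite (w_eqn hw).
pose t (i : 'I_n.+1) := aE (chi c)`_i * z ^+ i.
have [i0 _ hi0] := @arg_maxP _ _ _ (ord_max : 'I_n.+1) xpredT (fun i => w (t i)) isT.
have ti0 : t i0 != 0.
  rewrite -(w_eqn hw) -vlt_none; apply: lt_le_trans (hi0 ord_max isT).
  rewrite /t chi_lead rmorph1 mul1r vlt_none (w_eqn hw) expf_neq0 //.
have [j [ji ej]] : exists j, j != i0 /\ w (t j) = w (t i0).
  apply: contrapT => h; have := phi_chi_sum g c; rewrite -/z => e.
  have : w (\sum_i t i) = w (t i0).
    apply: (w_sum_dom hN hw) => // i ii0; rewrite lt_neqAle (hi0 i isT : (w (t i) <= w (t i0))%O) andbT.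
    by apply/eqP => e'; apply: h; exists i.
  by rewrite e (w0 hw) => /esym/eqP; rewrite (w_eqn hw) (negPf ti0).
wlog lt_ij : i0 j ti0 ji ej {hi0} / (i0 < j)%N.
  move=> H; case: (ltngtP i0 j) => [h|h|/val_inj e]; first exact: (H i0 j).
    apply: (H j i0) => //; last by rewrite eq_sym.
    by rewrite -(w_eqn hw) ej (w_eqn hw).
  by rewrite e eqxx in ji.
have nz (i : 'I_n.+1) : t i != 0 -> (chi c)`_i != 0.
  by apply: contraNneq => e; rewrite /t e rmorph0 mul0r.
have tj : t j != 0 by rewrite -(w_eqn hw) ej (w_eqn hw).
have G : Gval (vexp (w z) (j - i0)).
  have -> : vexp (w z) (j - i0) = vmul (w (aE (chi c)`_i0)) (vinv (w (aE (chi c)`_j))).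
    have pj := w_pos hN hw (aE (chi c)`_j).
    have nj : w (aE (chi c)`_j) != None by rewrite aE_eqn nz.
    move: ej; rewrite /t !(wM hw) !(wX hw) -[X in vexp (w z) X](subnK (ltnW lt_ij)) vexpD vmulA => ej.
    have e : vmul (w (aE (chi c)`_j)) (vexp (w z) (j - i0)) = w (aE (chi c)`_i0).
      have ze : vexp (w z) i0 != None by rewrite vexp_eqn (negPf zn) andbF.
      have zp : vpos (vexp (w z) i0) by apply/vexp_pos/(w_pos hN hw).
      exact: (vmulIr zp ze).
    by rewrite -e vmulC vmulA (vmulC (vinv _)) vinvK // vmul1.
  by apply: Gval_mul; [|apply: Gval_inv]; apply/Gval_aE/nz.
have d : (j - i0 %| factorial n)%N.
  by rewrite dvdn_fact // subn_gt0 lt_ij /= (leq_trans (leq_subr _ _)) // -ltnS.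
by rewrite -(divnK d) mulnC vexpM; apply: Gval_exp.
Qed.

Lemma small_ex (e : R) : 0 < e -> exists2 k : K, k != 0 & absK k < e.
Proof.
move=> e0; have [x x0 x1] := rank1_nontrivial hK.
have [y [y0 y1]] : exists y : K, y != 0 /\ absK y < 1.
  case: (ltgtP (absK x) 1) x1 => // h _; first by exists x.
  by exists x^-1; rewrite invr_eq0 x0 (nabsV hN) invf_lt1 // (nabs_gt0 hN).
have : (fun n => absK y ^+ n) @ \oo --> (0 : R).
  by apply: cvg_expr; rewrite ger0_norm // (abs_ge0 hN).
move=> /cvg0P/(_ _ e0)[N /(_ N (leqnn N))].
rewrite ger0_norm ?exprn_ge0 ?(abs_ge0 hN) // => h.
by exists (y ^+ N); rewrite ?expf_neq0 // (nabsX hN).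
Qed.
Let wpos z : vpos (w z). Proof. exact: (w_pos hN hw). Qed.
Lemma w_one_units (I : Type) (s : seq I) (P : pred I) (F : I -> E) :
  (forall i, P i -> (w (F i - 1)%R < vone R)%O) ->
  (w (\prod_(i <- s | P i) F i - 1)%R < vone R)%O.
Proof.
move=> h; elim/big_rec: _ => [|i y Pi IH].
  by rewrite subrr (w0 hw) vlt_none.
rewrite (_ : _ - 1 = F i * (y - 1) + (F i - 1)); last by ring.
apply: (w_addlt hw); last exact: h.
by rewrite (wM hw) (w_sub1 hN hw (h i Pi)) vmul1.
Qed.
(** The power of exponent [#|gT|!] has the value of a monomial, where below 1 means at most
    [(1, 1)]. *)
Lemma w_phi_small g c (M : nat) : (w (phi g c) < vone R)%O ->
  (w (phi g c ^+ (M * factorial #|gT|)) <= Some (1, M%:R))%O.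
Proof.
move=> h; have [->|z0] := eqVneq (phi g c) 0.
  have [->|M0] := posnP M; first by rewrite mul0n expr0 (w1 hw).
  by rewrite expr0n gtn_eqF ?muln_gt0 ?M0 ?fact_gt0 // (w0 hw).
rewrite (wX hw) mulnC vexpM.
have [k [m [k0 e]]] := w_phi_pow z0.
have : (vexp (w (phi g c)) (factorial #|gT|) < vone R)%O.
  by rewrite -(vexp1n _ (factorial #|gT|)); apply: vexp_lt; rewrite ?fact_gt0 ?vpos1.
rewrite e => /w_aE_lt1 h1.
apply: le_trans (vexp_le M _ _ h1) _ => //; first exact: ltr01.
by rewrite vexp_some expr1n.
Qed.

Lemma w_monoV k m : k != 0 ->
  vmul (w (aE (mono k^-1 (- m)))) (w (aE (mono k m))) = vone R.
Proof.
move=> k0; rewrite -(wM hw) -(rmorphM aE) monoM mulVf // addNr mono1.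
by rewrite (rmorph1 aE) (w1 hw).
Qed.

(** * Separation of the points of X/H and ramification indices *)

Section FixedRing.
Variable H : {group gT}.

Definition inC c : Prop := forall h, h \in H -> act h c = c.
Lemma inCD c d : inC c -> inC d -> inC (c + d).
Proof. by move=> hc hd h hH; rewrite rmorphD /= hc ?hd. Qed.
Lemma inCN c : inC c -> inC (- c).
Proof. by move=> hc h hH; rewrite rmorphN /= hc. Qed.
Lemma inCB c d : inC c -> inC d -> inC (c - d).
Proof. by move=> hc hd; apply: inCD => //; exact: inCN. Qed.
Lemma inCM c d : inC c -> inC d -> inC (c * d).
Proof. by move=> hc hd h hH; rewrite rmorphM /= hc ?hd. Qed.
Lemma inC_alg f : inC f%:A. Proof. by move=> h _; rewrite act_alg. Qed.
Lemma inC1 : inC 1. Proof. by move=> h _; rewrite rmorph1. Qed.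
Lemma inC0 : inC 0. Proof. by move=> h _; rewrite rmorph0. Qed.
Lemma inC_kB k : inC (kB k). Proof. exact: inC_alg. Qed.
Lemma inCX c n : inC c -> inC (c ^+ n).
Proof. by move=> hc h hH; rewrite rmorphXn /= hc. Qed.
Lemma inC_prod (I : Type) (s : seq I) (P : pred I) (F : I -> B) :
  (forall i, P i -> inC (F i)) -> inC (\prod_(i <- s | P i) F i).
Proof. by move=> h; elim/big_ind: _; [exact: inC1|exact: inCM|]. Qed.
Lemma inC_sum (I : Type) (s : seq I) (P : pred I) (F : I -> B) :
  (forall i, P i -> inC (F i)) -> inC (\sum_(i <- s | P i) F i).
Proof. by move=> h; elim/big_ind: _; [exact: inC0|exact: inCD|]. Qed.
Lemma phi_coset g h c : inC c -> h \in H -> phi (g * h)%g c = phi g c.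
Proof. by move=> hc hH; rewrite /phi /= (gal_actM hB) (hc h hH). Qed.
Lemma phi_eq0 c : (forall g, phi g c = 0) -> c = 0.
Proof.
move=> h; have [n [u [v [_ e]]]] := gal_span; rewrite [c]e big1 // => i _.
have [f hf] := trace_alg (v i * c); rewrite hf.
suff -> : f = 0 by rewrite scale0r mulr0.
apply: aE_inj; rewrite rmorph0 /aE /= -hf rmorph_sum big1 // => s _.
by rewrite !rmorphM /= -[iota (act s c)]/(phi s c) h mulr0.
Qed.

(** The norm of [y] lies in [A] and is a monomial up to a factor close to 1. Divided by that
    monomial, the product of the other conjugates nearly inverts [y]. *)
Lemma inv_approx y : inC y -> (forall g, phi g y != 0) ->
  exists2 y', inC y' & forall g, (w (phi g y * phi g y' - 1)%R < vone R)%O.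
Proof.
move=> yC y0.
have [f hf] : exists f : A, \prod_g act g y = f%:A.
  apply: (gal_inv hB) => s; rewrite rmorph_prod /= [RHS](reindex_inj (mulgI s)).
  by apply: eq_bigr => t _; rewrite (gal_actM hB).
have f0 : f != 0.
  rewrite -aE_eqn (w_eqn hw) /aE /= -hf rmorph_prod.
  by apply/prodf_neq0 => g _; exact: y0.
have [k [m [k0 e h]]] := lead_mono f0.
pose y' := (mono k^-1 (- m))%:A * \prod_(g | g != 1%g) act g y.
have ey : y * y' = (mono k^-1 (- m) * f)%:A.
  by rewrite mulrCA algM -hf [in RHS](bigD1 1%g) //= (gal_act1 hB).
exists y'.
  apply: inCM; first exact: inC_alg.
  (* The action of [s] in [H] turns the product over [g != 1] into the one over [g != s]; both omit
     a factor equal to [y]. *)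
  move=> s sH; rewrite rmorph_prod /=.
  rewrite (eq_bigr (fun g => act (s * g)%g y)); last by move=> g _; rewrite (gal_actM hB).
  rewrite (reindex_inj (mulgI s^-1%g)) /=.
  rewrite (eq_big (fun g => g != s) (fun g => act g y)); last first.
  - by move=> g _; rewrite mulKVg.
  - by move=> g; rewrite -(inj_eq (mulgI s)) mulKVg mulg1.
  have [->//|s1] := eqVneq s 1%g.
  rewrite (bigD1 1%g) 1?eq_sym //= [RHS](bigD1 s) //= (yC s sH) (gal_act1 hB).
  by congr (_ * _); apply: eq_bigl => g; rewrite andbC.
move=> g; rewrite -rmorphM ey /= phi_aE.
have -> : mono k^-1 (- m) * f = 1 + mono k^-1 (- m) * (f - mono k m).
  by rewrite mulrBr monoM mulVf // addNr mono1 addrC subrK.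
rewrite rmorphD rmorph1 addrAC subrr add0r rmorphM (wM hw).
have ne : w (aE (mono k^-1 (- m))) != None by rewrite aE_eqn mono_eq0 invr_eq0.
have := vltM2r (wpos (aE (mono k^-1 (- m)))) ne h; rewrite vmulC e.
by rewrite [X in (_ < X)%O]vmulC w_monoV.
Qed.

(** A truncation: [b] has value [min 1 (1 / u)] at every point. It is a near inverse of [1 + al u],
    where the unit [al] avoids the residues for which [1 + al u] would cancel. *)
Lemma thr u : inC u -> exists2 b, inC b & forall g,
  ((w (phi g u) <= vone R)%O -> w (phi g b) = vone R) /\
  ((vone R < w (phi g u))%O -> w (phi g b) = vinv (w (phi g u))).
Proof.
move=> uC.
have /choice[be hbe] g : exists k, (w (phi g u) <= vone R)%O ->
    absK k <= 1 /\ (w (phi g u - kE k)%R < vone R)%O.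
  have [h|h] := leP (w (phi g u)) (vone R); last by exists 0.
  by have [k k1 k2] := residue h; exists k.
have [al al1 hal] := abs_unit_avoid hN [seq - (be g)^-1 | g : gT].
pose y := 1 + kB al * u.
have phiy g : phi g y = 1 + kE al * phi g u.
  by rewrite rmorphD rmorph1 rmorphM /= phi_kB.
have y1 g : (w (phi g u) <= vone R)%O -> w (phi g y) = vone R.
  move=> h; have [b1 b2] := hbe g h; rewrite phiy.
  have -> : 1 + kE al * phi g u = kE al * (phi g u - kE (be g)) + kE (1 + al * be g).
    by rewrite rmorphD rmorph1 rmorphM /=; ring.
  have e1 : absK (1 + al * be g) = 1.
    have [b0|b0] := eqVneq (absK (be g)) 1; last first.
      rewrite addrC (nabs_dom hN) (abs_one hN) // (abs_mul hN) al1 mul1r.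
      by rewrite lt_neqAle b0.
    have bn : be g != 0 by apply: contra_eq_neq b0 => ->; rewrite (abs_zero hN) eq_sym oner_eq0.
    rewrite -[RHS](hal (- (be g)^-1)); first last.
    - by rewrite (nabsN hN) (nabsV hN) b0 invr1.
    - by apply: map_f; rewrite mem_enum.
    rewrite -[RHS]mulr1 -b0 -(abs_mul hN) opprK mulrDl mulVf //.
    by rewrite addrC.
  rewrite (w_dom hN hw) w_kE1 // (wM hw) w_kE1 // vmul1 //.
have y2 g : (vone R < w (phi g u))%O -> w (phi g y) = w (phi g u).
  move=> h; rewrite phiy (w_dom hN hw) (wM hw) w_kE1 // vmul1 //.
  by rewrite (w1 hw).
have yn g : w (phi g y) != None.
  have [h|h] := leP (w (phi g u)) (vone R); first by rewrite y1.
  by rewrite y2 // -vlt_none; apply: lt_trans h; rewrite vlt_none.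
have [||bb bC hbb] := @inv_approx y.
- by apply: inCD; [exact: inC1|apply: inCM => //; exact: inC_kB].
- by move=> g; rewrite -(w_eqn hw).
have eb g : w (phi g bb) = vinv (w (phi g y)).
  have := w_sub1 hN hw (hbb g); rewrite (wM hw) => e.
  rewrite -[LHS]vmul1 -(vinvK (vinv_pos (wpos (phi g y)))) ?vinv_eqn //.
  have -> : vinv (vinv (w (phi g y))) = w (phi g y).
    by case: (w _) => [[p q]|] //=; rewrite invrK opprK.
  by rewrite -vmulA e vmul_1.
exists bb => // g; split=> h; rewrite eb; last by rewrite y2.
by rewrite y1 // /vone /= invr1 oppr0.
Qed.

(* g and t give the same point of X/H. *)
Definition eqv g t := `[< forall c, inC c -> w (phi g c) = w (phi t c) >].
Lemma eqvP g t : reflect (forall c, inC c -> w (phi g c) = w (phi t c)) (eqv g t).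
Proof. exact: asboolP. Qed.
Lemma eqv_refl g : eqv g g. Proof. by apply/eqvP. Qed.
Lemma eqv_sym g t : eqv g t = eqv t g.
Proof. by apply/eqvP/eqvP => h c cC; rewrite h. Qed.
Lemma eqv_trans g t s : eqv g t -> eqv t s -> eqv g s.
Proof. by move=> /eqvP h1 /eqvP h2; apply/eqvP => c cC; rewrite h1 ?h2. Qed.

(** A power of [c] over a monomial has value 1 at [g] and a larger one at [t]. The truncation [thr]
    makes it small at [t], and a constant brings the residue at [g] to 1. *)
Lemma sep_lt g t c : inC c -> (w (phi g c) < w (phi t c))%O ->
  exists b, [/\ inC b, forall s, (w (phi s b) <= vone R)%O,
    (w (phi g b - 1)%R < vone R)%O & (w (phi t b) < vone R)%O].
Proof.
(* If [c] vanishes at [g], a constant smaller than the value of [c] at [t] is added. *)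
move=> cC; wlog g0 : c cC / phi g c != 0.
  move=> W h; have [g0|] := eqVneq (phi g c) 0; last by move=> n0; exact: (W c).
  case et : (w (phi t c)) h => [[p q]|] h; last by rewrite ltNge vle_none in h.
  have p0 : 0 < p by have := wpos (phi t c); rewrite et.
  have [k k0 kp] := small_ex p0.
  apply: (W (c + kB k)); first by apply: inCD => //; exact: inC_kB.
    by rewrite rmorphD /= g0 add0r phi_kB -(w_eqn hw) w_kE.
  rewrite !rmorphD /= g0 add0r !phi_kB w_kE // addrC (w_dom hN hw) et ?w_kE //.
    by rewrite vlt_some kp.
  by rewrite vlt_some kp.
move=> h; have [k [m [k0 e]]] := w_phi_pow g0.
pose u := (mono k^-1 (- m))%:A * c ^+ (factorial #|gT|).
have uC : inC u by apply: inCM; [exact: inC_alg|exact: inCX].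
have mm : vmul (w (aE (mono k^-1 (- m)))) (w (aE (mono k m))) = vone R.
  exact: w_monoV.
have wu s : w (phi s u) = vmul (w (aE (mono k^-1 (- m)))) (vexp (w (phi s c)) (factorial #|gT|)).
  by rewrite rmorphM rmorphXn /= phi_aE (wM hw) (wX hw).
have ug : w (phi g u) = vone R by rewrite wu e mm.
have ut : (vone R < w (phi t u))%O.
  rewrite wu -mm -e; rewrite ![vmul (w (aE (mono k^-1 _))) _]vmulC; apply: vltM2r => //.
    by rewrite aE_eqn mono_eq0 invr_eq0.
  by apply: vexp_lt; rewrite ?fact_gt0.
have [b0 b0C hb0] := thr uC.
have b0le s : (w (phi s b0) <= vone R)%O.
  have [l|l] := leP (w (phi s u)) (vone R); first by rewrite (hb0 s).1.
  rewrite (hb0 s).2 //; have := vleV (vpos1 R) _ (ltW l) (wpos _).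
  by rewrite /vone /= invr1 oppr0; apply.
have gb0 : w (phi g b0) = vone R by apply: (hb0 g).1; rewrite ug.
have tb0 : (w (phi t b0) < vone R)%O.
  have un : w (phi t u) != None by rewrite -vlt_none; apply: lt_trans ut; rewrite vlt_none.
  by rewrite (hb0 t).2 // -(vltM2rE _ _ (wpos (phi t u)) un) vmulC vinvK // vmul1.
have [ka ka1 hka] := residue (b0le g).
have kae : absK ka = 1.
  apply/le_anti; rewrite ka1 /= leNgt; apply/negP => h1.
  have : (w (phi g b0) < vone R)%O.
    by rewrite -[phi g b0](subrK (kE ka)); apply: (w_addlt hw) => //; rewrite w_kE_lt1.
  by rewrite gb0 ltxx.
have kan : ka != 0 by apply: contra_eq_neq kae => ->; rewrite (abs_zero hN) eq_sym oner_eq0.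
have ki : w (kE ka^-1) = vone R by apply: w_kE1; rewrite (nabsV hN) kae invr1.
exists (kB ka^-1 * b0); split.
- by apply: inCM => //; exact: inC_kB.
- by move=> s; rewrite rmorphM /= phi_kB (wM hw) ki vmul1.
- rewrite rmorphM /= phi_kB (_ : _ - 1 = kE ka^-1 * (phi g b0 - kE ka)).
    by rewrite (wM hw) ki vmul1.
  by rewrite mulrBr -rmorphM mulVf // rmorph1.
- by rewrite rmorphM /= phi_kB (wM hw) ki vmul1.
Qed.

Lemma sep g t : ~~ eqv g t -> exists b, [/\ inC b, forall s, (w (phi s b) <= vone R)%O,
    (w (phi g b - 1)%R < vone R)%O & (w (phi t b) < vone R)%O].
Proof.
move=> /eqvP/existsNP[c /not_implyP[cC /eqP]].
case: (ltgtP (w (phi g c)) (w (phi t c))) => // h _; first exact: sep_lt h.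
have [bb [bC b1 b2 b3]] := sep_lt cC h.
exists (1 - bb); split.
- by apply: inCB => //; exact: inC1.
- move=> s; rewrite rmorphB rmorph1 /=; apply: (w_suble hN hw) => //.
  by rewrite (w1 hw).
- by rewrite rmorphB rmorph1 /= addrAC subrr add0r (wN hN hw).
- by rewrite rmorphB rmorph1 /= (w_subC hN hw).
Qed.

Lemma idem0 g : exists2 z, inC z & forall t,
  (eqv g t -> (w (phi t z - 1)%R < vone R)%O) /\ (~~ eqv g t -> (w (phi t z) < vone R)%O).
Proof.
have /choice[bb hbb] t : exists d, ~~ eqv g t -> [/\ inC d, forall s, (w (phi s d) <= vone R)%O,
    (w (phi g d - 1)%R < vone R)%O & (w (phi t d) < vone R)%O].
  case: (boolP (eqv g t)) => h; first by exists 0.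
  by have [d hd] := sep h; exists d.
pose z := \prod_(t | ~~ eqv g t) bb t.
have zC : inC z by apply: inC_prod => t /hbb[].
exists z => // t; split=> h.
  have -> : w (phi t z - 1)%R = w (phi t (z - 1)) by rewrite rmorphB rmorph1.
  rewrite -(eqvP _ _ h); last by apply: inCB => //; exact: inC1.
  rewrite rmorphB rmorph1 rmorph_prod; apply: w_one_units => s /hbb[] //.
rewrite rmorph_prod (bigD1 t) //= (wM hw).
have [_ _ _ ht] := hbb t h.
apply: le_lt_trans ht; rewrite -[leRHS]vmul_1; apply: vleM => //.
elim/big_rec: _ => [|i y /andP[/hbb[_ l _ _] _] IH]; first by rewrite (w1 hw).
exact: (w_mull hN hw).
Qed.

(** [z ^ k] is tiny away from [g], and [(1 - z ^ k) ^ k] is tiny at [g]. As [1 - (1 - z ^ k) ^ k] is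
    a multiple of [z ^ k], it has both properties. *)
Lemma idem g (M : nat) : (0 < M)%N -> exists2 z, inC z & forall t,
  (eqv g t -> (w (phi t z - 1)%R <= Some (1, M%:R))%O) /\
  (~~ eqv g t -> (w (phi t z) <= Some (1, M%:R))%O).
Proof.
move=> M0; have [z zC hz] := idem0 g; pose k := (M * factorial #|gT|)%N.
have k0 : (0 < k)%N by rewrite muln_gt0 M0 fact_gt0.
pose z' := 1 - (1 - z ^+ k) ^+ k.
have factor (y : E) n : (w y <= vone R)%O -> exists2 q, 1 - y ^+ n = (1 - y) * q & (w q <= vone R)%O.
  move=> y1; exists (\sum_(i < n) y ^+ i).
    by rewrite -opprB subrX1 -mulNr opprB.
  by apply: (w_sum_le hw) => i _; rewrite (wX hw); apply: vexp_le1.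
exists z'; first by apply: inCB; [exact: inC1|apply/inCX/inCB; [exact: inC1|exact: inCX]].
have phiz' t : phi t z' = 1 - (1 - phi t z ^+ k) ^+ k.
  by rewrite !(rmorphB, rmorphXn, rmorph1).
move=> t; split=> h.
  have h1 := (hz t).1 h; have w1z := w_sub1 hN hw h1.
  have -> : w (phi t z' - 1)%R = w (phi t (1 - z ^+ k) ^+ k).
    rewrite phiz' addrAC subrr add0r (wN hN hw).
    by rewrite !(rmorphB, rmorphXn, rmorph1).
  apply: w_phi_small; rewrite !(rmorphB, rmorphXn, rmorph1) /=.
  have [|q -> hq] := factor (phi t z) k; first by rewrite w1z.
  by rewrite mulrC; apply: le_lt_trans (w_mull hN hw hq (lexx _)) _; rewrite (w_subC hN hw).
have h1 := (hz t).2 h; rewrite phiz'.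
have zk : (w (phi t z ^+ k) <= Some (1, M%:R))%O by apply: w_phi_small.
have [|q -> hq] := factor (1 - phi t z ^+ k) k.
  apply: (w_suble hN hw); first by rewrite (w1 hw).
  by rewrite (wX hw); apply: vexp_le1 => //; exact: ltW.
by rewrite subKr mulrC; apply: (w_mull hN hw).
Qed.

Definition Onat g (q : rat) : Prop := exists2 c, inC c & exists p, w (phi g c) = Some (p, q).
Lemma Onat_int g (m : int) : Onat g m%:~R.
Proof.
exists (mono 1 m)%:A; first exact: inC_alg.
by rewrite phi_aE w_mono ?oner_eq0 //; eexists.
Qed.
Lemma OnatD g p q : Onat g p -> Onat g q -> Onat g (p + q).
Proof.
move=> [c cC [u eu]] [d dC [v ev]]; exists (c * d); first exact: inCM.
by rewrite rmorphM (wM hw) eu ev; eexists.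
Qed.
Lemma Onat_mul g q (n : nat) : Onat g q -> Onat g (q *+ n).
Proof.
move=> h; elim: n => [|n IH]; first exact: (Onat_int g 0).
by rewrite mulrS; exact: OnatD.
Qed.
Lemma Onat_den g q : Onat g q -> exists m : int, q *+ (factorial #|gT|) = m%:~R.
Proof.
move=> [c _ [p e]]; have n0 : phi g c != 0 by rewrite -(w_eqn hw) e.
have [k [m [k0]]] := w_phi_pow n0.
by rewrite e vexp_some w_mono // => -[_ ->]; exists m.
Qed.
Lemma OnatN g q : Onat g q -> Onat g (- q).
Proof.
move=> h; have [m hm] := Onat_den h; pose N := factorial #|gT|.
have -> : - q = q *+ N.-1 + (- m)%:~R.
  apply: (addIr q); rewrite addNr addrAC -mulrSr prednK ?fact_gt0 //.
  by rewrite hm rmorphN /= subrr.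
by apply: OnatD; [exact: Onat_mul|exact: Onat_int].
Qed.
(** The natural parts form a group between the integers and the multiples of [1 / N], hence are the
    multiples of [d / N] with [d] minimal; [d] divides [N], and [e = N / d]. *)
Lemma Onat_ex g : exists e : nat, (0 < e)%N /\
  forall q, Onat g q <-> exists m : int, q = m%:~R / e%:R.
Proof.
pose N := factorial #|gT|; have N0 : (0 < N)%N by exact: fact_gt0.
have NQ : (N%:R : rat) != 0 by rewrite pnatr_eq0 -lt0n.
pose P (d : nat) := (0 < d)%N && `[< Onat g (d%:R / N%:R) >].
have exP : exists n : nat, P n.
  exists N; rewrite /P N0; apply/asboolP; rewrite mulfV //; exact: (Onat_int g 1).
case: (ex_minnP exP) => d /andP[d0 /asboolP Od] dmin.
have dn : (d : int) != 0 by rewrite eqz_nat -lt0n.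
have Omul (k : int) : Onat g (k%:~R * (d%:R / N%:R)).
  have Om (n : nat) : Onat g (n%:R * (d%:R / N%:R)).
    by rewrite [n%:R * _]mulr_natl; exact: Onat_mul.
  case: k => n; first exact: Om.
  by rewrite NegzE rmorphN mulNr; apply/OnatN/Om.
have dint (k : int) : Onat g (k%:~R / N%:R) -> (d %| k)%Z.
  move=> Ok.
  have e : (k%:~R : rat) = (k %/ d)%Z%:~R * d%:R + (k %% d)%Z%:~R.
    by rewrite {1}(divz_eq k d) rmorphD rmorphM.
  have Or : Onat g ((k %% d)%Z%:~R / N%:R).
    have -> : (k %% d)%Z%:~R / N%:R = k%:~R / N%:R - (k %/ d)%Z%:~R * (d%:R / N%:R) :> rat.
      by rewrite e mulrDl mulrA addrAC subrr add0r.
    by apply: OnatD => //; apply: OnatN.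
  have r0 := modz_ge0 k dn.
  have rd : (k %% d)%Z < d by apply: ltz_pmod; rewrite ltz_nat.
  apply/dvdz_mod0P; apply/eqP; apply: contraT => rn.
  have := dmin `|(k %% d)%Z|%N; rewrite /P absz_gt0 rn /=.
  have -> : `[< Onat g (`|(k %% d)%Z|%N%:R / N%:R) >].
    by apply/asboolP; rewrite -[_%:R]/((`|(k %% d)%Z|%N : int)%:~R) gez0_abs.
  by move=> /(_ isT); lia.
have /dvdzP[e0 he] : (d %| (N : int))%Z.
  by apply: dint; rewrite mulfV //; exact: (Onat_int g 1).
have e1 : 0 < e0 by rewrite -(@pmulr_lgt0 _ (d : int)) -?he ltz_nat.
exists `|e0|%N; split; first by lia.
have eE : (`|e0|%N%:R : rat) = e0%:~R by rewrite -[_%:R]/((`|e0|%N : int)%:~R) gez0_abs // ltW.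
have NE : (N%:R : rat) = e0%:~R * d%:R by rewrite -[LHS]/((N : int)%:~R) he rmorphM.
have dQ : (d%:R : rat) != 0 by rewrite pnatr_eq0 -lt0n.
have eQ : (e0%:~R : rat) != 0 by rewrite intr_eq0 gt_eqF.
move=> q; rewrite eE; split=> [Oq|[m ->]].
  have [m hm] := Onat_den Oq.
  have qE : q = m%:~R / N%:R by rewrite -hm -[q *+ _]mulr_natr mulfK.
  have /dvdzP[k hk] : (d %| m)%Z by apply: dint; rewrite -qE.
  by exists k; rewrite qE NE hk rmorphM /= -mulf_div divff // mulr1.
have -> : m%:~R / e0%:~R = m%:~R * (d%:R / N%:R) :> rat.
  by rewrite NE; field; rewrite dQ eQ.
exact: Omul.
Qed.
(* The ramification index at the point of X/H given by g. *)
Definition ram g : nat := sval (cid (Onat_ex g)).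
Lemma ram_gt0 g : (0 < ram g)%N. Proof. by rewrite /ram; case: cid => e []. Qed.
Lemma OnatP g q : Onat g q <-> exists m : int, q = m%:~R / (ram g)%:R.
Proof. by rewrite /ram; case: cid => e []. Qed.
Lemma w_phi_nat g c p q : inC c -> w (phi g c) = Some (p, q) ->
  exists m : int, q = m%:~R / (ram g)%:R.
Proof. by move=> cC e; apply/OnatP; exists c => //; exists p. Qed.

(** Let [c1] have value [(1, q)] at [g]. Where [c1] is larger, the truncation of the normalized
    power [u] divides by at least the excess, by [vexp_swap]. An approximate idempotent then makes
    the inequality strict at the other points. *)
Lemma peak g (m : int) : exists2 f, inC f & forall t,
  (eqv g t -> w (phi t f) = Some (1, m%:~R / (ram g)%:R)) /\
  (~~ eqv g t -> (w (phi t f) < Some (1, m%:~R / (ram g)%:R))%O).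
Proof.
set q := _ / _; have [c cC [p ep]] : Onat g q by apply/OnatP; exists m.
have [k /= k0 kp] := val_group (fval_val hw) ep.
pose c1 := kB k^-1 * c; have c1C : inC c1 by apply: inCM => //; exact: inC_kB.
have e1 : w (phi g c1) = Some (1, q).
  rewrite rmorphM /= phi_kB (wM hw) w_kE ?invr_eq0 // ep /=.
  by rewrite (nabsV hN) kp mulVf ?add0r // -kp nabs_neq0.
have n1 : phi g c1 != 0 by rewrite -(w_eqn hw) e1.
have [l [j [l0 el]]] := w_phi_pow n1; rewrite e1 in el.
pose N := factorial #|gT|; have N0 : (0 < N)%N by exact: fact_gt0.
pose u := (mono l^-1 (- j))%:A * c1 ^+ N.
have uC : inC u by apply: inCM; [exact: inC_alg|exact: inCX].
have v0 : vpos (Some (1, q) : val2 R) by exact: ltr01.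
pose V : val2 R := vexp (Some (1, q)) N; have Vp : vpos V by exact: vexp_pos.
have Vn : V != None by rewrite vexp_eqn andbF.
have wu s : vmul (w (phi s u)) V = vexp (w (phi s c1)) N.
  rewrite rmorphM rmorphXn /= phi_aE (wM hw) (wX hw) vmulC vmulA -/N /V el.
  by rewrite (vmulC (w (aE (mono l j)))) w_monoV // vmul1.
have [d dC hd] := thr uC.
have wd s : (w (phi s (c1 * d)) <= Some (1, q))%O.
  rewrite rmorphM (wM hw).
  have [h|h] := leP (w (phi s u)) (vone R).
    rewrite (hd s).1 // vmul_1 leNgt; apply/negP => h'.
    have := vexp_lt N0 v0 (wpos _) h'; rewrite -wu -/V -[ltLHS]vmul1 vltM2rE //.
    by rewrite ltNge h.
  rewrite (hd s).2 //.
  have un : w (phi s u) != None by rewrite -vlt_none; apply: lt_trans h; rewrite vlt_none.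
  rewrite -(vleM2rE _ _ (wpos (phi s u)) un) -vmulA (vmulC (vinv _)) vinvK // vmul_1.
  rewrite -(vleM2rE _ _ Vp Vn) -vmulA wu.
  apply: vexp_swap => //; apply/ltW; rewrite ltNge; apply/negP => h'.
  have := vexp_le N (wpos _) v0 h'; rewrite -[vexp (Some _) _]/V -wu.
  by rewrite -[X in (_ <= X)%O]vmul1 vleM2rE // leNgt h.
have gd : w (phi g (c1 * d)) = Some (1, q).
  rewrite rmorphM (wM hw) e1 (hd g).1 ?vmul_1 // le_eqVlt; apply/orP; left; apply/eqP.
  by apply: (vmulIr Vp Vn); rewrite wu e1 vmul1.
have [z zC hz] := idem0 g; have fC : inC (c1 * d * z) by apply: inCM => //; exact: inCM.
exists (c1 * d * z) => // t; split=> h.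
  rewrite -(eqvP _ _ h) // rmorphM (wM hw) [X in vmul X _]gd.
  by rewrite (w_sub1 hN hw ((hz g).1 (eqv_refl g))) vmul_1.
rewrite rmorphM (wM hw) -[ltRHS]vmul_1; apply: vltM => //; first exact: wd.
exact: (hz t).2.
Qed.

Definition rep g : gT := odflt g [pick t | eqv g t].
Lemma rep_eqv g : eqv g (rep g).
Proof. by rewrite /rep; case: pickP => //= _; exact: eqv_refl. Qed.
Lemma rep_eq g t : eqv g t = (rep g == rep t).
Proof.
apply/idP/eqP => [h|e]; last first.
  by apply: eqv_trans (rep_eqv g) _; rewrite e eqv_sym; exact: rep_eqv.
have eq1 : eqv g =1 eqv t.
  move=> s; apply/idP/idP => h'; last exact: eqv_trans h h'.
  by apply: eqv_trans h'; rewrite eqv_sym.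
rewrite /rep (eq_pick eq1); case: pickP => //= /(_ t).
by rewrite eqv_refl.
Qed.
(* Representatives of the points of X/H over eta(r). *)
Definition Y : {set gT} := [set g | rep g == g].
Lemma rep_in g : rep g \in Y.
Proof. by rewrite inE -rep_eq eqv_sym rep_eqv. Qed.
Lemma Y_eqv g t : g \in Y -> t \in Y -> eqv g t = (g == t).
Proof. by rewrite !inE rep_eq => /eqP-> /eqP->. Qed.

Definition idx := {y : {g : gT | g \in Y} & 'I_(ram (val y))}.
Definition idx_y (i : idx) : gT := val (tag i).
Definition idx_m (i : idx) : nat := tagged i.
Definition ex (i : idx) : rat := (idx_m i)%:R / (ram (idx_y i))%:R.
Definition top i : val2 R := Some (1, ex i).
Lemma card_idx : #|{: idx}| = (\sum_(y in Y) ram y)%N.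
Proof.
rewrite card_tagged sumnE big_map big_enum /=.
under eq_bigr do rewrite card_ord.
by rewrite [RHS]big_sub.
Qed.
Lemma fam_ex i : exists2 f, inC f & forall t,
  (eqv (idx_y i) t -> w (phi t f) = top i) /\
  (~~ eqv (idx_y i) t -> (w (phi t f) < top i)%O).
Proof. exact: (peak (idx_y i) (idx_m i)). Qed.
Definition fam i : B := sval (cid2 (fam_ex i)).
Lemma famC i : inC (fam i). Proof. by rewrite /fam; case: cid2. Qed.
Lemma fam_top i t : eqv (idx_y i) t -> w (phi t (fam i)) = top i.
Proof. by rewrite /fam; case: cid2 => f /= _ h; exact: (h t).1. Qed.
Lemma fam_lt i t : ~~ eqv (idx_y i) t -> (w (phi t (fam i)) < top i)%O.
Proof. by rewrite /fam; case: cid2 => f /= _ h; exact: (h t).2. Qed.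
Lemma fam_le i t : (w (phi t (fam i)) <= top i)%O.
Proof. by have [/fam_top->//|/fam_lt/ltW] := boolP (eqv (idx_y i) t). Qed.
Lemma ex_bounds i : 0 <= ex i < 1.
Proof.
rewrite divr_ge0 // ltr_pdivrMr ?ltr0n ?ram_gt0 // mul1r ltr_nat.
exact: (ltn_ord (tagged i)).
Qed.
Lemma ex_inj i j (m : int) : idx_y i = idx_y j -> ex i = ex j + m%:~R -> i = j.
Proof.
move=> ey e; have m0 : m = 0.
  have := ex_bounds i; have := ex_bounds j; rewrite e => /andP[j0 j1] /andP[i0 i1].
  have h1 : (m%:~R : rat) < 1 by lra.
  have h2 : (-1 : rat) < m%:~R by lra.
  have : (m < 1)%R && (-1 < m)%R by rewrite -!(@ltr_int rat) h1 rmorphN h2.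
  by lia.
move: e; rewrite m0 addr0 /ex -ey => /divIf; rewrite pnatr_eq0 -lt0n ram_gt0 => /(_ isT)/eqP.
rewrite eqr_nat; case: i j ey {m0} => [[y yY] m1] [[z zY] m2]; rewrite /idx_y /idx_m /= => eyz.
subst z; have e : zY = yY by exact: bool_irrelevance.
by subst zY => /eqP/val_inj ->.
Qed.

(** At the point of a largest term all others are strictly smaller: the terms that peak there have
    natural parts in different classes modulo integers, and those that peak elsewhere lie below
    their [top]. *)
Lemma orth_max (a' : idx -> A) i0 : a' i0 != 0 ->
  (forall i, (vmul (w (aE (a' i))) (top i) <= vmul (w (aE (a' i0))) (top i0))%O) ->
  w (phi (idx_y i0) (\sum_i (a' i)%:A * fam i)) = vmul (w (aE (a' i0))) (top i0).
Proof.
move=> a0 hmax; rewrite rmorph_sum /=.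
have tE i : phi (idx_y i0) ((a' i)%:A * fam i) = aE (a' i) * phi (idx_y i0) (fam i).
  by rewrite rmorphM /= phi_aE.
have t0 : w (phi (idx_y i0) ((a' i0)%:A * fam i0)) = vmul (w (aE (a' i0))) (top i0).
  by rewrite tE (wM hw) fam_top ?eqv_refl.
rewrite -t0; apply: (w_sum_dom hN hw) => [|i ii0].
  by rewrite -(w_eqn hw) t0 vmul_eqn aE_eqn (negPf a0).
rewrite t0 tE (wM hw); have [e|ai] := eqVneq (a' i) 0.
  by rewrite e rmorph0 (w0 hw) /= vlt_none vmul_eqn aE_eqn (negPf a0).
have [ey|ny] := eqVneq (idx_y i) (idx_y i0); last first.
  apply: lt_le_trans (hmax i); rewrite vmulC [ltRHS]vmulC; apply: vltM2r => //.
    by rewrite aE_eqn.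
  by apply: fam_lt; rewrite Y_eqv //; [exact: (valP (tag i))|exact: (valP (tag i0))].
rewrite -ey fam_top ?eqv_refl // lt_neqAle hmax andbT; apply: contra ii0 => /eqP.
have [m [_ em _ _]] := eta_lead rab ai; have [n [_ en _ _]] := eta_lead rab a0.
rewrite !w_aE em en /top /= => -[_ e2]; apply/eqP/(@ex_inj _ _ (n - m) ey).
by rewrite rmorphB /= addrA [ex i0 + _]addrC -e2; ring.
Qed.
Lemma orth_le (a' : idx -> A) i : exists t,
  (vmul (w (aE (a' i))) (top i) <= w (phi t (\sum_i (a' i)%:A * fam i)))%O.
Proof.
have [i0 _ hi0] := @arg_maxP _ _ _ i xpredT (fun i => vmul (w (aE (a' i))) (top i)) isT.
have [e|a0] := eqVneq (a' i0) 0.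
  exists 1%g; have := hi0 i isT; rewrite /= e rmorph0 (w0 hw) /= => h.
  by apply: le_trans h _.
exists (idx_y i0); rewrite (orth_max a0) => [|j]; [exact: (hi0 i isT)|exact: (hi0 j isT)].
Qed.
Lemma fam_free (a' : idx -> A) : \sum_i (a' i)%:A * fam i = 0 -> forall i, a' i = 0.
Proof.
move=> e i; have [t] := orth_le a' i.
rewrite e rmorph0 (w0 hw) vle_Nnone vmul_eqn orbF aE_eqn => /eqP //.
Qed.
Lemma sum_ex : (\sum_i ex i) *+ 2 = (#|{: idx}|%:R - #|Y|%:R : rat).
Proof.
have -> : \sum_i ex i = \sum_(y in Y) \sum_(m < ram y) m%:R / (ram y)%:R.
  rewrite [RHS](big_sub Y) /=.
  by rewrite (sig_big_dep (I := {g | g \in Y}) xpredT (fun _ => xpredT) (fun y (m : 'I_(ram (val y))) => m%:R / (ram (val y))%:R)).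
rewrite card_idx natr_sum -sum1_card natr_sum -sumrB -sumrMnl; apply: eq_bigr => y _.
have e2 n : (\sum_(m < n) m%:R : rat) *+ 2 = n%:R * (n%:R - 1).
  elim: n => [|n IH]; first by rewrite big_ord0 mul0rn mul0r.
  by rewrite big_ord_recr mulrnDl IH /= -[n.+1%:R]natr1; ring.
have n0 : (ram y)%:R != 0 :> rat by rewrite pnatr_eq0 -lt0n ram_gt0.
by rewrite -mulr_suml -mulrnAl e2 mulrAC mulfV ?mul1r.
Qed.

Lemma phi_aM g f c : phi g (f%:A * c) = aE f * phi g c.
Proof. by rewrite rmorphM /= phi_aE. Qed.
(** Fraction-free Gaussian elimination with pivot [p]; [A] is a domain because it embeds in [E]. *)
Lemma dep (n m : nat) (N : 'I_m -> 'I_n -> A) : (n < m)%N ->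
  exists2 z : 'I_m -> A, (exists i, z i != 0) & forall j, \sum_i z i * N i j = 0.
Proof.
have dom (p q : A) : p != 0 -> q != 0 -> p * q != 0.
  move=> p0 q0; rewrite -aE_eqn (rmorphM aE) (w_eqn hw) mulf_neq0 // -(w_eqn hw) aE_eqn //.
elim: n m N => [|n IH] m N nm.
  by exists (fun=> 1) => [|[]//]; exists (Ordinal nm); exact: oner_neq0.
have [[i0 p0]|h0] : (exists i0 : 'I_m, N i0 ord0 != 0) \/ (forall i, N i ord0 = 0).
  have [/existsP[i0 p0]|/existsPn h0] := boolP [exists i, N i ord0 != 0]; first by left; exists i0.
  by right=> i; move: (h0 i); rewrite negbK => /eqP.
all: swap 1 2.

  have [|z z0 hz] := IH m (fun i j => N i (lift ord0 j)); first exact: ltnW.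
  exists z => // j; have [j' ->|->] := unliftP ord0 j; first exact: hz.
  by rewrite big1 // => i _; rewrite h0 mulr0.
case: m N nm i0 p0 => // m N nm i0 p0; set p := N i0 ord0 in p0 *.
have [z [i zi] hz] := IH m (fun i j => p * N (lift i0 i) (lift ord0 j) - N (lift i0 i) ord0 * N i0 (lift ord0 j)) nm.
exists (fun i => if unlift i0 i is Some i' then p * z i' else - \sum_i' z i' * N (lift i0 i') ord0).
  by exists (lift i0 i); rewrite liftK dom.
move=> j; rewrite (bigD1_ord i0) //= unlift_none.
under [X in _ + X]eq_bigr => i' _ do rewrite (liftK i0 i').
have [j' ->|->] := unliftP ord0 j; last first.
  rewrite -/p mulNr mulr_suml addrC -sumrB big1 // => i' _; ring.
rewrite -[RHS](hz j') mulNr mulr_suml addrC -sumrB; apply: eq_bigr => i' _; ring.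
Qed.

(** * Cosets, trace forms and the rank of the fixed ring *)

Definition deg : nat := #|lcosets H [set: gT]%SET|.
Definition crep (k : 'I_deg) : gT := repr (enum_val k).
Lemma crep_coset k : enum_val k = (crep k *: H)%g.
Proof.
have /lcosetsP[y _ ey] := enum_valP k.
rewrite /crep ey; apply/lcoset_eqP; rewrite lcoset_sym.
by apply: mem_repr; exact: lcoset_refl.
Qed.
Lemma ci_ex g : exists k, ((crep k)^-1 * g)%g \in H.
Proof.
have h : (g *: H)%g \in lcosets H [set: gT]%SET by apply/lcosetsP; exists g; rewrite ?inE.
exists (enum_rank_in h (g *: H)%g); rewrite -mem_lcoset -crep_coset.
by rewrite enum_rankK_in // lcoset_refl.
Qed.
Definition ci g : 'I_deg := sval (cid (ci_ex g)).
Lemma ciP g : ((crep (ci g))^-1 * g)%g \in H. Proof. by rewrite /ci; case: cid. Qed.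
Lemma ci_uniq g k : ((crep k)^-1 * g)%g \in H -> ci g = k.
Proof.
rewrite -mem_lcoset => /lcoset_eqP h; have := ciP g; rewrite -mem_lcoset => /lcoset_eqP.
by rewrite h -!crep_coset => /enum_val_inj.
Qed.
Lemma ci_crep k : ci (crep k) = k.
Proof. by apply: ci_uniq; rewrite mulVg group1. Qed.
Lemma act_ci g c : inC c -> act (crep (ci g)) c = act g c.
Proof.
by move=> cC; rewrite -{2}[g](mulKVg (crep (ci g))) (gal_actM hB _ _ c) (cC _ (ciP g)).
Qed.
Lemma phi_ci g c : inC c -> phi (crep (ci g)) c = phi g c.
Proof. by move=> cC; rewrite /phi /= act_ci. Qed.
Lemma phi_eq0C c : inC c -> (forall k, phi (crep k) c = 0) -> c = 0.
Proof. by move=> cC h; apply: phi_eq0 => g; rewrite -phi_ci. Qed.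
Lemma ci_mul_inj s : injective (fun k => ci (s * crep k)%g).
Proof.
move=> k l /= e; have := ciP (s * crep k); rewrite {}e => h.
rewrite -(ci_crep k); apply: ci_uniq.
have := groupM (groupVr (ciP (s * crep l))) h.
by rewrite !invMg invgK -!mulgA mulKVg mulKg.
Qed.

Definition Phi (n : nat) (c : 'I_n -> B) : 'M[E]_(deg, n) := \matrix_(k, i) phi (crep k) (c i).
(** By the Galois relation the matrix of the [H]-traces of the [u i] has the matrix of the [v i] as
    right inverse; an invertible maximal minor selects the family. *)
Lemma Phi_ex : exists2 c : 'I_deg -> B, forall i, inC (c i) & Phi c \in unitmx.
Proof.
have [n [u [v hv]]] := gal_etale hB.
pose b0 i := \sum_(h in H) act h (u i).
have b0C i : inC (b0 i).
  move=> s sH; rewrite rmorph_sum /= [RHS](reindex_inj (mulgI s)) /=.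
  by apply: eq_big => h; [rewrite groupMl|rewrite (gal_actM hB)].
pose V : 'M[E]_(n, deg) := \matrix_(i, k) phi (crep k) (v i).
have UV : Phi b0 *m V = 1%:M.
  apply/matrixP => k k'; rewrite !mxE.
  have -> : \sum_j Phi b0 k j * V j k' = \sum_(h in H) iota (act (crep k * h)%g (\sum_j u j * act ((crep k * h)^-1 * crep k')%g (v j))).
    under eq_bigr do rewrite !mxE /phi /= rmorph_sum rmorph_sum mulr_suml.
    rewrite exchange_big /=; apply: eq_bigr => h _; rewrite !rmorph_sum /=; apply: eq_bigr => j _.
    by rewrite !rmorphM /= -!(gal_actM hB) mulKVg.
  under eq_bigr do rewrite hv !rmorph_nat.
  have [->|kk] := eqVneq k k'.
    rewrite (bigD1 1%g) //= mulg1 mulVg eqxx big1 ?addr0 // => h /andP[_ /negPf h1].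
    rewrite invMg -mulgA mulVg mulg1 (_ : _ == _ = false) //.
    by rewrite eq_invg1.
  rewrite big1 // => h hH; case: eqP => // e; case/eqP: kk.
  rewrite -(ci_crep k'); apply/esym/ci_uniq.
  move: e => /(congr1 (mulg (crep k * h)%g)); rewrite mulKVg mulg1 => ->.
  by rewrite mulKg.
have fU : row_full (Phi b0)^T.
  by apply/row_fullP; exists V^T; rewrite -trmx_mul UV trmx1.
exists (fun k => b0 (fullrankfun fU k)) => //.
rewrite -unitmx_tr (_ : _^T = rowsub (fullrankfun fU) (Phi b0)^T) ?fullrowsub_unit //.
by apply/matrixP => i k; rewrite !mxE.
Qed.
Lemma ctr_ex c : inC c -> exists f : A, \sum_k act (crep k) c = f%:A.
Proof.
move=> cC; apply: (gal_inv hB) => s; rewrite rmorph_sum [RHS](reindex_inj (@ci_mul_inj s)) /=.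
by apply: eq_bigr => k _; rewrite -(gal_actM hB) act_ci.
Qed.
Lemma trace_mx (m n : nat) (c : 'I_m -> B) (d : 'I_n -> B) :
  (forall i, inC (c i)) -> (forall i, inC (d i)) ->
  exists2 T : 'M[A]_(m, n), (forall i j, (T i j)%:A = \sum_k act (crep k) (c i * d j))
    & map_mx aE T = (Phi c)^T *m Phi d.
Proof.
move=> cC dC.
have /choice[T hT] (ij : 'I_m * 'I_n) := ctr_ex (inCM (cC ij.1) (dC ij.2)).
exists (\matrix_(i, j) T (i, j)); first by move=> i j; rewrite mxE -hT.
apply/matrixP => i j; rewrite !mxE /aE /= -hT rmorph_sum; apply: eq_bigr => k _.
by rewrite !mxE /phi /= !rmorphM.
Qed.
(** An [H]-invariant element is determined by its traces against a family with invertible [Phi],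
    that is by [deg] elements of [A], to which [dep] applies. *)
Lemma dependent (m : nat) (c : 'I_m -> B) : (forall i, inC (c i)) -> (deg < m)%N ->
  exists2 z : 'I_m -> A, (exists i, z i != 0) & \sum_i (z i)%:A * c i = 0.
Proof.
move=> cC h; have [bb bC bu] := Phi_ex; have [T hT eT] := trace_mx cC bC.
have [z z0 hz] := dep (fun i j => T i j) h; exists z => //.
have xC : inC (\sum_i (z i)%:A * c i) by apply: inC_sum => j _; apply: inCM => //; exact: inC_alg.
apply: phi_eq0C => // k; pose x := \sum_i (z i)%:A * c i.
pose v : 'rV[E]_deg := \row_k phi (crep k) x.
suff : v *m Phi bb = 0.
  move=> /(congr1 (mulmx^~ (invmx (Phi bb)))); rewrite mulmxK // mul0mx => /rowP/(_ k).
  by rewrite !mxE.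
have -> : v = (map_mx aE (\row_i z i)) *m (Phi c)^T.
  apply/rowP => l; rewrite !mxE rmorph_sum; apply: eq_bigr => j _.
  by rewrite !mxE /= phi_aM.
rewrite -mulmxA -eT -map_mxM; apply/rowP => j; rewrite !mxE.
under eq_bigr do rewrite mxE.
by rewrite hz rmorph0.
Qed.
Lemma free_le (m : nat) (c : 'I_m -> B) : (forall i, inC (c i)) ->
  (forall z : 'I_m -> A, \sum_i (z i)%:A * c i = 0 -> forall i, z i = 0) -> (m <= deg)%N.
Proof.
move=> cC free; rewrite leqNgt; apply/negP => h.
by have [z [i /eqP zi] /free] := dependent cC h.
Qed.
(** Cramer's rule for the trace form: the traces of [z] against [c], multiplied by the adjugate, are
    the coordinates of [D z] with [D] the discriminant. *)
Lemma Phi_span (c : 'I_deg -> B) : (forall i, inC (c i)) -> Phi c \in unitmx ->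
  exists D, aE D = \det (Phi c) ^+ 2 /\ forall z, inC z -> exists m : 'I_deg -> A,
    D%:A * z = \sum_i (m i)%:A * c i.
Proof.
move=> cC u; have [T hT eT] := trace_mx cC cC; exists (\det T); split.
  by rewrite -det_map_mx eT det_mulmx det_tr expr2.
move=> z zC; have [t ht et] := @trace_mx _ 1 _ (fun=> z) cC (fun=> zC).
exists (fun i => (\adj T *m t) i 0); apply/eqP; rewrite -subr_eq0; apply/eqP.
apply: phi_eq0C.
  apply: inCB; first by apply: inCM => //; exact: inC_alg.
  by apply: inC_sum => i _; apply: inCM => //; exact: inC_alg.
move=> k; have : (aE (\det T)) *: Phi (fun _ : 'I_1 => z) - Phi c *m map_mx aE (\adj T *m t) = 0.
  rewrite map_mxM map_mx_adj eT et; set X := (Phi c)^T *m Phi c.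
  have uX : (Phi c)^T \in unitmx by rewrite unitmx_tr.
  have -> : aE (\det T) = \det X by rewrite -det_map_mx eT.
  have -> : \adj X *m ((Phi c)^T *m Phi (fun _ : 'I_1 => z)) = \det X *: (invmx (Phi c) *m Phi (fun _ : 'I_1 => z)).
    rewrite -[X in _ *m ((Phi c)^T *m X)](mulKVmx u) !mulmxA -[_ *m (Phi c)^T *m _]mulmxA -/X.
    by rewrite mul_adj_mx mul_scalar_mx -scalemxAl.
  by rewrite -scalemxAr mulKVmx // subrr.
move=> /matrixP/(_ k 0); rewrite !mxE => e.
rewrite rmorphB /= phi_aM -[RHS]e; congr (_ - _); rewrite rmorph_sum;
 apply: eq_bigr => i _.
by rewrite /= phi_aM mulrC [Phi c k i]mxE; congr (_ * _); rewrite [RHS]mxE.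
Qed.
(** Adjoining [d j] to [c] creates a dependence, so a nonzero multiple of each [d j] lies in the
    span of [c]; hence [\det (Phi c)] is a factor of a nonzero determinant. *)
Lemma Phi_unit (c d : 'I_deg -> B) : (forall i, inC (c i)) -> (forall i, inC (d i)) ->
  (forall z : 'I_deg -> A, \sum_i (z i)%:A * c i = 0 -> forall i, z i = 0) ->
  Phi d \in unitmx -> Phi c \in unitmx.
Proof.
move=> cC dC free du.
have /choice[D hD] j : exists D : A * ('I_deg -> A), D.1 != 0 /\ D.1%:A * d j = \sum_i (D.2 i)%:A * c i.
  pose e (i : 'I_deg.+1) := if unlift ord0 i is Some i' then c i' else d j.
  have eC i : inC (e i) by rewrite /e; case: unliftP.
  have [z z0] := dependent eC (ltnSn _).
  rewrite (bigD1_ord ord0) //= {1}/e unlift_none.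
  under eq_bigr => i _ do rewrite /e (liftK ord0 i).
  move=> hz; exists (z ord0, fun i => - z (lift ord0 i)); split=> /=; last first.
    by apply/eqP; rewrite -subr_eq0 -[X in _ == X]hz -sumrN; apply/eqP; congr (_ + _); apply: eq_bigr => i _; rewrite scaleNr mulNr opprK.
  apply: contraPneq z0 => e0 [i /eqP zi]; apply: zi.
  have [i' ->|->//] := unliftP ord0 i.
  by apply: (free (fun i => z (lift ord0 i))); rewrite -[RHS]hz e0 scale0r mul0r add0r.
have dE : Phi d *m diag_mx (\row_j aE (D j).1) = Phi c *m \matrix_(i, j) aE ((D j).2 i).
  rewrite mul_mx_diag; apply/matrixP => k j; rewrite !mxE mulrC -(phi_aE (crep k)) -rmorphM (hD j).2.
  rewrite rmorph_sum; apply: eq_bigr => i _.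
  by rewrite !mxE /= phi_aM mulrC.
rewrite !unitmxE !unitfE in du *.
have : \det (Phi d *m diag_mx (\row_j aE (D j).1)) != 0.
  rewrite det_mulmx mulf_neq0 // det_diag; apply/prodf_neq0 => j _.
  by rewrite mxE -(w_eqn hw) aE_eqn (hD j).1.
by rewrite dE det_mulmx mulf_eq0 negb_or => /andP[].
Qed.

(** * Stability *)

Section Band.
Variables (cc ee : R) (M : nat).
Hypotheses (cc1 : 1 <= cc) (ee0 : 0 <= ee).

(** Size at most [cc ^ j] and, up to the relative error [ee], support in the exponents of absolute
    value at most [j * M]: a filtration compatible with products. *)
Definition band (j : nat) f : Prop := forall l : int,
  nrm r f l <= cc ^+ j /\ ((j * M < `|l|)%N -> nrm r f l <= ee * cc ^+ j).

Let ccj j : 0 <= cc ^+ j. Proof. by rewrite exprn_ge0 // (le_trans ler01). Qed.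
Lemma nrm_add_le f f' (l : int) (u : R) : nrm r f l <= u -> nrm r f' l <= u -> nrm r (f + f') l <= u.
Proof.
by rewrite /nrm -!ler_pdivlMr ?exprz_gt0 ?r_gt0 // acoefD; exact: (nabs_addle hN).
Qed.
Lemma nrm0 (l : int) : nrm r 0 l = 0.
Proof. by rewrite /nrm acoef0 (abs_zero hN) mul0r. Qed.
Lemma bandD j f f' : band j f -> band j f' -> band j (f + f').
Proof.
move=> h h' l; split=> [|hl]; apply: nrm_add_le.
- exact: (h l).1.
- exact: (h' l).1.
- exact: (h l).2.
- exact: (h' l).2.
Qed.
Lemma bandN j f : band j f -> band j (- f).
Proof. by move=> h l; rewrite /nrm acoefN (nabsN hN); exact: h. Qed.
Lemma band0 j : band j 0.
Proof. by move=> l; rewrite nrm0; split=> // _; rewrite mulr_ge0. Qed.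
Lemma band_nat j (t : bool) : band j t%:R.
Proof.
case: t => [l|]; last exact: band0.
have h : nrm r 1 l = (l == 0)%:R.
  rewrite /nrm acoef1; have [->|_] := eqVneq; last by rewrite (abs_zero hN) mul0r.
  by rewrite (abs_one hN) expr0z mulr1.
rewrite h; split=> [|hl].
  by case: (l == 0) => //; rewrite exprn_ege1.
by rewrite (_ : (l == 0) = false) ?mulr_ge0 //; lia.
Qed.
Lemma bandM j k f f' : band j f -> band k f' -> band (j + k) (f * f').
Proof.
move=> h h' l; split=> [|hl]; apply: (coef_mul_le r_gt0) => i.
  by rewrite exprD; apply: ler_pM; rewrite ?nrm_ge0 ?r_gt0 ?(h i).1 ?(h' _).1.
have [hi|hi] := ltnP (j * M) `|i|.
  rewrite exprD [leRHS]mulrA; apply: ler_pM; rewrite ?nrm_ge0 ?r_gt0 ?(h' _).1 //.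
  exact: (h i).2.
rewrite exprD [leRHS]mulrCA; apply: ler_pM; [exact: (nrm_ge0 _ _ r_gt0)|exact: (nrm_ge0 _ _ r_gt0)|exact: (h i).1|].
by apply: (h' _).2; lia.
Qed.
Lemma band_sum (I : Type) (s : seq I) (P : pred I) (F : I -> A) j :
  (forall i, P i -> band j (F i)) -> band j (\sum_(i <- s | P i) F i).
Proof. by move=> h; elim/big_ind: _ => //; [exact: band0|move=> *; exact: bandD]. Qed.

(** The weights of a characteristic polynomial: the coefficient of degree [k] is a sum of products
    of [n - k] matrix entries. *)
Definition pband n (p : {poly A}) : Prop := forall k,
  ((k <= n)%N -> band (n - k) p`_k) /\ ((n < k)%N -> p`_k = 0).
Lemma pbandM m n (p q : {poly A}) : pband m p -> pband n q -> pband (m + n) (p * q).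
Proof.
move=> hp hq k; rewrite coefM; split=> hk.
  apply: band_sum => i _; have [im|im] := leqP i m; last by rewrite (hp i).2 // mul0r; exact: band0.
  have [kn|kn] := leqP (k - i) n; last by rewrite (hq (k - i)%N).2 // mulr0; exact: band0.
  rewrite (_ : (m + n - k = (m - i) + (n - (k - i)))%N); last by have := ltn_ord i; lia.
  by apply: bandM; [exact: (hp i).1|exact: (hq _).1].
rewrite big1 // => i _; have [im|im] := leqP i m; last by rewrite (hp i).2 // mul0r.
by rewrite (hq (k - i)%N).2 ?mulr0 //; lia.
Qed.
Lemma pband_det n (X : 'M[{poly A}]_n) : (forall i j, pband 1 (X i j)) -> pband n (\det X).
Proof.
move=> h; have hs (s : 'S_n) : pband n ((-1) ^+ s * \prod_i X i (s i)).
  rewrite -[X in pband X _]add0n; apply: pbandM.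
    case: (odd_perm s) => k; rewrite ?expr0 ?expr1 ?coefN coef1; split=> hk.
    - by apply: bandN; exact: band_nat.
    - by rewrite gtn_eqF // oppr0.
    - exact: band_nat.
    - by rewrite gtn_eqF.
  have {1}-> : n = (\sum_(i < n) 1)%N by rewrite sum_nat_const card_ord muln1.
  elim/big_rec2: _ => [k|i m p _ IH].
    by rewrite coef1; split=> hk; [exact: band_nat|rewrite gtn_eqF].
  exact: pbandM.
move=> k; rewrite coef_sum; split=> hk.
  by apply: band_sum => s _; exact: (hs s k).1.
by rewrite big1 // => s _; exact: (hs s k).2.
Qed.
Lemma pband_char n (X : 'M[A]_n) : (forall i j, band 1 (X i j)) -> pband n (char_poly X).
Proof.
move=> h; apply: pband_det => i j k; rewrite !mxE coefB coefMn coefX coefC; split.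
  case: k => [|[|//]] _ /=; last first.
    by rewrite subr0 -mulrnA mul1n; exact: band_nat.
  by rewrite mul0rn sub0r; apply: bandN.
by case: k => [|[|k]] // _; rewrite /= mul0rn subr0.
Qed.
End Band.

Lemma Phi_free n (c : 'I_n -> B) : row_free (Phi c)^T -> forall z : 'I_n -> A,
  \sum_i (z i)%:A * c i = 0 -> forall i, z i = 0.
Proof.
move=> u z e i; apply: aE_inj; rewrite rmorph0.
have : (\row_i aE (z i)) *m (Phi c)^T = 0.
  apply/rowP => k; rewrite !mxE -[RHS](rmorph0 (phi (crep k))) -e rmorph_sum.
  by apply: eq_bigr => j _; rewrite !mxE /= phi_aM.
move=> /eqP; rewrite mulmx_free_eq0 // => /eqP/rowP/(_ i).
by rewrite !mxE.
Qed.
Lemma mult_char (c : 'I_deg -> B) (X : 'M[A]_deg) D (f : B) : Phi c \in unitmx ->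
  (forall j, D%:A * f * c j = \sum_k (X j k)%:A * c k) ->
  map_poly aE (char_poly X) = \prod_k ('X - (aE D * phi (crep k) f)%:P).
Proof.
move=> u h; rewrite map_char_poly.
pose dd : 'rV[E]_deg := \row_k (aE D * phi (crep k) f).
have e : map_mx aE X *m (Phi c)^T = (Phi c)^T *m diag_mx dd.
  rewrite mul_mx_diag; apply/matrixP => j k; rewrite !mxE.
  transitivity (phi (crep k) (\sum_k (X j k)%:A * c k)); last first.
    by rewrite -h !rmorphM /= phi_aE mulrC.
  by rewrite rmorph_sum; apply: eq_bigr => i _; rewrite !mxE /= phi_aM.
have : char_poly (map_mx aE X) = char_poly (diag_mx dd).
  have du : \det (map_mx (@polyC E) (Phi c)^T) != 0.
    rewrite det_map_mx polyC_eq0 -unitfE -unitmxE unitmx_tr //.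
  apply: (mulIf du); rewrite [RHS]mulrC /char_poly -!det_mulmx; congr (\det _).
  rewrite /char_poly_mx mulmxBl mulmxBr -!map_mxM e; congr (_ - _).
  by rewrite mul_scalar_mx mul_mx_scalar.
move=> ->; rewrite char_poly_trig; last exact: diag_mx_is_trig.
by apply: eq_bigr => k _; rewrite !mxE eqxx mulr1n.
Qed.

Definition spanV (bb : 'I_deg -> B) (m : nat) (f : B) : Prop := exists x : 'I_deg -> A,
  (forall i (l : int), (m < `|l|)%N -> coef (x i) l = 0) /\ f = \sum_i (x i)%:A * bb i.

(** In the basis [bb], multiplication by [D f] has entries concentrated in exponents up to [m + D0],
    where [D0] depends on the structure constants [t] alone. The characteristic polynomial inherits
    this according to weights. *)
Lemma span_consts : exists (bb : 'I_deg -> B) (D : A) (D0 : nat),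
  [/\ forall i, inC (bb i), Phi bb \in unitmx, w (aE D) = vone R &
  forall (m : nat) (f : B), spanV bb m f -> (forall g, vflat (w (phi g f)) <= 1) ->
  exists2 P : {poly A}, map_poly aE P = \prod_k ('X - (aE D * phi (crep k) f)%:P) &
    forall j (l : int), (j <= deg)%N -> (j * (m + D0) < `|l|)%N -> nrm r P`_(deg - j) l < 1].
Proof.
have [bb bC bu] := Phi_ex; have [D1 [eD1 hD1]] := Phi_span bC bu.
have D10 : D1 != 0 by rewrite -aE_eqn eD1 (w_eqn hw) expf_neq0 // -unitfE -unitmxE.
have [k0 [m0 [k0n ek0 _]]] := lead_mono D10.
(* With its leading monomial divided out, [D] has value 1, and multiplication by it changes no
   value. *)
pose D := mono k0^-1 (- m0) * D1.
have eD : w (aE D) = vone R by rewrite (rmorphM aE) (wM hw) ek0 w_monoV.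
have /choice[t ht] (ij : 'I_deg * 'I_deg) : exists t : 'I_deg -> A,
    D%:A * (bb ij.1 * bb ij.2) = \sum_k (t k)%:A * bb k.
  have [t ht] := hD1 _ (inCM (bC ij.1) (bC ij.2)); exists (fun k => mono k0^-1 (- m0) * t k).
  by rewrite algM -mulrA ht mulr_sumr; apply: eq_bigr => i _; rewrite algM mulrA.
pose V := invmx (Phi bb).
have flN := flat_nonarch hN hw.
have V0 i k : 0 <= vflat (w (V i k)) by exact: (abs_ge0 flN).
pose c1 : R := 1 + \sum_i \sum_k vflat (w (V i k)).
have c1V i k : vflat (w (V i k)) <= c1.
  rewrite /c1 (bigD1 i) //= (bigD1 k) //=; set x := \sum_(_ < _ | _) _; set y := \sum_(_ < _ | _) _.
  have x0 : 0 <= x by apply: sumr_ge0 => *; exact: V0.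
  have y0 : 0 <= y by apply: sumr_ge0 => *; apply: sumr_ge0 => *; exact: V0.
  lra.
have c11 : 1 <= c1 by rewrite lerDl; apply: sumr_ge0 => *; apply: sumr_ge0 => *; exact: V0.
pose c2 : R := 1 + \sum_i \sum_k gauss absK coef r (t i k).
have c2t i k : gauss absK coef r (t i k) <= c2.
  rewrite /c2 (bigD1 i) //= (bigD1 k) //=; set x := \sum_(_ < _ | _) _; set y := \sum_(_ | _) _.
  have x0 : 0 <= x by apply: sumr_ge0 => *; exact: gauss_ge0.
  have y0 : 0 <= y by apply: sumr_ge0 => *; apply: sumr_ge0 => *; exact: gauss_ge0.
  lra.
have c21 : 1 <= c2 by rewrite lerDl; apply: sumr_ge0 => *; apply: sumr_ge0 => *; exact: gauss_ge0.
pose cc := c1 * c2; have cc1 : 1 <= cc by rewrite mulr_ege1.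
(* With this error [ee * cc ^ j < 1] for all [j <= deg]. *)
pose ee := (cc ^+ deg)^-1 / 2.
have ccd : 1 <= cc ^+ deg by rewrite exprn_ege1.
have cc0 : 0 < cc by apply: lt_le_trans cc1.
have ee0 : 0 < ee by rewrite divr_gt0 // invr_gt0 exprn_gt0.
have [D0 hD0] : exists D0 : nat, forall i k (l : int), (D0 < `|l|)%N -> nrm r (t i k) l <= ee.
  have /choice[N hN'] (ik : 'I_deg * 'I_deg * 'I_deg) : exists N : nat, forall l : int, (N < `|l|)%N -> nrm r (t ik.1 ik.2) l <= ee.
    have [N hN'] := decay (t ik.1 ik.2) ee0; exists N => l /ltnW hl.
    by apply/ltW/hN' => //; exact: rab.
  exists (\max_ik N ik)%N => i k l h; apply: (hN' (i, k)).
  by apply: leq_ltn_trans h; exact: leq_bigmax.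
exists bb, D, D0; split=> // m f [x [hx ef]] hf.
have xE i : aE (x i) = \sum_k V i k * phi (crep k) f.
  have : V *m (Phi bb *m \col_i aE (x i)) = \col_i aE (x i) by rewrite mulKmx.
  move=> /matrixP/(_ i 0); rewrite !mxE => <-; apply: eq_bigr => k _; congr (_ * _).
  rewrite ef rmorph_sum mxE; apply: eq_bigr => j _.
  by rewrite !mxE /= phi_aM mulrC.
have xg i (l : int) : nrm r (x i) l <= c1.
  apply: le_trans (gauss_ub _ _ rab) _; rewrite -flat_aE xE.
  apply: (nabs_sum flN) => [|k _]; first exact: le_trans c11.
  rewrite (abs_mul flN) -[leRHS]mulr1; apply: ler_pM => //; exact: (abs_ge0 flN).
pose X : 'M[A]_deg := \matrix_(j, k) \sum_i x i * t (i, j) k.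
exists (char_poly X).
  apply: (mult_char bu) => j; rewrite ef mulr_sumr mulr_suml.
  rewrite (eq_bigr (fun i => \sum_k (x i * t (i, j) k)%:A * bb k)); last first.
    move=> i _; rewrite (_ : D%:A * ((x i)%:A * bb i) * bb j = (x i)%:A * (D%:A * (bb i * bb j))); last by ring.
    by rewrite (ht (i, j)) mulr_sumr; apply: eq_bigr => k _; rewrite algM mulrA.
  rewrite exchange_big; apply: eq_bigr => k _.
  by rewrite mxE scaler_suml mulr_suml.
have hX i j : band cc ee (m + D0) 1 (X i j).
  rewrite mxE; apply: band_sum => [||k _]; [by rewrite // ltW|by rewrite ltW|].
  move=> l; rewrite expr1; split=> [|hl].
    apply: (coef_mul_le r_gt0) => i'; apply: ler_pM; rewrite ?nrm_ge0 ?r_gt0 //.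
    exact: le_trans (gauss_ub _ _ rab) (c2t _ _).
  apply: (coef_mul_le r_gt0) => i'.
  have [i'm|i'm] := ltnP m `|i'|; first by rewrite /nrm hx // (abs_zero hN) !mul0r mulr_ge0 // ltW.
  apply: le_trans (_ : c1 * ee <= _).
    apply: ler_pM; rewrite ?nrm_ge0 ?r_gt0 //; apply: hD0; move: hl i'm; clear; lia.
  by rewrite mulrC ler_wpM2l ?(ltW ee0) // /cc ler_peMr // (le_trans ler01).
have hP := pband_char cc1 (ltW ee0) hX.
move=> j l jd hl; have := ((hP (deg - j)%N).1 (leq_subr _ _) l).2; rewrite subKn // => /(_ hl) h.
apply: le_lt_trans h _; apply: le_lt_trans (_ : ee * cc ^+ deg < _).
  by rewrite ler_wpM2l ?(ltW ee0) // ler_weXn2l.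
by rewrite /ee mulrAC mulVf ?mul1r ?invf_lt1 ?ltr1n // gt_eqF // exprn_gt0.
Qed.

(** Sup norms over the circle and flat parts are both read off from the Gauss norms of the
    coefficients of [chi c]. *)
Lemma flat_of_points c : (forall p, is_point p -> absK (p c) <= 1) -> forall g, vflat (w (phi g c)) <= 1.
Proof.
move=> h g; have [mQ sQ rQ] := phi_chi g c.
apply: (nabs_root_le (flat_nonarch hN hw) ler01 sQ mQ rQ) => i hi.
by rewrite coef_map flat_aE expr1n -[leRHS](expr1n _ (#|gT| - i)); apply: gauss_chi_le.
Qed.
Lemma points_of_flat c : (forall g, vflat (w (phi g c)) < 1) -> forall p, is_point p -> absK (p c) < 1.
Proof.
move=> h p hp; apply: (point_lt1_of_chi hp) => i hi.
have [g0 _ hmax] := @arg_maxP _ _ _ (1%g : gT) xpredT (fun g => vflat (w (phi g c))) isT.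
rewrite -flat_aE -coef_map chi_prod.
have flN := flat_nonarch hN hw.
have g00 : 0 <= vflat (w (phi g0 c)) by exact: (abs_ge0 flN).
have := nabs_prod_coef flN (s := [seq phi g c | g : gT]) i g00.
rewrite size_map -cardE => /(_ _)/le_lt_trans; apply.
  by move=> z /mapP[g _ ->]; exact: hmax.
by rewrite exprn_ilt1 // -lt0n subn_gt0.
Qed.

Section Bandwidth.
Variables (D : A) (f : B) (M : nat) (P : {poly A}).
Hypotheses (fC : inC f) (eD : w (aE D) = vone R) (f1 : forall g, vflat (w (phi g f)) <= 1).
Hypothesis eP : map_poly aE P = \prod_k ('X - (aE D * phi (crep k) f)%:P).
Hypothesis hP : forall j (l : int), (j <= deg)%N -> (j * M < `|l|)%N -> nrm r P`_(deg - j) l < 1.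

Let zs := [seq aE D * phi (crep k) f | k : 'I_deg].
Let eP' : map_poly aE P = \prod_(z <- zs) ('X - z%:P).
Proof. by rewrite eP big_image. Qed.
Let szs : size zs = deg. Proof. by rewrite size_map -cardE card_ord. Qed.
Let wz k : w (aE D * phi (crep k) f) = w (phi (crep k) f).
Proof. by rewrite (wM hw) eD vmul1. Qed.

(** The coefficient of index [deg - j] has norm at most 1; if it is 1, the leading exponent is at
    least [- j M]. So its value is at most [(1, - j M)], and the root bound applies. *)
Lemma bw_lower g : (w (phi g f) <= Some (1, - M%:R))%O.
Proof.
rewrite -phi_ci // -wz; set z := _ * _.
have sP : size (map_poly aE P) = deg.+1 by rewrite eP' size_prod_XsubC szs.
have mP : map_poly aE P \is monic by rewrite eP' monic_prod_XsubC.
have rz : root (map_poly aE P) z.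
  by rewrite eP' root_prod_XsubC; apply/mapP; exists (ci g); rewrite ?mem_enum.
apply: (w_root_le hN hw (n := deg) _ _ sP mP rz) => //; first exact: ltr01.
move=> i hi; rewrite coef_map /=.
have [->|P0] := eqVneq P`_i 0; first by rewrite rmorph0 (w0 hw).
have fl : vflat (w (aE P`_i)) <= 1.
  have := nabs_prod_coef (flat_nonarch hN hw) (s := zs) i ler01.
  rewrite -eP' coef_map expr1n; apply=> _ /mapP[k _ ->]; rewrite wz; exact: f1.
rewrite vexp_some expr1n; move: fl; rewrite w_aE.
have [l [_ -> _ _]] := eta_lead rab P0 => /= fl.
rewrite vle_some; case: ltgtP fl => //= e _.
have := hP (j := (deg - i)%N) (l := l) (leq_subr _ _).
rewrite subKn ?(ltnW hi) // e ltxx => h.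
have hl : (`|l| <= (deg - i) * M)%N by rewrite leqNgt; apply/negP => /h.
rewrite mulNrn -mulrnA pmulrn -rmorphN ler_int.
by rewrite mulnC; lia.
Qed.
(** Roots below [(1, M)] put the coefficient of index [deg - j] below [(1, j M)]. With norm 1 its
    leading exponent would exceed [j M], against [hP]; so the norms, and then the roots, are below
    1. *)
Lemma bw_upper : (forall g, (w (phi g f) < Some (1, M%:R))%O) -> forall g, vflat (w (phi g f)) < 1.
Proof.
move=> h g; rewrite -phi_ci // -wz; set z := _ * _.
have sP : size (map_poly aE P) = deg.+1 by rewrite eP' size_prod_XsubC szs.
have mP : map_poly aE P \is monic by rewrite eP' monic_prod_XsubC.
have rz : root (map_poly aE P) z.
  by rewrite eP' root_prod_XsubC; apply/mapP; exists (ci g); rewrite ?mem_enum.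
apply: (nabs_root_lt1 (flat_nonarch hN hw) sP mP rz) => i hi.
have [k0 _ hk0] := @arg_maxP _ _ _ (ci g) xpredT (fun k => w (phi (crep k) f)) isT.
rewrite coef_map /=; have [->|P0] := eqVneq P`_i 0; first by rewrite rmorph0 (w0 hw) ltr01.
have : (w (aE P`_i) < vexp (Some (1, M%:R)) (deg - i))%O.
  have := w_coef_prod hN hw (s := zs) (k := i) (wpos (phi (crep k0) f)).
  rewrite -eP' coef_map szs => hh; apply: le_lt_trans (hh _ (ltnW hi)) _.
    by move=> _ /mapP[k _ ->]; rewrite wz; exact: hk0.
  by apply: vexp_lt; rewrite ?subn_gt0 //; exact: ltr01.
rewrite vexp_some expr1n w_aE.
have [l [_ -> _ _]] := eta_lead rab P0; rewrite vlt_some /= => /orP[//|/andP[/eqP e hl]].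
have := hP (j := (deg - i)%N) (l := l) (leq_subr _ _).
rewrite subKn ?(ltnW hi) // e ltxx => hh; suff : false by []; apply: hh.
move: hl; rewrite -mulrnA pmulrn ltr_int mulnC; lia.
Qed.
End Bandwidth.

(** Some multiple [u d] of [d] has value 1; the residues of [u c] and [u d] are those of constants,
    whose quotient serves. *)
Lemma ratio g c d : (w (phi g c) <= w (phi g d))%O -> phi g d != 0 ->
  exists2 k, absK k <= 1 & (w (phi g (c - kB k * d)%R) < w (phi g d))%O.
Proof.
move=> h d0; have [l [m [l0 e]]] := w_phi_pow d0.
pose u := (mono l^-1 (- m))%:A * d ^+ (factorial #|gT|).-1.
have ud : w (phi g (u * d)) = vone R.
  by rewrite -mulrA -exprSr prednK ?fact_gt0 // phi_aM rmorphXn (wM hw) (wX hw) e w_monoV.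
have un : w (phi g u) != None.
  by apply: contra_eq_neq ud => e0; rewrite rmorphM (wM hw) e0.
have uc : (w (phi g (u * c)) <= vone R)%O.
  by rewrite -ud (rmorphM (phi g) u c) (rmorphM (phi g) u d) !(wM hw) ![vmul (w (phi g u)) _]vmulC vleM2rE.
have [kc kc1 hkc] := residue uc; have [kd kd1 hkd] : exists2 k, absK k <= 1 & (w (phi g (u * d) - kE k)%R < vone R)%O.
  by apply: residue; rewrite ud.
have kde : absK kd = 1.
  apply/le_anti; rewrite kd1 leNgt; apply/negP => h1.
  have : (w (phi g (u * d)) < vone R)%O.
    by rewrite -[phi g (u * d)](subrK (kE kd)); apply: (w_addlt hw) => //; rewrite w_kE_lt1.
  by rewrite ud ltxx.
have kd0 : kd != 0 by apply: contra_eq_neq kde => ->; rewrite (abs_zero hN) eq_sym oner_eq0.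
have k1 : absK (kc / kd) <= 1 by rewrite (abs_mul hN) (nabsV hN) kde invr1 mulr1.
exists (kc / kd) => //.
rewrite -(vltM2rE _ _ (wpos (phi g u)) un) ![vmul _ (w (phi g u))]vmulC -!(wM hw) -!(rmorphM (phi g)) ud.
have -> : u * (c - kB (kc / kd) * d) = u * c - kB (kc / kd) * (u * d) by ring.
rewrite [X in w X](_ : _ = (phi g (u * c) - kE kc) - kE (kc / kd) * (phi g (u * d) - kE kd)); last first.
  rewrite rmorphB (rmorphM (phi g) (kB _)) /= phi_kB mulrBr -(rmorphM kE) divfK //; ring.
apply: (w_sublt hN hw) => //; apply: le_lt_trans hkd; apply: (w_mull hN hw) => //.
by rewrite w_kE_le1.
Qed.

(** Orthonormality for the sup norm over the points. Elimination preserves this property, though not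
    the interpolation property of Leja points. *)
Definition ortho (n : nat) (l : 'I_n -> B) : Prop := forall k : 'I_n -> K,
  (forall i, absK (k i) <= 1) -> (exists i, absK (k i) = 1) ->
  exists2 p, is_point p & 1 <= absK (p (\sum_i kB (k i) * l i)).
Definition stable (Q : B -> Prop) : Prop := forall c d k, absK k <= 1 -> Q c -> Q d -> Q (c - kB k * d).

(** The pivot is an element of largest value at [y]. A combination of the new elements is one of the
    old elements with the same coefficients and an additional integral coefficient at the pivot, so
    orthonormality persists. *)
Lemma elim1 n (l : 'I_n.+1 -> B) Q y v : ortho l -> stable Q -> (forall i, Q (l i)) ->
  v != None -> (forall i, (w (phi y (l i)) <= v)%O) ->
  exists l' : 'I_n -> B, [/\ ortho l', forall i, Q (l' i) & forall i, (w (phi y (l' i)) < v)%O].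
Proof.
move=> hl hQ Ql vn hv.
have [i0 _ hi0] := @arg_maxP _ _ _ ord0 xpredT (fun i => w (phi y (l i))) isT.
have /choice[k hk] (i : 'I_n) : exists k, absK k <= 1 /\ (w (phi y (l (lift i0 i) - kB k * l i0)%R) < v)%O.
  have [e|ne] := eqVneq (w (phi y (l i0))) v; last first.
    exists 0; rewrite (abs_zero hN) ler01 kB0 mul0r subr0; split=> //.
    by apply: le_lt_trans (hi0 (lift i0 i) isT) _; rewrite lt_neqAle ne hv.
  have [||k k1 hk] := @ratio y (l (lift i0 i)) (l i0); first exact: (hi0 (lift i0 i) isT).
    by rewrite -(w_eqn hw) e.
  by exists k; rewrite -e.
exists (fun i => l (lift i0 i) - kB (k i) * l i0); split=> [q q1 [i1 qi1]|i|i]; last exact: (hk i).2.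
  have [||p hp h] := hl (fun i => if unlift i0 i is Some j then q j else - \sum_j q j * k j).
    move=> i; case: unliftP => [j _|_]; first exact: q1.
    rewrite (nabsN hN); apply: (nabs_sum hN) => // j _.
    by rewrite (abs_mul hN) mulr_ile1 ?(abs_ge0 hN) ?q1 ?(hk j).1.
  - by exists (lift i0 i1); rewrite liftK.
  exists p => //; move: h; rewrite (bigD1_ord i0) //= unlift_none.
  under [X in _ + X]eq_bigr => j _ do rewrite (liftK i0 j).
  rewrite kBN rmorph_sum mulNr mulr_suml addrC -sumrB.
  congr (_ <= absK (p _)); apply: eq_bigr => j _; rewrite /= kBM; ring.
by apply: hQ; [exact: (hk i).1|exact: Ql|exact: Ql].
Qed.
(** Natural parts at [y] are multiples of [1 / ram y], so each strict inequality gains a full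
    step. *)
Lemma elim_slots n N (l : 'I_(n + N) -> B) Q y (m : int) : ortho l -> stable Q ->
  (forall i, Q (l i)) -> (forall c, Q c -> inC c) ->
  (forall i, (w (phi y (l i)) <= Some (1%R, m%:~R / (ram y)%:R))%O) ->
  exists l' : 'I_N -> B, [/\ ortho l', forall i, Q (l' i) &
   forall i, (w (phi y (l' i)) <= Some (1%R, (m + n%:Z)%:~R / (ram y)%:R))%O].
Proof.
elim: n m l => [|n IH] m l hl hQ Ql QC hv; first by exists l; rewrite addr0.
have [l1 [h1 h2 h3]] : exists l1 : 'I_(n + N) -> B, [/\ ortho l1, forall i, Q (l1 i) & forall i, (w (phi y (l1 i)) < Some (1%R, m%:~R / (ram y)%:R))%O] := elim1 hl hQ Ql (isT : Some (1%R, m%:~R / (ram y)%:R) != None) hv.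
have [|l' [h1' h2' h3']] := IH (m + 1) l1 h1 hQ h2 QC.
  move=> i; move: (h3 i); case e: (w _) => [[p q]|] //.
  have [m' ->] := w_phi_nat (QC _ (h2 i)) e.
  rewrite vlt_some vle_some => /orP[->//|/andP[-> hm]]; rewrite orbC /=.
  have r0 : 0 < (ram y)%:R :> rat by rewrite ltr0n ram_gt0.
  by move: hm; rewrite ltr_pM2r ?invr_gt0 // ler_pM2r ?invr_gt0 // ltr_int ler_int; lia.
exists l'; split=> // i; apply: le_trans (h3' i) _.
by rewrite (_ : m + 1 + n%:Z = m + n.+1%:Z) //; lia.
Qed.
(** At a point [y] the numerators have to pass from [- M * ram y] to [M * ram y + 1], at the cost of
    one element per step. The bound reached at [y] is absorbed into [Q] before the next point. *)
Lemma elim_all (ys : seq gT) (M N : nat) Q (l : 'I_(\sum_(y <- ys) (M.*2 * ram y).+1 + N) -> B) :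
  ortho l -> stable Q -> (forall i, Q (l i)) -> (forall c, Q c -> inC c) ->
  (forall c g, Q c -> (w (phi g c) <= Some (1%R, - M%:R))%O) ->
  exists l' : 'I_N -> B, [/\ ortho l', forall i, Q (l' i) &
    forall i y, y \in ys -> (w (phi y (l' i)) < Some (1%R, M%:R))%O].
Proof.
elim: ys Q l => [|y ys IH] Q.
  by rewrite big_nil => l hl hQ Ql QC QM; exists l.
rewrite big_cons -addnA => l hl hQ Ql QC QM.
have r0 : (ram y)%:R != 0 :> rat by rewrite pnatr_eq0 -lt0n ram_gt0.
have [|l1 [h1 h2 h3]] := elim_slots (y := y) (m := - (M%:Z * (ram y)%:Z)) hl hQ Ql QC.
  move=> i; rewrite rmorphN rmorphM mulNr /= mulfK //; exact: QM.
pose Q' c := Q c /\ (w (phi y c) < Some (1%R, M%:R))%O.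
have [||||] := IH Q' l1 h1.
- move=> c d k k1 [q1 v1] [q2 v2]; split; first exact: hQ.
  rewrite rmorphB rmorphM /= phi_kB; apply: (w_sublt hN hw) => //.
  by apply: le_lt_trans v2; apply: (w_mull hN hw) => //; rewrite w_kE_le1.
- move=> i; split=> //; apply: le_lt_trans (h3 i) _.
  rewrite vlt_some ltxx eqxx /= ltr_pdivlMr ?ltr0n ?ram_gt0 //.
  rewrite -natrM [(M * ram y)%:R]pmulrn ltr_int; lia.
- by move=> c [/QC].
- by move=> c g [/QM].
move=> l' [h1' h2' h3']; exists l'; split=> // [i|i z]; first exact: (h2' i).1.
by rewrite in_cons => /predU1P[->|]; [exact: (h2' i).2|exact: h3'].
Qed.

Lemma kB_scale (k : K) f : (k *: f)%:A = kB k * f%:A.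
Proof. by rewrite /kB -algM -scalerAl mul1r. Qed.
Lemma spanV_lin bb m (k : K) (c d : B) : spanV bb m c -> spanV bb m d -> spanV bb m (c + kB k * d).
Proof.
move=> [x [hx ->]] [y [hy ->]]; exists (fun i => x i + k *: y i); split=> [i l hl|].
  by rewrite acoefD acoefZ hx // hy // mulr0 addr0.
rewrite mulr_sumr -big_split; apply: eq_bigr => i _ /=.
by rewrite scalerDl mulrDl kB_scale mulrA.
Qed.
Lemma spanV_sum bb m (I : Type) (s : seq I) (k : I -> K) (F : I -> B) :
  (forall i, spanV bb m (F i)) -> spanV bb m (\sum_(i <- s) kB (k i) * F i).
Proof.
move=> h; elim: s => [|i s IH]; last by rewrite big_cons addrC; exact: spanV_lin.
rewrite big_nil; exists (fun=> 0); split=> [i l _|]; first by rewrite acoef0.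
by rewrite big1 // => i _; rewrite scale0r mul0r.
Qed.

(** Otherwise one function survives the elimination at all points. It has sup norm at least 1 by
    [ortho], but its values are below [(1, m + D0)], so [bw_upper] and [points_of_flat] make it
    smaller than 1 at every point. *)
Lemma slots : exists D0 : nat, forall m : nat,
  (deg * m.*2.+1 <= \sum_(y in Y) ((m + D0).*2 * ram y).+1)%N.
Proof.
have [bb [D [D0 [bC bu eD hP]]]] := span_consts; exists D0 => m.
rewrite leqNgt; apply/negP => lt_slots.
have bfree : forall z : 'I_deg -> A, \sum_i (z i)%:A * bb i = 0 -> forall i, z i = 0.
  by apply: Phi_free; rewrite row_free_unit unitmx_tr.
pose J : finType := ('I_deg * 'I_(m.*2.+1))%type.
pose e (l : 'I_(m.*2.+1)) : int := l%:Z - m%:Z.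
pose F (j : J) : B := (xi (e j.2))%:A * bb j.1.
pose N := #|{: J}|.
pose v (i : nat) : B := if insub i is Some i' then F (enum_val (i' : 'I_N)) else 0.
have FV j : spanV bb m (F j).
  exists (fun i => if i == j.1 then xi (e j.2) else 0); split=> [i l hl|].
    case: eqP => _; last by rewrite acoef0.
    rewrite coef_xi (_ : l == _ = false) //; apply/negP => /eqP el; move: hl.
    by rewrite el /e; have := ltn_ord j.2; lia.
  rewrite (bigD1 j.1) //= eqxx big1 ?addr0 // => i /negPf ->.
  by rewrite scale0r mul0r.
have vV i : spanV bb m (v i).
  rewrite /v; case: insubP => [i' _ _|_]; first exact: FV.
  have := @spanV_sum bb m 'I_0 [::] (fun=> 0) (fun=> 0); rewrite big_nil; apply.
  by move=> [].
have vE (k : nat -> K) : \sum_(i < N) kB (k i) * v i = \sum_(j : J) kB (k (enum_rank j)) * F j.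
  rewrite [RHS](reindex (@enum_val _ (mem J))) /=; last first.
    by apply: onW_bij; exists enum_rank; [exact: enum_valK|exact: enum_rankK].
  by apply: eq_bigr => i _; rewrite /v valK enum_valK.
have [k hk i iN|l [p [hp hpl hl hlk]]] := @leja v N.
  have {hk} : \sum_i \sum_j kB (k (enum_rank ((i, j) : J))) * F (i, j) = 0.
    rewrite pair_bigA /= -[RHS]hk vE; apply: eq_bigr => -[j1 j2] _ //.
  rewrite (eq_bigr (fun i => (\sum_j (k (enum_rank (i, j)) *: xi (e j)))%:A * bb i)); last first.
    move=> i' _; rewrite scaler_suml mulr_suml; apply: eq_bigr => j _.
    by rewrite kB_scale /F mulrA.
  move=> /bfree h; pose i' := enum_val (Ordinal iN : 'I_N).
  have := congr1 (coef^~ (e i'.2)) (h i'.1); rewrite acoef_sum acoef0 (bigD1 i'.2) //= big1 ?addr0.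
    by rewrite acoefZ coef_xi eqxx mulr1 -surjective_pairing enum_valK.
  move=> j /eqP hj; rewrite acoefZ coef_xi (_ : _ == _ = false) ?mulr0 //.
  by apply/negP => /eqP; rewrite /e => ee; apply: hj; apply/val_inj => /=; lia.
pose Q c := [/\ spanV bb m c, inC c & forall p, is_point p -> absK (p c) <= 1].
have QC c : Q c -> inC c by case.
have VC c : spanV bb m c -> inC c.
  by move=> [x [_ ->]]; apply: inC_sum => i _; apply: inCM => //; exact: inC_alg.
have Ql (i : nat) : (i < N)%N -> Q (l i).
  move=> iN; have [k ek] := hlk i iN.
  have lV : spanV bb m (l i) by rewrite ek; apply: spanV_sum => j; exact: vV.
  by split=> //; [exact: VC|move=> q; exact: hl].
have stQ : stable Q.
  move=> c d k k1 [c1 c2 c3] [d1 d2 d3]; split.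
  - by rewrite -mulNr -kBN; exact: spanV_lin.
  - by apply: inCB => //; apply: inCM => //; exact: inC_kB.
  - move=> q hq; rewrite rmorphB rmorphM /= point_kB //; apply: (nabs_suble hN); first exact: c3.
    by rewrite (abs_mul hN) mulr_ile1 ?(abs_ge0 hN) ?d3.
have QP c : Q c -> exists2 P : {poly A}, map_poly aE P = \prod_k ('X - (aE D * phi (crep k) c)%:P) &
    forall j (l : int), (j <= deg)%N -> (j * (m + D0) < `|l|)%N -> nrm r P`_(deg - j) l < 1.
  by move=> [c1 _ c3]; apply: hP => //; exact: flat_of_points.
have NE : N = (deg * m.*2.+1)%N by rewrite /N card_prod !card_ord.
pose ys := enum Y; pose S := (\sum_(y <- ys) ((m + D0).*2 * ram y).+1)%N.
have SN : (S + 1 <= N)%N by rewrite addn1 NE /S big_enum.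
pose l1 (i : 'I_(S + 1)) := l i.
have l1o : ortho l1.
  move=> k k1 [i0 ki0]; exists (p i0); first by apply: hp; apply: leq_trans (ltn_ord i0) SN.
  rewrite rmorph_sum (bigD1 i0) //= big1 ?addr0.
    rewrite rmorphM /= point_kB; last by apply: hp; apply: leq_trans (ltn_ord i0) SN.
    by rewrite /l1 hpl ?eqxx ?mulr1 ?ki0 // (leq_trans (ltn_ord i0) SN).
  move=> i ii0; rewrite rmorphM /= /l1 hpl ?(leq_trans (ltn_ord _) SN) //.
  by rewrite (negPf ii0 : (i == i0 :> nat) = false) mulr0.
have [||l2 [l2o l2Q l2y]] := elim_all (M := m + D0) l1o stQ _ QC.
- by move=> i; apply: Ql; apply: leq_trans (ltn_ord i) SN.
- move=> c g Qc; have [P eP hP'] := QP c Qc.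
  apply: (bw_lower (D := D) (P := P)) => //; first exact: QC.
  by apply: flat_of_points; case: Qc.
have [||q hq] := l2o (fun=> 1); first by move=> i; rewrite (abs_one hN).
  by exists ord0; rewrite (abs_one hN).
rewrite big_ord1 kB1 mul1r leNgt => /negP; apply.
have [P eP hP'] := QP _ (l2Q ord0).
apply: points_of_flat hq; apply: (bw_upper (D := D) (P := P) _ eD eP hP'); first exact: QC.
move=> g; rewrite (eqvP _ _ (rep_eqv g)) ?l2y ?mem_enum ?rep_in //; exact: QC.
Qed.
Lemma card_idx_deg : #|{: idx}| = deg.
Proof.
apply/eqP; rewrite eqn_leq; apply/andP; split.
  apply: (@free_le _ (fun i => fam (enum_val i))) => [i|z e i]; first exact: famC.
  rewrite -(enum_valK i); apply: (@fam_free (fun j => z (enum_rank j))).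
  rewrite (reindex (fun j : 'I_#|{: idx}| => enum_val j)) /=; last exact/onW_bij/enum_val_bij.
  by rewrite -[RHS]e; apply: eq_bigr => j _; rewrite enum_valK.
have [D0 h] := slots; set T := #|_|.
rewrite leqNgt; apply/negP => lt_T.
(* If [T < deg], the left side of [slots] is at least [(T + 1) (2 m + 1)] and the right side at most
   [2 (m + D0) T + T]. For [m = D0 T] the former exceeds the latter by 1. *)
have := h (D0 * T)%N; apply/negP; rewrite -ltnNge.
have YT : (#|Y| <= T)%N.
  rewrite /T card_idx -sum1_card; apply: leq_sum => y _; exact: ram_gt0.
have -> : (\sum_(y in Y) ((D0 * T + D0).*2 * ram y).+1 = (D0 * T + D0).*2 * T + #|Y|)%N.
  under eq_bigr do rewrite -addn1.
  by rewrite big_split /= -big_distrr /= -card_idx sum1_card.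
apply: leq_ltn_trans (_ : (D0 * T + D0).*2 * T + T < _)%N; first by rewrite leq_add2l.
apply: leq_trans (_ : T.+1 * (D0 * T).*2.+1 <= _)%N; last by rewrite leq_mul2r lt_T orbT.
nia.
Qed.

Definition uniformizes (al : gT -> K) c : Prop := forall y g, y \in Y -> eqv y g ->
  w (phi g c - kE (al y)) = Some (1, (ram y)%:R^-1).
Lemma distinct_residues (ys : seq gT) : exists2 al : gT -> K, forall y, absK (al y) <= 1 &
  forall y z, y \in ys -> z \in ys -> y != z -> absK (al y - al z) = 1.
Proof.
elim: ys => [|y ys [al al1 h]]; first by exists (fun=> 0) => // y; rewrite (abs_zero hN).
have [u u1 hu] := abs_unit_avoid hN [seq al z | z <- ys].
have hu' z : z \in ys -> absK (u - al z) = 1 by move=> zs; rewrite hu ?map_f.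
exists (fun g => if g == y then u else al g) => [g|g t].
  by case: ifP => _; rewrite ?u1.
rewrite !in_cons; case: (eqVneq g y) => [->|gy]; case: (eqVneq t y) => [->|ty] //=.
- by move=> _ /hu'.
- by move=> /hu' h' _ _; rewrite (nabs_subC hN).
- exact: h.
Qed.
(** The local elements [al y + p y] are glued by approximate idempotents. Their precision [(1, 2)]
    is finer than every uniformizer value [(1, 1 / ram y)]. *)
Lemma theta_ex : exists al : gT -> K, [/\ forall y, absK (al y) <= 1,
  forall y z, y \in Y -> z \in Y -> y != z -> absK (al y - al z) = 1 &
  exists2 c, inC c & uniformizes al c].
Proof.
have [al al1 al2] := distinct_residues (enum Y).
exists al; split=> // [y z yY zY|]; first by apply: al2; rewrite mem_enum.
have /choice[z hz] g : exists z, inC z /\ forall t,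
  (eqv g t -> (w (phi t z - 1)%R <= Some (1, 2%:R))%O) /\ (~~ eqv g t -> (w (phi t z) <= Some (1, 2%:R))%O).
  by have [z zC hz] := idem g (isT : 0 < 2)%N; exists z.
have /choice[p hp] g : exists p, inC p /\ forall t,
  (eqv g t -> w (phi t p) = Some (1, 1%:~R / (ram g)%:R)) /\
  (~~ eqv g t -> (w (phi t p) < Some (1, 1%:~R / (ram g)%:R))%O).
  by have [p pC hp] := peak g 1; exists p.
have r0 y : 0 < (ram y)%:R^-1 :> rat by rewrite invr_gt0 ltr0n ram_gt0.
have r1 y : (ram y)%:R^-1 <= 1 :> rat by rewrite invf_le1 ?ltr0n ?ram_gt0 // ler1n ram_gt0.
have p1 y t : (w (phi t (p y)) <= vone R)%O.
  have h1 : ((Some (1%R, 1%:~R / (ram y)%:R) : val2 R) <= vone R)%O.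
    by rewrite mul1r vle_some eqxx ltW ?orbT.
  by have [/((hp y).2 t).1->//|/((hp y).2 t).2/ltW h] := boolP (eqv y t); exact: le_trans h h1.
have a1 y : (w (kE (al y)) <= vone R)%O by rewrite w_kE_le1.
exists (\sum_(y in Y) z y * (kB (al y) + p y)).
  apply: inC_sum => y _; apply: inCM; first exact: (hz y).1.
  by apply: inCD; [exact: inC_kB|exact: (hp y).1].
move=> y g yY yg; rewrite rmorph_sum (bigD1 y) //=.
have P1 : w (phi g (p y)) = Some (1, (ram y)%:R^-1) by rewrite (((hp y).2 g).1 yg) mul1r.
have lt2 : ((Some (1%R, 2%:R) : val2 R) < Some (1%R, (ram y)%:R^-1))%O.
  by rewrite vlt_some eqxx ltxx /=; have := r1 y; lra.
rewrite rmorphM rmorphD /= phi_kB; set S := \sum_(_ | _) _.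
have -> : phi g (z y) * (kE (al y) + phi g (p y)) + S - kE (al y) =
   ((phi g (z y) - 1) * (kE (al y) + phi g (p y)) + S) + phi g (p y) by ring.
rewrite (w_dom hN hw) P1 //; apply: le_lt_trans lt2; apply: (w_addle hw).
  rewrite mulrC; apply: (w_mull hN hw); last exact: (((hz y).2 g).1 yg).
  exact: (w_addle hw).
apply: (w_sum_le hw) => y' /andP[y'Y yy']; rewrite /= rmorphM rmorphD /= phi_kB mulrC.
apply: (w_mull hN hw); first exact: (w_addle hw).
apply: ((hz y').2 g).2; apply/negP => h; case/eqP: yy'; apply/eqP.
by rewrite -Y_eqv //; apply: eqv_trans h _; rewrite eqv_sym.
Qed.

(** * Monogenic generators and the discriminant *)

Section Theta.
Variables (al : gT -> K) (th : B).
Hypotheses (al1 : forall y, absK (al y) <= 1)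
  (al2 : forall y z, y \in Y -> z \in Y -> y != z -> absK (al y - al z) = 1)
  (thC : inC th) (hth : uniformizes al th).

Lemma theta_val y g b' : y \in Y -> eqv y g -> w (phi g th - kE b') =
  if absK (b' - al y) < 1 then Some (1, (ram y)%:R^-1) else Some (Num.max 1 (absK b'), 0).
Proof.
move=> yY yg; have -> : phi g th - kE b' = (phi g th - kE (al y)) - kE (b' - al y).
  by rewrite (rmorphB kE) /=; ring.
have r0 : 0 < (ram y)%:R^-1 :> rat by rewrite invr_gt0 ltr0n ram_gt0.
case: ifP => h.
  rewrite addrC (w_dom hN hw) hth // (wN hN hw).
  have [e|ne] := eqVneq (b' - al y) 0; first by rewrite e rmorph0 (w0 hw).
  by rewrite w_kE // vlt_some h.
have ne : b' - al y != 0 by apply: contraFneq h => ->; rewrite (abs_zero hN) ltr01.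
move: h => /negbT; rewrite -leNgt => h.
rewrite (w_dom hN hw) (wN hN hw) w_kE // ?hth //; last first.
  by rewrite vlt_some; case: ltgtP h => //= _ _; rewrite r0.
congr (Some (_, _)); have [b1|b1] := leP (absK b') 1.
  by apply/le_anti; rewrite h andbT; apply: (nabs_suble hN).
by rewrite addrC (nabs_dom hN) // (nabsN hN) (le_lt_trans (al1 y)).
Qed.
Lemma theta_le1 g : (w (phi g th) <= vone R)%O.
Proof.
have := @theta_val (rep g) g 0 (rep_in g); rewrite eqv_sym rep_eqv => /(_ isT).
rewrite rmorph0 subr0 => ->; rewrite (abs_zero hN); case: ifP => _.
  by rewrite vle_some ltxx eqxx /= invr_ge0.
by rewrite vle_some (max_l ler01) ltxx eqxx /=.
Qed.

(* A polynomial over K of degree < deg = sum of the ram y cannot have, for every y,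
   at least ram y roots close to al y. *)
Lemma theta_lattice (x : 'I_deg -> A) :
  (forall g, (w (phi g (\sum_k (x k)%:A * th ^+ k)) <= vone R)%O) ->
  forall k, (w (aE (x k)) <= vone R)%O.
Proof.
move=> h k; rewrite leNgt; apply/negP => hk.
have [i0 _ hi0] := @arg_maxP _ _ _ k xpredT (fun i => w (aE (x i))) isT.
have gt1 : (vone R < w (aE (x i0)))%O by apply: lt_le_trans (hi0 k isT).
have x0 : x i0 != 0.
  by rewrite -aE_eqn -vlt_none; apply: lt_trans gt1; rewrite vlt_none.
have [l [m [l0 em _]]] := lead_mono x0.
(* Division by the leading monomial of a largest coefficient makes all coefficients integral and one
   of them a unit. As this monomial has value above 1, the combination drops to at most [(1, 1)]. *)
pose y k := mono l^-1 (- m) * x k.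
have mm := w_monoV m l0; set mu := w (aE (mono l^-1 (- m))) in mm.
have mun : mu != None by rewrite aE_eqn mono_eq0 invr_eq0.
have yE i : w (aE (y i)) = vmul mu (w (aE (x i))) by rewrite (rmorphM aE) (wM hw).
have y1 i : (w (aE (y i)) <= vone R)%O.
  by rewrite yE -mm -em ![vmul mu _]vmulC (vleM2rE _ _ (wpos _) mun); exact: (hi0 i isT).
have yi0 : w (aE (y i0)) = vone R by rewrite yE em.
have mu1 : (mu <= Some (1%R, 1))%O.
  apply: w_aE_lt1; rewrite -/mu -mm -em -[ltLHS]vmul_1 ![vmul mu _]vmulC vltM2rE //.
  exact: wpos.
have zle g : (w (phi g (\sum_k (y k)%:A * th ^+ k)) <= Some (1%R, 1))%O.
  have -> : \sum_k (y k)%:A * th ^+ k = (mono l^-1 (- m))%:A * \sum_k (x k)%:A * th ^+ k.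
    by rewrite mulr_sumr; apply: eq_bigr => i _; rewrite /y algM mulrA.
  by rewrite phi_aM mulrC; apply: (w_mull hN hw).
have m10 : mono 1 0 = 1 := mono1.
have /choice[q hq] i : exists q, absK q <= 1 /\ (w (aE (y i) - kE q)%R < vone R)%O.
  have [|q q1 hq] := @res_ratio (y i) 1 0 (oner_neq0 _); first by rewrite m10 rmorph1 (w1 hw).
  by exists q; move: hq; rewrite m10 aE_subscale rmorph1 mulr1 (w1 hw).
(* Replacing the coefficients by their residues costs at most [(1, 1)], the largest value below 1 on
   [A]. *)
pose Q : {poly K} := \poly_(i < deg) (if insub i is Some i' then q i' else 0).
have Qi (i : 'I_deg) : Q`_i = q i by rewrite coef_poly ltn_ord valK.
have sQ : (size Q <= deg)%N by apply: size_poly.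
have Qle g : (w (map_poly kE Q).[phi g th] <= Some (1%R, 1))%O.
  rewrite (horner_coef_wide _ (leq_trans (size_poly _ _) sQ)).
  have -> : \sum_(i < deg) (map_poly kE Q)`_i * phi g th ^+ i =
    phi g (\sum_k (y k)%:A * th ^+ k) - \sum_(i < deg) (aE (y i) - kE (q i)) * phi g th ^+ i.
    rewrite rmorph_sum -sumrB; apply: eq_bigr => i _.
    by rewrite coef_map Qi /= phi_aM rmorphXn; ring.
  apply: (w_suble hN hw) => //; apply: (w_sum_le hw) => i _; rewrite mulrC; apply: (w_mull hN hw).
    by rewrite (wX hw); apply: vexp_le1 => //; exact: theta_le1.
  have := hq i => -[_]; rewrite kE_aE -(rmorphB aE); exact: w_aE_lt1.
have q0 : absK (q i0) = 1.
  apply/le_anti; rewrite (hq i0).1 leNgt; apply/negP => q1.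
  have : (w (aE (y i0)) < vone R)%O.
    rewrite -[aE (y i0)](subrK (kE (q i0))); apply: (w_addlt hw); first exact: (hq i0).2.
    by rewrite w_kE_lt1.
  by rewrite yi0 ltxx.
have [rs eQ] := closed_field_poly_normal Q.
have Q0 : Q != 0.
  apply: contra_eq_neq q0 => e; rewrite -Qi e coef0 (abs_zero hN) eq_sym; exact: oner_neq0.
have lQ : lead_coef Q != 0 by rewrite lead_coef_eq0.
pose near y' := [pred z | absK (z - al y') < 1].
have val y' : y' \in Y -> w (map_poly kE Q).[phi y' th] =
   Some (absK (lead_coef Q) * \prod_(z <- rs) (if near y' z then 1 else Num.max 1 (absK z)), (count (near y') rs)%:R / (ram y')%:R).
  move=> yY; rewrite {1}eQ map_polyZ rmorph_prod hornerZ horner_prod (wM hw) w_kE // (w_prod hw).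
  have -> : \big[@vmul R/vone R]_(z <- rs) w (map_poly kE ('X - z%:P)).[phi y' th] =
     Some (\prod_(z <- rs) (if near y' z then 1 else Num.max 1 (absK z)), (count (near y') rs)%:R / (ram y')%:R).
    elim: (rs) => [|z s IH]; first by rewrite !big_nil mul0r.
    rewrite !big_cons IH rmorphB /= map_polyX map_polyC !hornerE (theta_val _ yY (eqv_refl _)).
    by case: ifP => _ /=; rewrite ?mul1r ?add0r // natrD mulrDl div1r ?add0r.
  by rewrite /= add0r.
have maxE y' z : near y' z -> Num.max 1 (absK z) = 1.
  move=> hz; apply/max_l; rewrite -[z](subrK (al y')); apply: (nabs_addle hN) => //.
  exact: ltW.
(* The flat part of [Q] at the point is at least 1, so a value at most [(1, 1)] requires natural
   part at least 1; each root near [al y'] contributes [1 / ram y'] to it. *)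
have cnt y' : y' \in Y -> (ram y' <= count (near y') rs)%N.
  move=> yY; have := Qle y'; rewrite val // vle_some.
  have h1 : 1 <= absK (lead_coef Q) * \prod_(z <- rs) (if near y' z then 1 else Num.max 1 (absK z)).
    rewrite -[leLHS]q0 -Qi {1}eQ coefZ (abs_mul hN) ler_wpM2l ?(abs_ge0 hN) //.
    rewrite (eq_bigr (fun z => Num.max 1 (absK z))); last first.
      by move=> z _; case: ifP => // /maxE ->.
    exact: nabs_coef_prod.
  rewrite ltNge h1 /= => /andP[_]; rewrite ler_pdivlMr ?ltr0n ?ram_gt0 // mul1r ler_nat.
  by [].
have : (\sum_(y' in Y) count (near y') rs <= size rs)%N.
  have dis z : (\sum_(y' in Y) near y' z <= 1)%N.
    have [y0 /andP[y0Y n0]|hno] := pickP [pred y' in Y | near y' z]; last first.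
      by rewrite big1 // => y' yY; have := hno y'; rewrite /= yY /= => ->.
    rewrite (bigD1 y0) //= big1 ?addn0 ?leq_b1 // => y' /andP[yY ny].
    apply/eqP; rewrite eqb0; apply/negP => n1.
    have := al2 yY y0Y ny; have -> : al y' - al y0 = (z - al y0) - (z - al y') by ring.
    by move=> e; have := nabs_sublt hN n0 n1; rewrite e ltxx.
  elim: (rs) => [|z s IH] /=; first by rewrite big1.
  by have := leq_add (dis z) IH; rewrite -big_split /= add1n.
have szrs : (size rs < deg)%N.
  apply: leq_trans sQ; rewrite [in X in (_ < size X)%N]eQ size_scale // size_prod_XsubC //.
have : (deg <= \sum_(y' in Y) count (near y') rs)%N.
  by rewrite -card_idx_deg card_idx; apply: leq_sum.
by move: szrs; clear; lia.
Qed.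
(** A nonzero coefficient could be scaled by a constant to a value above 1, while the combination
    stays 0; [theta_lattice] excludes this. *)
Lemma theta_free (x : 'I_deg -> A) : \sum_k (x k)%:A * th ^+ k = 0 -> forall k, x k = 0.
Proof.
move=> e k; apply/eqP/negPn/negP => x0; have := w_pos hN hw (aE (x k)).
case ex : (w (aE (x k))) => [[p q]|]; last by move/eqP: ex; rewrite aE_eqn (negPf x0).
move=> p0; have [l l0 lp] := small_ex p0.
have : (w (aE (l^-1 *: x k)) <= vone R)%O.
  apply: (theta_lattice (x := fun k => l^-1 *: x k)) => g.
  rewrite (eq_bigr (fun i : 'I_deg => kB l^-1 * ((x i)%:A * th ^+ i))); last first.
    by move=> i _; rewrite kB_scale mulrA.
  by rewrite -mulr_sumr e mulr0 rmorph0 (w0 hw).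
rewrite aE_scale (wM hw) w_kE ?invr_eq0 // ex vle_some (nabsV hN).
have : 1 < (absK l)^-1 * p by rewrite mulrC ltr_pdivlMr ?mul1r // (nabs_gt0 hN).
by move=> h; rewrite ltNge (ltW h) gt_eqF.
Qed.
End Theta.

Lemma w_div_le1 (z y : E) : y != 0 -> (w (z / y) <= vone R)%O = (w z <= w y)%O.
Proof.
move=> y0; have yn : w y != None by rewrite (w_eqn hw).
by rewrite -(vleM2rE _ _ (wpos y) yn) -(wM hw) divfK // vmul1.
Qed.
Lemma w_det_le n (X : 'M[E]_n) : (forall i j, (w (X i j) <= vone R)%O) -> (w (\det X) <= vone R)%O.
Proof.
move=> h; apply: (w_sum_le hw) => s _; apply: (w_mull hN hw).
  by case: (odd_perm s); rewrite ?expr1 ?expr0 ?(wN hN hw) (w1 hw).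
elim/big_rec: _ => [|i z _ IH]; first by rewrite (w1 hw).
exact: (w_mull hN hw).
Qed.
Lemma w_det_eq (X Z U V : 'M[E]_deg) : X = Z *m U -> Z = X *m V ->
  (forall i j, (w (U i j) <= vone R)%O) -> (forall i j, (w (V i j) <= vone R)%O) ->
  w (\det X) = w (\det Z).
Proof.
move=> eX eZ hU hV; apply/le_anti/andP; split.
  by rewrite eX det_mulmx mulrC; apply: (w_mull hN hw) => //; exact: w_det_le.
by rewrite eZ det_mulmx mulrC; apply: (w_mull hN hw) => //; exact: w_det_le.
Qed.

Definition famI (i : 'I_deg) : B := fam (enum_val (cast_ord (esym card_idx_deg) i)).
Definition exI (i : 'I_deg) : rat := ex (enum_val (cast_ord (esym card_idx_deg) i)).
Lemma famIC i : inC (famI i). Proof. exact: famC. Qed.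
Lemma sum_famI (V : nmodType) (F : idx -> V) :
  \sum_i F i = \sum_(i : 'I_deg) F (enum_val (cast_ord (esym card_idx_deg) i)).
Proof.
rewrite (reindex (fun i : 'I_deg => enum_val (cast_ord (esym card_idx_deg) i))) //=.
apply: onW_bij; apply: bij_comp (enum_val_bij _) _.
exists (cast_ord card_idx_deg) => i; [exact: cast_ordKV|exact: cast_ordK].
Qed.
Lemma famI_free (z : 'I_deg -> A) : \sum_i (z i)%:A * famI i = 0 -> forall i, z i = 0.
Proof.
pose z' (j : idx) := z (cast_ord card_idx_deg (enum_rank j)).
have zE i : z i = z' (enum_val (cast_ord (esym card_idx_deg) i)).
  by rewrite /z' enum_valK cast_ordKV.
move=> e i; rewrite zE; apply: (@fam_free z'); rewrite sum_famI -[RHS]e.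
by apply: eq_bigr => j _; rewrite zE.
Qed.
Lemma famI_unit : Phi famI \in unitmx.
Proof.
have [bb bC bu] := Phi_ex.
by apply: (Phi_unit famIC bC _ bu) => z; exact: famI_free.
Qed.
Lemma famI_le (z : 'I_deg -> A) i : exists t,
  (vmul (w (aE (z i))) (Some (1%R, exI i)) <= w (phi t (\sum_i (z i)%:A * famI i)))%O.
Proof.
pose z' (j : idx) := z (cast_ord card_idx_deg (enum_rank j)).
have zE j : z j = z' (enum_val (cast_ord (esym card_idx_deg) j)).
  by rewrite /z' enum_valK cast_ordKV.
have [t ht] := orth_le z' (enum_val (cast_ord (esym card_idx_deg) i)).
exists t; rewrite zE; apply: le_trans ht _; rewrite sum_famI le_eqVlt; apply/orP; left.
by apply/eqP; congr (w (phi t _)); apply: eq_bigr => j _; rewrite zE.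
Qed.
Lemma w_aE_int f : f != 0 -> exists p (m : int), w (aE f) = Some (p, m%:~R).
Proof.
by rewrite w_aE => /(eta_lead rab)[m [_ -> _ _]]; exists (nrm r f m), m.
Qed.
Lemma span_div (c : 'I_deg -> B) D z (x : 'I_deg -> A) : D != 0 ->
  D%:A * z = \sum_i (x i)%:A * c i ->
  forall g, phi g z = \sum_i aE (x i) / aE D * phi g (c i).
Proof.
move=> D0 e g; have aD : aE D != 0 by rewrite -(w_eqn hw) aE_eqn.
apply: (mulfI aD); rewrite -phi_aM e rmorph_sum mulr_sumr; apply: eq_bigr => i _ /=.
by rewrite phi_aM mulrA mulrCA divff // mulr1.
Qed.
Lemma det_neq0 (c : 'I_deg -> B) D : Phi c \in unitmx -> aE D = \det (Phi c) ^+ 2 -> D != 0.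
Proof.
by move=> u eD; rewrite -aE_eqn eD (w_eqn hw) expf_neq0 // -unitfE -unitmxE.
Qed.
(** Orthogonality bounds the coordinate [x i / D] only up to the factor [(1, exI i)]. Since
    [exI i < 1] and natural parts on [A] are integers, the coordinate is integral nevertheless. *)
Lemma famI_int z : inC z -> (forall g, (w (phi g z) <= vone R)%O) -> exists u : 'I_deg -> E,
  (forall i, (w (u i) <= vone R)%O) /\ forall g, phi g z = \sum_i u i * phi g (famI i).
Proof.
move=> zC z1; have [D [eD hD]] := Phi_span famIC famI_unit.
have D0 := det_neq0 famI_unit eD; have [x ex] := hD z zC.
exists (fun i => aE (x i) / aE D); split=> [i|g]; last exact: (span_div D0 ex).
have [t] := famI_le x i; rewrite -ex phi_aM mulrC => h.
have aD : w (aE D) != None by rewrite aE_eqn.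
have {}h : (vmul (w (aE (x i))) (Some (1%R, exI i)) <= w (aE D))%O.
  by apply: le_trans h _; apply: (w_mull hN hw).
have [->|x0] := eqVneq (x i) 0; first by rewrite rmorph0 mul0r (w0 hw).
rewrite w_div_le1 -?(w_eqn hw) //.
have [p [m e1]] := w_aE_int x0; have [q [n e2]] := w_aE_int D0.
move: h; rewrite e1 e2 /= mulr1 !vle_some => /orP[->//|/andP[-> hm]]; apply/orP; right.
have /andP[_ e_lt] := ex_bounds (enum_val (cast_ord (esym card_idx_deg) i)).
rewrite /= ler_int -ltzD1 -(ltr_int rat) rmorphD /=.
by move: hm e_lt; rewrite /exI; lra.
Qed.

Section ThetaInt.
Variables (al : gT -> K) (th : B).
Hypotheses (al1 : forall y, absK (al y) <= 1)
  (al2 : forall y z, y \in Y -> z \in Y -> y != z -> absK (al y - al z) = 1)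
  (thC : inC th) (hth : uniformizes al th).
Let pw (k : 'I_deg) := th ^+ k.
Let pwC k : inC (pw k). Proof. exact: inCX. Qed.
Lemma theta_unit : Phi (fun k : 'I_deg => th ^+ k) \in unitmx.
Proof.
have [bb bC bu] := Phi_ex; apply: (Phi_unit pwC bC _ bu) => z.
exact: (theta_free al1 al2 hth).
Qed.
Lemma theta_int z : inC z -> (forall g, (w (phi g z) <= vone R)%O) -> exists u : 'I_deg -> E,
  (forall k, (w (u k) <= vone R)%O) /\ forall g, phi g z = \sum_k u k * phi g th ^+ k.
Proof.
move=> zC z1; have [D [eD hD]] := Phi_span pwC theta_unit.
have D0 := det_neq0 theta_unit eD; have [x ex] := hD z zC.
exists (fun i => aE (x i) / aE D); split=> [i|g]; last first.
  by rewrite (span_div D0 ex); apply: eq_bigr => i _; rewrite rmorphXn.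
have aD : w (aE D) != None by rewrite aE_eqn.
have [k [m [k0 ek _]]] := lead_mono D0.
pose mu := mono k^-1 (- m).
have : (w (aE (mu * x i)) <= vone R)%O.
  apply: (theta_lattice al1 al2 hth (x := fun i => mu * x i)) => g.
  have -> : \sum_(k0 < deg) (mu * x k0)%:A * th ^+ k0 = (mu * D)%:A * z.
    by rewrite algM -mulrA ex mulr_sumr; apply: eq_bigr => j _; rewrite algM mulrA.
  by rewrite phi_aM (wM hw) (rmorphM aE) (wM hw) ek w_monoV // vmul1.
rewrite (rmorphM aE) (wM hw) => h.
have mun : w (aE mu) != None by rewrite aE_eqn mono_eq0 invr_eq0.
rewrite w_div_le1 -?(w_eqn hw) // ek -(vleM2rE _ _ (wpos (aE mu)) mun).
by rewrite ![vmul _ (w (aE mu))]vmulC w_monoV.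
Qed.
Lemma w_det_fam : w (\det (Phi famI)) = w (\det (Phi (fun k : 'I_deg => th ^+ k))).
Proof.
have th1 := theta_le1 al1 hth.
have /choice[u hu] (i : 'I_deg) : exists u : 'I_deg -> E, (forall k, (w (u k) <= vone R)%O) /\
    forall g, phi g (famI i) = \sum_k u k * phi g th ^+ k.
  apply: (theta_int (famIC i)) => g; apply: le_trans (fam_le _ _) _.
  by rewrite vle_some eqxx /=; have /andP[->] := ex_bounds (enum_val (cast_ord (esym card_idx_deg) i)); rewrite orbT.
have /choice[v hv] (k : 'I_deg) : exists v : 'I_deg -> E, (forall i, (w (v i) <= vone R)%O) /\
    forall g, phi g (th ^+ k) = \sum_i v i * phi g (famI i).
  apply: famI_int => [|g]; first exact: inCX.
  by rewrite rmorphXn (wX hw); apply: vexp_le1; [exact: wpos|exact: th1].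
apply: (@w_det_eq _ _ (\matrix_(k, i) u i k) (\matrix_(i, k) v k i)).
- apply/matrixP => g i; rewrite !mxE (hu i).2; apply: eq_bigr => k _.
  by rewrite !mxE rmorphXn mulrC.
- apply/matrixP => g k; rewrite !mxE (hv k).2; apply: eq_bigr => i _.
  by rewrite !mxE mulrC.
- by move=> i j; rewrite mxE; exact: (hu j).1.
- by move=> i j; rewrite mxE; exact: (hv j).1.
Qed.
Lemma w_det_theta : vexp (w (\det (Phi (fun k : 'I_deg => th ^+ k)))) 2 =
  \big[@vmul R/vone R]_k \big[@vmul R/vone R]_(l | l != k) w (phi (crep k) th - phi (crep l) th).
Proof.
have -> : Phi (fun k : 'I_deg => th ^+ k) = (Vandermonde deg (\row_k phi (crep k) th))^T.
  by apply/matrixP => k l; rewrite !mxE rmorphXn.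
rewrite det_tr det_Vandermonde (w_prod hw) /=.
pose W k l := w (phi (crep k) th - phi (crep l) th).
have Wsym k l : W k l = W l k by exact: (w_subC hN hw).
rewrite (eq_bigr (fun k : 'I_deg => \big[@vmul R/vone R]_(l : 'I_deg | (k < l)%N) W k l)); last first.
  by move=> k _; rewrite (w_prod hw); apply: eq_bigr => l _; rewrite !mxE Wsym.
rewrite vmul_1.
rewrite [X in vmul _ X](exchange_big_dep xpredT) //= -big_split /=; apply: eq_bigr => k _.
rewrite [RHS](bigID (fun l : 'I_deg => (k < l)%N)) /=; congr vmul.
  by apply: eq_bigl => l; case: ltngtP => //; rewrite ?andbT ?andbF // => h; rewrite -val_eqE gtn_eqF.
apply: eq_big => [l|l _]; last exact: Wsym.
by rewrite -val_eqE; case: ltngtP.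
Qed.
End ThetaInt.
End FixedRing.

(** Synthetic division from the top, [Q_k = G_(k+1) + z Q_(k+1)], keeps the coefficients
    integral. *)
Lemma w_factor (G : {poly E}) z : (w z <= vone R)%O -> (forall i, (w G`_i <= vone R)%O) -> root G z ->
  exists2 Q, G = Q * ('X - z%:P) & forall i, (w Q`_i <= vone R)%O.
Proof.
move=> z1 G1 /factor_theorem[Q eQ]; exists Q => // i.
have rec k : Q`_k = G`_k.+1 + z * Q`_k.+1.
  by rewrite eQ mulrBr coefB coefMX coefMC /= mulrC subrK.
have [n] := ubnP (size Q - i); elim: n i => // n IH i hn.
have [h|h] := leqP (size Q) i; first by rewrite nth_default // (w0 hw).
rewrite rec; apply: (w_addle hw) => //; apply: (w_mull hN hw) => //.
apply: IH; lia.
Qed.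
Lemma w_horner_roots (rs : seq E) (G : {poly E}) z : uniq rs -> all (root G) rs ->
  (forall y, y \in rs -> (w y <= vone R)%O) -> (w z <= vone R)%O ->
  (forall i, (w G`_i <= vone R)%O) ->
  (w G.[z] <= \big[@vmul R/vone R]_(y <- rs) w (z - y))%O.
Proof.
move=> + + + z1; elim: rs G => [|y rs IH] G /=.
  move=> _ _ _ G1; rewrite big_nil horner_coef; apply: (w_sum_le hw) => i _.
  by rewrite mulrC; apply: (w_mull hN hw) => //; rewrite (wX hw); apply: vexp_le1; rewrite ?(w_pos hN hw).
move=> /andP[yrs urs] /andP[ry rG] h G1.
have y1 : (w y <= vone R)%O by apply: h; rewrite mem_head.
have [Q eQ Q1] := w_factor y1 G1 ry.
rewrite big_cons eQ hornerM hornerXsubC (wM hw) vmulC vmulC [vmul (w Q.[z]) _]vmulC.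
rewrite ![vmul (w (z - y)) _]vmulC; apply: vleM2r; first exact: (w_pos hN hw).
apply: IH => //; last by move=> y' y's; apply: h; rewrite in_cons y's orbT.
apply/allP => y' y's; move/allP: rG => /(_ _ y's); rewrite eQ rootM root_XsubC => /orP[//|/eqP e].
by move: yrs; rewrite -e y's.
Qed.
Lemma w_horner_diff (G : {poly E}) y z : (w y <= vone R)%O -> (w z <= vone R)%O ->
  (forall i, (w G`_i <= vone R)%O) -> (w (G.[y] - G.[z]) <= w (y - z))%O.
Proof.
move=> y1 z1 G1; rewrite !horner_coef -sumrB; apply: (w_sum_le hw) => i _.
rewrite -mulrBr; apply: (w_mull hN hw) => //; rewrite subrXX mulrC.
apply: (w_mull hN hw) => //; apply: (w_sum_le hw) => j _.
by apply: (w_mull hN hw); rewrite (wX hw); apply: vexp_le1; rewrite ?(w_pos hN hw).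
Qed.

(** The coefficients of [G] may lie in [E]: they arise as quotients of elements of [A], and the same
    [G] serves for all conjugates. *)
Definition generates (H : {group gT}) t : Prop := [/\ inC H t, forall g, (w (phi g t) <= vone R)%O &
  forall z : B, inC H z -> (forall g, (w (phi g z) <= vone R)%O) ->
  exists2 G : {poly E}, forall i, (w G`_i <= vone R)%O & forall g, phi g z = G.[phi g t]].
Lemma theta_generates H al t : (forall y, absK (al y) <= 1) ->
  (forall y z : gT, y \in Y H -> z \in Y H -> y != z -> absK (al y - al z) = 1) ->
  inC H t -> uniformizes H al t -> generates H t.
Proof.
move=> al1 al2 tC ht; split=> // [g|z zC z1]; first exact: theta_le1 ht g.
have [u [u1 hu]] := theta_int al1 al2 tC ht zC z1.
exists (\poly_(i < deg H) (if insub i is Some i' then u i' else 0)) => [i|g].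
  rewrite coef_poly; case: ifP => _; last by rewrite (w0 hw).
  by case: insub => [i'|]; [exact: u1|rewrite (w0 hw)].
by rewrite horner_poly hu; apply: eq_bigr => k _; rewrite valK.
Qed.
Lemma inC_triv c : inC [1 gT]%G c.
Proof. by move=> h /set1gP ->; rewrite (gal_act1 hB). Qed.
(** If the embeddings agree, the Galois relation for [g^-1 g'] has the same image as the one for 1,
    namely 1, so this element is trivial. *)
Lemma phi_sep g g' : (forall c, phi g c = phi g' c) -> g = g'.
Proof.
move=> h; have [n [u [v hv]]] := gal_etale hB.
have e1 : phi g (\sum_i u i * act (g^-1 * g')%g (v i)) = 1.
  have <- : phi g (\sum_i u i * act 1%g (v i)) = 1 by rewrite hv eqxx rmorph1.
  rewrite !rmorph_sum; apply: eq_bigr => i _; rewrite !rmorphM /=; congr (_ * _).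
  by rewrite (gal_act1 hB) [RHS]h /phi /= -!(gal_actM hB) mulKVg.
move: e1; rewrite hv rmorph_nat; case: eqP => [e _|_ /eqP]; last by rewrite eq_sym oner_eq0.
by rewrite -[g]mulg1 -e mulKVg.
Qed.
Lemma scale_integral c : exists2 k : K, k != 0 & forall g, (w (phi g (kB k * c)) <= vone R)%O.
Proof.
have flN := flat_nonarch hN hw.
have c0 g : 0 <= vflat (w (phi g c)) by exact: (abs_ge0 flN).
pose M : R := 1 + \sum_g vflat (w (phi g c)).
have M0 : 0 < M by rewrite ltr_pwDl // sumr_ge0.
have [k k0 hk] := small_ex (divr_gt0 (ltr01 : (0 : R) < 1) M0).
exists k => // g; rewrite rmorphM /= phi_kB (wM hw) w_kE //.
have h : vflat (w (phi g c)) <= M.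
  rewrite /M (bigD1 g) //= addrCA lerDl addr_ge0 // sumr_ge0 //.
move: h (c0 g); case: (w (phi g c)) => [[p q]|] //= h p0.
rewrite vle_some; apply/orP; left; apply: le_lt_trans (_ : absK k * M < 1).
  by rewrite ler_wpM2l // (abs_ge0 hN).
by rewrite -ltr_pdivlMr.
Qed.
Lemma gen_inj (s : B) : generates [1 gT]%G s -> injective (fun g => phi g s).
Proof.
move=> [_ _ hs] g g' /= e; apply: phi_sep => c.
have [k k0 hk] := scale_integral c; have [G _ hG] := hs _ (@inC_triv _) hk.
have := hG g; rewrite e -hG !rmorphM /= !phi_kB; apply: mulfI.
by rewrite -(w_eqn hw) w_kE.
Qed.

(* Serre, Local Fields, IV, Proposition 3. *)
Lemma serre H (t s : B) g g' : generates H t -> generates [1 gT]%G s ->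
  w (phi g t - phi g' t) = \big[@vmul R/vone R]_(h in H) w (phi g s - phi (g' * h)%g s).
Proof.
move=> [tC t1 ht] hs; have [_ s1 hs'] := hs.
apply/le_anti/andP; split.
  have [G G1 hG] := hs' _ (@inC_triv t) t1.
  (* As [t = G(s)], the polynomial [G'] vanishes at the elements [phi (g' h) s], and the
     corresponding monic linear factors split off with an integral quotient. *)
  pose G' := G - (phi g' t)%:P.
  have G'1 i : (w G'`_i <= vone R)%O.
    rewrite coefB coefC; apply: (w_suble hN hw) => //.
    by case: ifP; rewrite ?(w0 hw).
  have -> : phi g t - phi g' t = G'.[phi g s] by rewrite !hornerE -hG.
  have := @w_horner_roots [seq phi (g' * h)%g s | h in H] G' (phi g s).
  rewrite big_image /=; apply=> //.
  - rewrite map_inj_uniq ?enum_uniq // => h h' /(gen_inj hs); exact: mulgI.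
  - apply/allP => _ /mapP[h hH ->]; rewrite /root !hornerE -hG (phi_coset _ tC) ?subrr //; by rewrite mem_enum in hH.
  - by move=> _ /mapP[h _ ->].
(* The coefficients of [F] are invariant, hence integral polynomials in [t]; so the transforms of
   [F] by [g] and [g'] differ by at most [phi g t - phi g' t]. At [phi g s] the transform by [g]
   vanishes. *)
pose F : {poly B} := \prod_(h in H) ('X - (act h s)%:P).
have FC i : inC H F`_i.
  move=> k kH; rewrite -coef_map; suff -> : map_poly (act k) F = F by [].
  rewrite rmorph_prod [RHS](reindex_inj (mulgI k)) /=.
  apply: eq_big => [h|h _]; first by rewrite groupMl.
  by rewrite rmorphB /= map_polyX map_polyC /= (gal_actM hB).
have FE (g0 : gT) : map_poly (phi g0) F = \prod_(h in H) ('X - (phi (g0 * h)%g s)%:P).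
  rewrite rmorph_prod; apply: eq_bigr => h _.
  by rewrite rmorphB /= map_polyX map_polyC /= /phi /= (gal_actM hB).
have F1 i g0 : (w (phi g0 F`_i) <= vone R)%O.
  have int1 : forall i : nat, (w (1 : {poly E})`_i <= vone R)%O.
    by move=> j; rewrite coef1; case: eqP; rewrite ?(w0 hw) ?(w1 hw).
  rewrite -coef_map FE; elim/big_ind: _ i => //.
    move=> p q hp hq i; rewrite coefM; apply: (w_sum_le hw) => j _; exact: (w_mull hN hw).
  move=> h _ i; rewrite coefB coefX coefC; apply: (w_suble hN hw).
    by case: (_ == _); rewrite ?(w0 hw) ?(w1 hw).
  by case: ifP; rewrite ?(w0 hw).
have e0 : (map_poly (phi g) F).[phi g s] = 0.
  by rewrite FE horner_prod (bigD1 1%g) ?group1 //= mulg1 !hornerE subrr mul0r.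
have e1 : (map_poly (phi g') F).[phi g s] = \prod_(h in H) (phi g s - phi (g' * h)%g s).
  by rewrite FE horner_prod; apply: eq_bigr => h _; rewrite !hornerE.
rewrite -(w_prod hw) -e1 -[X in w X]subr0 -e0 (w_subC hN hw (phi g t)).
rewrite -hornerN -hornerD horner_coef; apply: (w_sum_le hw) => i _.
rewrite mulrC; apply: (w_mull hN hw).
  by rewrite (wX hw); apply: vexp_le1; rewrite ?(w_pos hN hw).
rewrite coefB !coef_map /=.
have [G G1 hG] := ht _ (FC i) (F1 i).
by rewrite !hG; apply: w_horner_diff.
Qed.

Section Ramification.
Let x c := w (iota c).
Variables (actE : gT -> {rmorphism E -> E}) (ix : gT -> val2 R).
Hypotheses (hactE : is_stabilizer_action act x w iota actE)
  (hix : is_ramification_function act x w actE ix).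
Let St := stabilizer act x.
Lemma mem_St s : (s \in St) = `[< forall c, w (phi s c) = w (phi 1%g c) >].
Proof.
rewrite inE; apply/asboolP/asboolP => h c; have := h c.
  by rewrite /phi /= (gal_act1 hB).
by rewrite /phi /= (gal_act1 hB).
Qed.
Lemma eqv_St g s : eqv [1 gT]%G g (s * g)%g = (s \in St).
Proof.
rewrite mem_St; apply/eqvP/asboolP => h c.
  by have := h (act g^-1 c) (@inC_triv _); rewrite /phi /= -!(gal_actM hB) mulgK mulgV.
by move=> _; have := h (act g c); rewrite /phi /= -!(gal_actM hB) mul1g.
Qed.
(** Since [g] permutes [B], the embeddings [phi g] share one value group. So [phi g s] minus its
    residue is a uniformizer at [x] for every [g], and [actE sg] carries it to the same expression
    for [sg * g]. *)
Lemma ram_St g (al : gT -> K) (s : B) sg : (forall y, absK (al y) <= 1) ->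
  uniformizes [1 gT]%G al s -> sg \in St -> ix sg = w (phi g s - phi (sg * g)%g s).
Proof.
move=> al1 hs sgS; pose y := rep [1 gT]%G g.
pose t := phi g s - kE (al y).
have yg : eqv [1 gT]%G y g by rewrite eqv_sym; exact: rep_eqv.
have wt : w t = Some (1, (ram [1 gT]%G y)%:R^-1) by apply: hs => //; exact: rep_in.
have r0 : 0 < (ram [1 gT]%G y)%:R :> rat by rewrite ltr0n ram_gt0.
have [hE _] := hactE sgS.
have ut : is_uniformizer x w t.
  split.
    split; last by rewrite wt /vlt /= ltxx eqxx /= -ltNge invr_gt0.
    exists (act g s - kB (al y)), 1; rewrite /x rmorph1 (w1 hw) /=.
    have -> : iota (act g s - kB (al y)) = t by rewrite rmorphB.
    by rewrite wt /= invr1 mulr1 oppr0 addr0.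
  move=> v [[c [d [c0 d0 ->]]]].
  have nat_y (e : B) p q : x e = Some (p, q) -> exists m : int, q = m%:~R / (ram [1 gT]%G y)%:R.
    move=> ee; apply: (w_phi_nat (g := y) (c := act y^-1%g e)); first exact: inC_triv.
    by rewrite /phi /= -(gal_actM hB) mulgV (gal_act1 hB); exact: ee.
  case ec: (x c) c0 => [[p q]|] // _; case ed: (x d) d0 => [[p' q']|] // _.
  have [m ->] := nat_y _ _ _ ec; have [m' ->] := nat_y _ _ _ ed.
  rewrite wt vltE vleE /vmul /vinv vlt_some vle_some -mulrBl -rmorphB /= => /orP[->//|/andP[-> hm]].
  apply/orP; right; move: hm; rewrite pmulr_lgt0 ?invr_gt0 // ltr0z => hm.
  by rewrite ler_peMl ?invr_ge0 ?(ltW r0) // ler1z.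
rewrite (hix sgS ut); congr (w _).
have -> : actE sg t = phi (sg * g)%g s - kE (al y).
  by rewrite /t rmorphB /= !hE -(gal_actM hB) act_alg.
rewrite /t; ring.
Qed.
(** Outside the stabilizer [g] and [sg * g] give different points of X, where [s] has distinct
    residues. *)
Lemma ram_out g (al : gT -> K) (s : B) sg : (forall y, absK (al y) <= 1) ->
  (forall y z : gT, y \in Y [1 gT]%G -> z \in Y [1 gT]%G -> y != z -> absK (al y - al z) = 1) ->
  uniformizes [1 gT]%G al s -> sg \notin St -> w (phi g s - phi (sg * g)%g s) = vone R.
Proof.
move=> al1 al2 hs sgS; pose y := rep [1 gT]%G g; pose z := rep [1 gT]%G (sg * g)%g.
have yz : y != z by rewrite -rep_eq eqv_St.
have lt1 g0 : (w (phi g0 s - kE (al (rep [1 gT]%G g0))) < vone R)%O.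
  rewrite hs ?rep_in //; last by rewrite eqv_sym rep_eqv.
  by rewrite vlt_some eqxx ltxx /= invr_gt0 ltr0n ram_gt0.
have e : w (kE (al y - al z)) = vone R by apply: w_kE1; apply: al2 => //; exact: rep_in.
have -> : phi g s - phi (sg * g)%g s = (phi g s - kE (al y)) - (phi (sg * g)%g s - kE (al z)) + kE (al y - al z).
  by rewrite (rmorphB kE) /=; ring.
rewrite (w_dom hN hw) e //; apply: (w_sublt hN hw); exact: lt1.
Qed.
Lemma disc_formula H : vexp (w (\det (Phi H (@famI H)))) 2 =
  \big[@vmul R/vone R]_k \big[@vmul R/vone R]_(sg in St | ((crep (H := H) k)^-1 * sg * crep k)%g \notin H) ix sg.
Proof.
have [al [al1 al2 [t tC ht]]] := theta_ex H.
have [al' [al1' al2' [s sC hs]]] := theta_ex [1 gT]%G.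
have gt := theta_generates al1 al2 tC ht; have gs := theta_generates al1' al2' sC hs.
rewrite (w_det_fam al1 al2 tC ht) w_det_theta; apply: eq_bigr => k _.
pose W (g' : gT) := w (phi (crep k) s - phi g' s).
(* Serre's formula turns the factor of a pair [(k, l)] of cosets into a product over the elements
   [g'] of the coset [l]. Writing [g' = sg * crep k] then exposes the ramification function, and
   [sg] outside the stabilizer contributes 1. *)
transitivity (\big[@vmul R/vone R]_(g' | ci H g' != k) W g').
  rewrite (partition_big (ci H) (fun l => l != k)) //=; apply: eq_bigr => l lk.
  rewrite (serre _ _ gt gs) [RHS](reindex_inj (mulgI (crep l))) /=.
  apply: eq_big => [h|//]; apply/idP/andP => [hH|[_ /eqP e]].
    by have -> : ci H (crep l * h)%g = l by apply: ci_uniq; rewrite mulKg.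
  by have := ciP H (crep l * h)%g; rewrite e mulKg.
rewrite (reindex_inj (mulIg (crep k))) /= (bigID (mem St)) /= [X in vmul _ X]big1 ?vmul_1.
  apply: eq_big => sg.
    rewrite andbC; congr (_ && ~~ _); apply/eqP/idP => [e|h].
      by have := ciP H (sg * crep k)%g; rewrite e mulgA.
    by apply: ci_uniq; rewrite mulgA.
  by move=> /andP[_ sgS]; rewrite (ram_St (crep k) al1' hs sgS).
by move=> sg /andP[_ sgS]; exact: ram_out hs sgS.
Qed.
End Ramification.

(** * Radii close to r *)

(** The infinitesimal [1 - eps] is replaced by real numbers below 1 and close to it. *)
Definition near1 (P : R -> Prop) : Prop :=
  exists2 t0 : R, 0 <= t0 < 1 & forall t, t0 < t -> t < 1 -> P t.
Lemma near1_all (I : finType) (P : I -> R -> Prop) : (forall i, near1 (P i)) -> near1 (fun t => forall i, P i t).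
Proof.
move=> h; have /choice[t0 ht0] i : exists t0 : R, 0 <= t0 < 1 /\ forall t, t0 < t -> t < 1 -> P i t.
  by have [t0 h0 h1] := h i; exists t0.
exists (\big[Num.max/0]_i t0 i).
  apply/andP; split; first by elim/big_rec: _ => // i x _ x0; rewrite le_max x0 orbT.
  by apply: bigmax_lt => [|i _]; [exact: ltr01|case: (ht0 i) => /andP[]].
move=> t h1 t1 i; apply: (ht0 i).2 => //; apply: le_lt_trans h1; exact: le_bigmax.
Qed.
Lemma near1_and (P Q : R -> Prop) : near1 P -> near1 Q -> near1 (fun t => P t /\ Q t).
Proof.
move=> hP hQ; have [|t0 h0 h] := @near1_all bool (fun i : bool => if i then P else Q); first by case.
by exists t0 => // t t1 t2; split; [exact: (h t t1 t2 true)|exact: (h t t1 t2 false)].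
Qed.
Lemma near1_imp (P Q : R -> Prop) : (forall t, 0 < t -> t < 1 -> P t -> Q t) -> near1 P -> near1 Q.
Proof.
move=> h [t0 /andP[t00 t01] hP]; exists t0 => [|t t1 t2]; first by rewrite t00.
by apply: h => //; [exact: le_lt_trans t1|exact: hP].
Qed.
Lemma near1_pow (P : R -> Prop) (n : nat) : (0 < n)%N -> near1 P -> near1 (fun t => P (t ^+ n)).
Proof.
move=> n0 [s0 /andP[s00 s01] hP]; have [t0 h0 ht] := pow_near1 n s01.
exists t0 => // t t1 t2; apply: hP; first by apply: ht => //; exact: ltW.
rewrite exprn_ilt1 // -?lt0n //.
by case/andP: h0 => h0 _; apply: le_trans h0 (ltW t1).
Qed.
(** The second hypothesis is the order of [val2] between [(p, e)] and [(p', e')]: a strict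
    inequality of flat parts survives near 1, and equality leaves a comparison of powers of
    [t < 1]. *)
Lemma near1_le (p p' : R) (e e' : int) : 0 < p' ->
  (p < p') || (p == p') && (e' <= e) -> near1 (fun t => p * t ^ e <= p' * t ^ e').
Proof.
move=> p0 h; have [t0 h0 ht] : near1 (fun t => p / p' <= t ^ (e' - e)).
  have ge1 (t : R) (k : int) : 0 < t -> t < 1 -> k <= 0 -> 1 <= t ^ k.
    move=> t0 t1; case: k => k //; first by case: k => // _; rewrite expr0z.
    move=> _; rewrite NegzE -invr_expz invf_ge1 ?exprz_gt0 //.
    by rewrite -exprnP exprn_ile1 // ltW.
  case/orP: h => [h|/andP[/eqP -> h]]; last first.
    by exists 0 => [|t t1 t2]; rewrite ?lexx ?ltr01 // divff ?gt_eqF // ge1 //; lia.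
  have q1 : p / p' < 1 by rewrite ltr_pdivrMr // mul1r.
  have [t0 h0 ht] := pow_near1 `|e' - e|%N q1; exists t0 => // t t1 t2.
  have t0' : 0 < t by case/andP: h0 => h0 _; apply: le_lt_trans t1.
  have [k0|/ltW k0] := leP 0 (e' - e); last by apply: le_trans (ltW q1) _; exact: ge1.
  rewrite -(gez0_abs k0) -exprnP; apply/ltW/ht => //; exact: ltW.
exists t0 => // t t1 t2; have := ht t t1 t2.
have t0' : 0 < t by case/andP: h0 => h0 _; apply: le_lt_trans t1.
rewrite ler_pdivrMr // => h'.
have -> : t ^ e' = t ^ (e' - e) * t ^ e by rewrite -expfzDr ?gt_eqF // subrK.
by rewrite mulrA ler_wpM2r ?(ltW (exprz_gt0 _ t0')) // mulrC.
Qed.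
Lemma near1_ge : near1 (fun s : R => a <= s * r <= b).
Proof.
have a0 : 0 < a := ann_a0.
exists (a / r) => [|s s1 s2].
  by rewrite divr_ge0 ?(ltW a0) ?(ltW r_gt0) //= ltr_pdivrMr ?r_gt0 // mul1r.
move: s1; rewrite ltr_pdivrMr ?r_gt0 // => /ltW -> /=.
by apply: le_trans hrb; rewrite ger_pMl ?r_gt0 // ltW.
Qed.
Lemma nrm_scale (s : R) f (l : int) : nrm (s * r) f l = nrm r f l * s ^ l.
Proof. by rewrite /nrm expfzMl mulrA mulrAC. Qed.
(** The leading term at eta(r) stays maximal slightly below [r]: finitely many terms are compared
    with it by [near1_le], and the tail is uniformly small. *)
Lemma near1_gauss f (p : R) (m : int) : w (aE f) = Some (p, m%:~R) ->
  near1 (fun s : R => gauss absK coef (s * r) f = p * s ^ m).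
Proof.
move=> ef; have f0 : f != 0 by rewrite -aE_eqn ef.
move: ef; rewrite w_aE; have [m' [m0 -> hle hlt]] := eta_lead rab f0.
move=> -[ep /eqP]; rewrite eqr_int => /eqP em; subst m' p.
have p0 : 0 < nrm r f m by rewrite mulr_gt0 ?(nabs_gt0 hN) ?exprz_gt0 ?r_gt0.
have ar0 : 0 < a / r by rewrite divr_gt0 ?r_gt0 // (ann_a0).
have ar1 : a / r < 1 by rewrite ltr_pdivrMr ?r_gt0 // mul1r.
(* The factor [(a / r) ^ |m|] is a lower bound of [s ^ m] for [a / r <= s <= 1], so the tail stays
   below the leading term. *)
have [N hN'] := decay f (mulr_gt0 p0 (exprn_gt0 `|m|%N ar0)).
have h1 : near1 (fun s : R => forall i : 'I_(N.*2.+1), nrm r f (i%:Z - N%:Z) * s ^ (i%:Z - N%:Z) <= nrm r f m * s ^ m).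
  apply: near1_all => i; apply: near1_le => //.
  have := hle (i%:Z - N%:Z); rewrite le_eqVlt => /orP[/eqP e|->//].
  rewrite e eqxx /=; apply/orP; right; rewrite leNgt; apply/negP => /hlt.
  by rewrite e ltxx.
apply: near1_imp (near1_and near1_ge h1) => s s0 s1 [hs hi].
rewrite -nrm_scale; apply: gauss_max => l; rewrite !nrm_scale.
have [hl|hl] := leqP N `|l|.
  rewrite -nrm_scale; apply: le_trans (ltW (hN' _ hs _ hl)) _; rewrite ler_pM2l //.
  have ars : a / r <= s by rewrite ler_pdivrMr ?r_gt0 //; case/andP: hs.
  case: (m) => k /=; first by rewrite -exprnP lerXn2r ?nnegrE ?(ltW ar0) ?(ltW s0).
  rewrite NegzE -invr_expz; apply: (@le_trans _ _ 1); first by rewrite exprn_ile1 ?(ltW ar0) ?(ltW ar1).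
  by rewrite invf_ge1 ?exprz_gt0 // -exprnP exprn_ile1 ?ltW.
have hj : (absz (l + N%:Z)%R < N.*2.+1)%N by move: hl; clear; lia.
have := hi (Ordinal hj); rewrite /= (_ : (absz (l + N%:Z))%:Z - N%:Z = l) //.
by move: hl; clear; lia.
Qed.

Lemma ord_den_ex : exists N : nat, (0 < N)%N /\
  forall H g q, Onat H g q -> exists m : int, q *+ N = m%:~R.
Proof. by exists (factorial #|gT|); split=> [|H g q]; [exact: fact_gt0|exact: Onat_den]. Qed.
Definition ord_den : nat := sval (cid ord_den_ex).
Lemma den_gt0 : (0 < ord_den)%N. Proof. by rewrite /ord_den; case: cid => N []. Qed.
Lemma denP H g q : Onat H g q -> exists m : int, q *+ ord_den = m%:~R.
Proof. exact: (svalP (cid ord_den_ex)).2. Qed.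
Lemma near1_w f D (q q' : rat) (n n' : int) : D != 0 ->
  q *+ ord_den = n%:~R -> q' *+ ord_den = n'%:~R ->
  (vmul (w (aE f)) (Some (1%R, q)) <= vmul (w (aE D)) (Some (1%R, q')))%O ->
  near1 (fun t => gauss absK coef (t ^+ ord_den * r) f * t ^ n <= gauss absK coef (t ^+ ord_den * r) D * t ^ n').
Proof.
move=> D0 eq eq'; have [p' [m' eD]] := w_aE_int D0.
have [->|f0] := eqVneq f 0.
  move=> _; apply: near1_imp (near1_pow den_gt0 (near1_gauss eD)) => t t0 t1 ->.
  rewrite (@gauss_max _ _ 0) => [|i]; last by rewrite /nrm !acoef0 (abs_zero hN) !mul0r.
  rewrite /nrm acoef0 (abs_zero hN) !mul0r mulr_ge0 ?(ltW (exprz_gt0 _ t0)) //.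
  have := w_pos hN hw (aE D); rewrite eD /= => /ltW p'0.
  by rewrite mulr_ge0 // ltW // exprz_gt0 // exprn_gt0.
have [p [m ef]] := w_aE_int f0; rewrite ef eD /= !mulr1 vle_some => h.
have pp : 0 < p' by have := w_pos hN hw (aE D); rewrite eD.
have den0 : 0 < (ord_den%:R : rat) by rewrite ltr0n den_gt0.
have h1 : near1 (fun t => p * t ^ (ord_den%:Z * m + n) <= p' * t ^ (ord_den%:Z * m' + n')).
  apply: near1_le => //; case/orP: h => [->//|/andP[-> h]]; apply/orP; right.
  have : ord_den%:R * m'%:~R + n'%:~R <= ord_den%:R * m%:~R + n%:~R :> rat.
    by rewrite -eq -eq' -[q *+ _]mulr_natl -[q' *+ _]mulr_natl -!mulrDr ler_pM2l.
  by rewrite -(ler_int rat) !rmorphD !rmorphM.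
apply: near1_imp (near1_and h1 (near1_and (near1_pow den_gt0 (near1_gauss ef)) (near1_pow den_gt0 (near1_gauss eD)))).
move=> t t0 t1 [ht [-> ->]]; move: ht.
have tn : t != 0 by rewrite gt_eqF.
by rewrite !expfzDr // -!exprz_exp !mulrA -!exprnP.
Qed.

Section Transfer.
Variable H : {group gT}.
Local Notation dg := (deg H).
Local Notation cf := (@famI H).
Lemma exI_num_ex (k : 'I_dg) : exists m : int, exI k *+ ord_den = m%:~R.
Proof.
apply: (denP (H := H) (g := idx_y (enum_val (cast_ord (esym (card_idx_deg H)) k)))).
by apply/OnatP; exists (Posz (idx_m (enum_val (cast_ord (esym (card_idx_deg H)) k)))).
Qed.
Definition num (k : 'I_dg) : int := sval (cid (exI_num_ex k)).
Lemma numP k : exI k *+ ord_den = (num k)%:~R.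
Proof. exact: (svalP (cid (exI_num_ex k))). Qed.
Lemma cf_le k g : (w (phi g (cf k)) <= Some (1%R, exI k))%O.
Proof. exact: fam_le. Qed.

Lemma Delta_ex : exists D, [/\ D != 0, aE D = \det (Phi H cf) ^+ 2 &
  forall z, inC H z -> exists x : 'I_dg -> A, D%:A * z = \sum_i (x i)%:A * cf i].
Proof.
have [D [eD hD]] := Phi_span (@famIC H) (famI_unit H).
by exists D; split=> //; apply: (det_neq0 (famI_unit H)).
Qed.
Definition Delta : A := sval (cid Delta_ex).
Lemma Delta_neq0 : Delta != 0. Proof. by rewrite /Delta; case: cid => D []. Qed.
Lemma aE_Delta : aE Delta = \det (Phi H cf) ^+ 2. Proof. by rewrite /Delta; case: cid => D []. Qed.
Lemma coord_ex z : exists x : 'I_dg -> A, inC H z -> Delta%:A * z = \sum_i (x i)%:A * cf i.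
Proof.
have [zC|nC] := pselect (inC H z); last by exists (fun=> 0).
by rewrite /Delta; case: cid => D [_ _ h] /=; have [x hx] := h z zC; exists x.
Qed.
(** The coordinates of [Delta z], which stay in [A], unlike those of [z]; outside the fixed ring
    they are 0 or arbitrary and carry no information. *)
Definition coord z : 'I_dg -> A := sval (cid (coord_ex z)).
Lemma coordP z : inC H z -> Delta%:A * z = \sum_i (coord z i)%:A * cf i.
Proof. exact: (svalP (cid (coord_ex z))). Qed.
Lemma coord_uniq z D (y : 'I_dg -> A) : inC H z -> D%:A * z = \sum_i (y i)%:A * cf i ->
  forall k, D * coord z k = Delta * y k.
Proof.
move=> zC e k; apply/eqP; rewrite -subr_eq0; apply/eqP.
apply: (@famI_free H (fun k => D * coord z k - Delta * y k)).
rewrite (eq_bigr (fun i => D%:A * ((coord z i)%:A * cf i) - Delta%:A * ((y i)%:A * cf i))); last first.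
  by move=> i _; rewrite scalerBl mulrBl !algM !mulrA.
by rewrite sumrB -!mulr_sumr -(coordP zC) -e; ring.
Qed.
Lemma coord_le z k (v : val2 R) : inC H z -> (forall g, (w (phi g z) <= v)%O) ->
  (vmul (w (aE (coord z k))) (Some (1%R, exI k)) <= vmul (w (aE Delta)) v)%O.
Proof.
move=> zC hz; have [t] := famI_le (coord z) k; rewrite -coordP // phi_aM (wM hw) => h.
apply: le_trans h _; rewrite ![vmul (w (aE Delta)) _]vmulC; exact: vleM2r.
Qed.
Lemma coord_ge z g v : inC H z -> (v <= w (phi g z))%O -> v != None ->
  exists k, (vmul (w (aE Delta)) v <= vmul (w (aE (coord z k))) (Some (1%R, exI k)))%O.
Proof.
move=> zC hz vn; apply: contrapT => /forallNP h.
have Dn : w (aE Delta) != None by rewrite aE_eqn Delta_neq0.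
have : (w (phi g (Delta%:A * z)) < vmul (w (aE Delta)) v)%O.
  rewrite coordP // rmorph_sum; apply: (w_sum_lt hw); first by rewrite vmul_eqn negb_or Dn.
  move=> k _; rewrite /= phi_aM (wM hw); apply: le_lt_trans (_ : vmul (w (aE (coord z k))) (Some (1%R, exI k)) < _)%O.
    rewrite ![vmul (w (aE _)) _]vmulC; apply: vleM2r; [exact: (w_pos hN hw)|exact: cf_le].
  by rewrite ltNge; apply/negP/h.
rewrite phi_aM (wM hw) ![vmul (w (aE Delta)) _]vmulC vltM2rE ?(w_pos hN hw) //.
by rewrite ltNge hz.
Qed.

Definition Dp : R := vflat (w (aE Delta)).
Lemma Delta_val : exists m : int, w (aE Delta) = Some (Dp, m%:~R).
Proof. by have [p [m e]] := w_aE_int Delta_neq0; exists m; rewrite /Dp e. Qed.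
Definition Dm : int := sval (cid Delta_val).
Lemma DeltaE : w (aE Delta) = Some (Dp, Dm%:~R). Proof. exact: (svalP (cid Delta_val)). Qed.
Lemma Dp_gt0 : 0 < Dp.
Proof. by have := w_pos hN hw (aE Delta); rewrite DeltaE. Qed.

(* The power makes t ^ (ord_den * q) an integral power for every value (p, q). *)
Local Notation rr t := (t ^+ ord_den * r).
(** The finite list of conditions at radius [rr t]: the leading term of [Delta] still gives its
    norm, and after rescaling the structure constants and the coordinates of 1 are integral. *)
Definition good (t : R) : Prop := [/\ a <= rr t <= b,
  gauss absK coef (rr t) Delta = Dp * (t ^+ ord_den) ^ Dm,
  forall k l m, gauss absK coef (rr t) (coord (cf k * cf l) m) * t ^ num m <=
     gauss absK coef (rr t) Delta * t ^ (num k + num l) &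
  forall m, gauss absK coef (rr t) (coord 1 m) * t ^ num m <= gauss absK coef (rr t) Delta * t ^ 0].
Lemma near1_good : near1 good.
Proof.
have h1 := near1_pow den_gt0 near1_ge.
have h2 := near1_pow den_gt0 (near1_gauss DeltaE).
have h3 : near1 (fun t => forall klm : 'I_dg * 'I_dg * 'I_dg,
     gauss absK coef (rr t) (coord (cf klm.1.1 * cf klm.1.2) klm.2) * t ^ num klm.2 <=
     gauss absK coef (rr t) Delta * t ^ (num klm.1.1 + num klm.1.2)).
  apply: near1_all => -[[k l] m] /=; apply: (near1_w Delta_neq0 (numP m)).
    by rewrite rmorphD /= -!numP -mulrnDl.
  apply: coord_le => [|g]; first by apply: inCM; exact: famIC.
  rewrite rmorphM (wM hw).
  have -> : Some (1%R, exI k + exI l) = vmul (Some (1%R, exI k)) (Some (1%R : R, exI l)) by rewrite /= mulr1.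
  by apply: vleM; rewrite ?(w_pos hN hw) ?cf_le //; exact: ltr01.
have h4 : near1 (fun t => forall m, gauss absK coef (rr t) (coord 1 m) * t ^ num m <=
     gauss absK coef (rr t) Delta * t ^ 0).
  apply: near1_all => m; apply: (near1_w (q' := 0) Delta_neq0 (numP m)); first by rewrite mul0rn.
  apply: (coord_le m (v := vone R)) => [|g]; first exact: inC1.
  by rewrite rmorph1 (w1 hw).
apply: near1_imp (near1_and h1 (near1_and h2 (near1_and h3 h4))).
by move=> t t0 t1 [g1 [g2 [g3 g4]]]; split=> // k l m; exact: (g3 (k, l, m)).
Qed.

(** * The integral stalk at a nearby radius *)

Section AtRadius.
Variables (t : R) (t0 : 0 < t) (ht : good t) (sigma : K) (hsigma : absK sigma = t).
Let r' := rr t.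
Variables (kap : fieldType) (nu : kap -> R) (iotak : {rmorphism A -> kap}).
Hypothesis hsrf : is_stalk_residue_field absK a b coef r' nu iotak.
Local Notation C := (fixring act H).
Variables (L : comAlgType kap) (j : {rmorphism C -> L}).
Hypothesis hj : is_base_change iotak j.
Let hnu : is_nonarch_abs nu := srf_abs hsrf.
Local Notation gs := (gauss absK coef r').

Lemma in_fixed c : inC H c -> c \in fixed_pred act H.
Proof. by move=> h; apply/forall_inP => s sH; rewrite (h s sH). Qed.
Lemma fixvalC (u : C) : inC H (fixval u).
Proof. by move=> s sH; have /forall_inP/(_ s sH)/eqP := valP u. Qed.
Definition mkC c (cC : inC H c) : C := Fixring (in_fixed cC).
Definition cC k : C := mkC (@famIC H k).

Lemma rab' : a <= r' <= b. Proof. by case: ht. Qed.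
Lemma r'_gt0 : 0 < r'. Proof. by rewrite mulr_gt0 ?exprn_gt0 ?r_gt0. Qed.
Lemma gs_gt0 f : f != 0 -> 0 < gs f.
Proof.
move=> /(eta_lead rab')[m [m0 _ h _]]; rewrite (gauss_max h).
by rewrite mulr_gt0 ?(nabs_gt0 hN) // exprz_gt0 // r'_gt0.
Qed.
Lemma nu_iotak f : nu (iotak f) = gs f. Proof. exact: (srf_ext hsrf). Qed.
Lemma iotak_neq0 f : f != 0 -> iotak f != 0.
Proof.
move=> /gs_gt0; rewrite -nu_iotak; apply: contraTneq => ->.
by rewrite (abs_zero hnu) ltxx.
Qed.
Lemma gs_cst k : gs k%:A = absK k.
Proof.
have e i : coef k%:A i = k * (i == 0)%:R by rewrite acoefZ acoef1.
have e0 : nrm r' k%:A 0 = absK k by rewrite /nrm e eqxx expr0z !mulr1.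
rewrite (@gauss_max _ _ 0) // => i; rewrite e0 /nrm e.
have [->|_] := eqVneq i 0; first by rewrite expr0z !mulr1.
by rewrite mulr0 (abs_zero hN) mul0r (abs_ge0 hN).
Qed.
Lemma iotak_Delta : iotak Delta != 0. Proof. exact/iotak_neq0/Delta_neq0. Qed.
Lemma nu_Delta_gt0 : 0 < gs Delta. Proof. exact/gs_gt0/Delta_neq0. Qed.

Definition cok (u : C) (k : 'I_dg) : kap := iotak (coord (fixval u) k) / iotak Delta.
Lemma cok_uniq (u : C) D (y : 'I_dg -> A) : D != 0 -> D%:A * fixval u = \sum_i (y i)%:A * cf i ->
  forall k, cok u k = iotak (y k) / iotak D.
Proof.
move=> D0 e k; apply/eqP; rewrite eqr_div ?iotak_Delta ?iotak_neq0 // -!rmorphM mulrC.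
by rewrite (coord_uniq (fixvalC u) e) mulrC.
Qed.
Lemma fixvalB (u v : C) : fixval (u - v) = fixval u - fixval v. Proof. by []. Qed.
Lemma fixval_sum (I : Type) (s : seq I) (F : I -> C) :
  fixval (\sum_(i <- s) F i) = \sum_(i <- s) fixval (F i).
Proof. by apply: (big_morph (@fixval _ _ _ act H)). Qed.
Lemma cokB u v k : cok (u - v) k = cok u k - cok v k.
Proof.
rewrite (cok_uniq (D := Delta) (y := fun k => coord (fixval u) k - coord (fixval v) k)) ?Delta_neq0 //.
  by rewrite rmorphB mulrBl.
rewrite fixvalB mulrBr !(coordP (fixvalC _)) -sumrB; apply: eq_bigr => i _.
by rewrite scalerBl mulrBl.
Qed.
Lemma cokZ f u k : cok (f *: u) k = iotak f * cok u k.
Proof.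
rewrite (cok_uniq (D := Delta) (y := fun k => f * coord (fixval u) k)) ?Delta_neq0 //.
  by rewrite rmorphM mulrA.
have -> : fixval (f *: u) = f%:A * fixval u by rewrite -scalerAl mul1r.
rewrite mulrCA (coordP (fixvalC _)) mulr_sumr; apply: eq_bigr => i _.
by rewrite algM mulrA.
Qed.
Lemma cok_cC l k : cok (cC l) k = (k == l)%:R.
Proof.
rewrite (cok_uniq (D := 1) (y := fun k => (k == l)%:R)) ?oner_neq0 //.
  by rewrite rmorph_nat rmorph1 divr1.
rewrite scale1r mul1r (bigD1 l) //= eqxx scale1r mul1r big1 ?addr0 // => i /negPf ->.
by rewrite scale0r mul0r.
Qed.
Lemma cokM u v k : cok (u * v) k = \sum_l cok (u * cC l) k * cok v l.
Proof.
have D2 : Delta * Delta != 0 by rewrite -aE_eqn (rmorphM aE) (w_eqn hw) mulf_neq0 // -(w_eqn hw) aE_eqn Delta_neq0.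
rewrite (cok_uniq (D := Delta * Delta) (y := fun k => \sum_l coord (fixval (u * cC l)) k * coord (fixval v) l)) //.
  rewrite rmorph_sum mulr_suml; apply: eq_bigr => l _.
  by rewrite !rmorphM /cok mulrACA invfM.
have -> : fixval (u * v) = fixval u * fixval v by [].
have -> : (Delta * Delta)%:A * (fixval u * fixval v) = Delta%:A * (fixval u * (Delta%:A * fixval v)).
  by rewrite algM; ring.
rewrite (coordP (fixvalC v)) mulr_sumr mulr_sumr.
rewrite (eq_bigr (fun l => \sum_k (coord (fixval (u * cC l)) k * coord (fixval v) l)%:A * cf k)); last first.
  move=> l _; have -> : Delta%:A * (fixval u * ((coord (fixval v) l)%:A * cf l)) =
     (coord (fixval v) l)%:A * (Delta%:A * fixval (u * cC l)).
    by rewrite (_ : fixval (u * cC l) = fixval u * cf l) //; ring.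
  rewrite (coordP (fixvalC _)) mulr_sumr; apply: eq_bigr => i _.
  by rewrite algM mulrA [X in X * _ = _]mulrC.
rewrite exchange_big; apply: eq_bigr => i _.
by rewrite scaler_suml mulr_suml.
Qed.
Lemma j_cok u : j u = \sum_k cok u k *: j (cC k).
Proof.
have e : Delta *: u = \sum_k coord (fixval u) k *: cC k.
  apply/val_inj; rewrite /= fixval_sum.
  have -> : Delta *: fixval u = Delta%:A * fixval u by rewrite -scalerAl mul1r.
  by rewrite coordP; [apply: eq_bigr => i _; rewrite -scalerAl mul1r|exact: fixvalC].
have jZ f v : j (f *: v) = iotak f *: j v.
  by rewrite -[f *: v](_ : f%:A * v = _) ?rmorphM ?(bc_comm hj) -?scalerAl ?mul1r.
have := congr1 j e; rewrite jZ rmorph_sum => h.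
apply: (scalerI iotak_Delta); rewrite h scaler_sumr; apply: eq_bigr => k _.
by rewrite jZ scalerA /cok mulrC divfK // iotak_Delta.
Qed.

Definition mu (k : 'I_dg) : kap := iotak (sigma ^ num k)%:A.
Lemma abs_sigma (m : int) : absK (sigma ^ m) = t ^ m.
Proof. by case: m => n; rewrite /exprz /= ?(nabsV hN) (nabsX hN) hsigma. Qed.
Lemma nu_mu k : nu (mu k) = t ^ num k.
Proof. by rewrite /mu nu_iotak gs_cst abs_sigma. Qed.
Lemma mu_neq0 k : mu k != 0.
Proof.
apply: contraTneq (exprz_gt0 (num k) t0) => e.
by rewrite -nu_mu e (abs_zero hnu) ltxx.
Qed.
(** The value [(1, exI k)] becomes the size [t ^ num k] at the new radius; the constant
    [sigma ^ num k] of that absolute value normalizes the basis. *)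
Definition ff k : L := (mu k)^-1 *: j (cC k).
Lemma j_ff u : j u = \sum_k (cok u k * mu k) *: ff k.
Proof.
rewrite j_cok; apply: eq_bigr => k _.
by rewrite /ff scalerA mulfK // mu_neq0.
Qed.
Lemma ff_span z : exists x : 'rV[kap]_dg, z = \sum_k x 0 k *: ff k.
Proof.
have [|x ->] := bc_span hj (c := cC) _ z; first by move=> u; exists (cok u); exact: j_cok.
exists (\row_k (x k * mu k)); apply: eq_bigr => k _.
by rewrite mxE /ff scalerA mulfK // mu_neq0.
Qed.
Lemma ff_free (x : 'rV[kap]_dg) : \sum_k x 0 k *: ff k = 0 -> x = 0.
Proof.
move=> e; apply/rowP => k; rewrite mxE.
have := bc_free hj cokB cokZ cok_cC cokM (a := fun k => x 0 k / mu k).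
move=> /(_ _ k) h; apply: (mulIf (invr_neq0 (mu_neq0 k))); rewrite mul0r; apply: h.
by rewrite -[RHS]e; apply: eq_bigr => i _; rewrite /ff scalerA.
Qed.
Local Notation coL := (co ff_span).
Local Notation nl := (nL nu ff_span).
Lemma coL_j u k : coL (j u) 0 k = cok u k * mu k.
Proof.
rewrite (co_uniq ff_span ff_free (a := \row_k (cok u k * mu k))) ?mxE //.
by rewrite j_ff; apply: eq_bigr => i _; rewrite mxE.
Qed.
Lemma nu_coL_j u k : nu (coL (j u) 0 k) = gs (coord (fixval u) k) * t ^ num k / gs Delta.
Proof. by rewrite coL_j /cok !(abs_mul hnu) nu_mu (nabsV hnu) !nu_iotak mulrAC. Qed.
Lemma nl_mul k l : nl (ff k * ff l) <= 1.
Proof.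
have hZ := nLZ hnu ff_span ff_free.
rewrite /ff -scalerAl -scalerAr scalerA hZ -rmorphM.
have tk m : 0 < t ^ m by rewrite exprz_gt0.
rewrite -invfM (nabsV hnu) (abs_mul hnu) !nu_mu mulrC ler_pdivrMr ?mulr_gt0 // mul1r.
apply/nL_leP => [|m]; first by rewrite mulr_ge0 ?ltW.
rewrite nu_coL_j ler_pdivrMr ?nu_Delta_gt0 // mulrC -expfzDr ?gt_eqF //.
rewrite mulrC [leRHS]mulrC; case: ht => _ _ h _; exact: (h k l m).
Qed.
Lemma nl_1 : nl 1 <= 1.
Proof.
rewrite -(rmorph1 j); apply/nL_leP => // m.
rewrite nu_coL_j ler_pdivrMr ?nu_Delta_gt0 // mul1r.
by case: ht => _ _ _ h; apply: le_trans (h m) _; rewrite expr0z mulr1.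
Qed.

Lemma frac_approx z (e : R) : 0 < e -> exists fg : A * A, fg.2 != 0 /\ nu (z - iotak fg.1 / iotak fg.2) < e.
Proof.
move=> e0; have [T [s [q [[_ _ s0] _ hq]]]] := srf_surj hsrf z.
have sn : s != 0.
  apply: contraNneq s0 => ->; rewrite (@gauss_max _ _ 0) => [|i]; rewrite /nrm !acoef0 (abs_zero hN) !mul0r //.
have /cvg0P/(_ _ e0)[N /(_ N (leqnn N)) h] := hq.
exists ((q N).1, s ^+ (q N).2); split=> /=.
  elim: (q N).2 => [|n IH]; first by rewrite expr0 oner_neq0.
  by rewrite exprS -aE_eqn (rmorphM aE) (w_eqn hw) mulf_neq0 // -(w_eqn hw) aE_eqn.
by rewrite rmorphXn; apply: le_lt_trans h; exact: ler_norm.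
Qed.
Lemma common_frac (z : 'I_dg -> kap) (e : 'I_dg -> R) : (forall k, 0 < e k) -> exists (g : A) (F : 'I_dg -> A),
  g != 0 /\ forall k, nu (z k - iotak (F k) / iotak g) < e k.
Proof.
move=> e0; have /choice[fg h] k := frac_approx (z k) (e0 k).
have prod0 (P : pred 'I_dg) : \prod_(k | P k) (fg k).2 != 0.
  elim/big_rec: _ => [|i x _ IH]; first exact: oner_neq0.
  by rewrite -aE_eqn (rmorphM aE) (w_eqn hw) mulf_neq0 // -(w_eqn hw) aE_eqn // (h i).1.
exists (\prod_k (fg k).2), (fun k => (fg k).1 * \prod_(l | l != k) (fg l).2); split=> // k.
set P := \prod_(l | l != k) _; have P0 : iotak P != 0 by exact/iotak_neq0/prod0.
have -> : \prod_k (fg k).2 = (fg k).2 * P by rewrite (bigD1 k).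
by rewrite (rmorphM iotak _ P) (rmorphM iotak _ P) invfM mulrACA divff // mulr1; exact: (h k).2.
Qed.
(** Only the terms of norm exactly [c] are kept, finitely many by [decay]. Their norms at the
    original radius are then determined by their exponents. *)
Lemma trim f (c : R) : 0 < c -> gs f <= c -> exists f0, gs (f - f0) < c /\
  forall i, coef f0 i != 0 -> nrm r' f0 i = c.
Proof.
move=> c0 fc; have [N hN'] := decay f c0.
pose T (i : int) := if nrm r' f i == c then coef f i else 0.
pose f0 : A := \sum_(i < N.*2.+1) T (i%:Z - N%:Z) *: xi (i%:Z - N%:Z).
have cf0 l : coef f0 l = T l.
  rewrite acoef_sum; have [hl|hl] := leqP N `|l|.
    have -> : T l = 0.
      by rewrite /T; case: eqP => // e; have := hN' _ rab' _ hl; rewrite e ltxx.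
    rewrite big1 // => i _; rewrite acoefZ coef_xi; case: eqP => [el|_]; last by rewrite mulr0.
    rewrite -el /T; case: eqP => [e|_]; last by rewrite mul0r.
    by have := hN' _ rab' _ hl; rewrite e ltxx.
  have hj' : (absz (l + N%:Z)%R < N.*2.+1)%N by move: hl; clear; lia.
  rewrite (bigD1 (Ordinal hj')) //= big1 ?addr0.
    rewrite acoefZ coef_xi (_ : (absz (l + N%:Z))%:Z - N%:Z = l) ?eqxx ?mulr1 //.
    by move: hl; clear; lia.
  move=> i /eqP hi; rewrite acoefZ coef_xi (_ : _ == _ = false) ?mulr0 //.
  by apply/negP => /eqP e; apply: hi; apply/val_inj; move: e hl; clear => /= e hl; lia.
exists f0; split=> [|i]; last first.
  by rewrite /nrm cf0 /T; case: ifP => [/eqP //|_]; rewrite eqxx.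
have [->|n0] := eqVneq (f - f0) 0.
  by rewrite (@gauss_max _ _ 0) => [|i]; rewrite /nrm !acoef0 (abs_zero hN) !mul0r.
have [m [m0 _ h _]] := eta_lead rab' n0; rewrite (gauss_max h).
move: m0; rewrite /nrm acoefB cf0 /T; case: ifPn => [_|hm _]; first by rewrite subrr eqxx.
rewrite subr0 -/(nrm _ _ _) lt_neqAle hm; apply: le_trans fc; exact: gauss_ub rab'.
Qed.
Lemma gs_lead f (p : R) (m : int) : w (aE f) = Some (p, m%:~R) -> p * t ^ (ord_den%:Z * m) <= gs f.
Proof.
move=> ef; have f0 : f != 0 by rewrite -aE_eqn ef.
move: ef; rewrite w_aE; have [m' [_ -> _ _]] := eta_lead rab f0.
move=> -[<- /eqP]; rewrite eqr_int => /eqP <-.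
by rewrite -exprz_exp -exprnP -nrm_scale; exact: gauss_ub rab'.
Qed.
Lemma nu_Delta : gs Delta = Dp * t ^ (ord_den%:Z * Dm).
Proof. by case: ht => _ -> _ _; rewrite -exprz_exp -exprnP. Qed.

(** Some coordinate of [Delta u] attains the largest value, so its leading term at [r] is known
    exactly. That single term bounds the Gauss norm of the coordinate at [r'] from below. *)
Lemma nl_ge (u : C) g (rho : R) (q : rat) (ex : int) : (forall g', (w (phi g' (fixval u)) <= Some (rho, q))%O) ->
  w (phi g (fixval u)) = Some (rho, q) -> q *+ ord_den = ex%:~R -> rho * t ^ ex <= nl (j u).
Proof.
move=> hle heq hq.
have rho0 : 0 < rho by have := w_pos hN hw (phi g (fixval u)); rewrite heq.
have [||k hk] := @coord_ge (fixval u) g (Some (rho, q)) (fixvalC u); rewrite ?heq //.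
have := coord_le k (fixvalC u) hle => hk'.
have {hk hk'} : vmul (w (aE (coord (fixval u) k))) (Some (1%R, exI k)) = vmul (w (aE Delta)) (Some (rho, q)).
  by apply/le_anti; rewrite hk hk'.
have [->|x0] := eqVneq (coord (fixval u) k) 0; first by rewrite rmorph0 (w0 hw) DeltaE.
have [P [M eP]] := w_aE_int x0; rewrite eP DeltaE /= mulr1 => -[e1 e2].
have e3 : ord_den%:Z * M + num k = ord_den%:Z * Dm + ex.
  apply/eqP; rewrite -(eqr_int rat) !rmorphD !rmorphM /= -hq -numP.
  rewrite -[exI k *+ _]mulr_natl -[q *+ _]mulr_natl -!mulrDr; apply/eqP; congr (_ * _).
  exact: e2.
apply: le_trans (nL_ub _ _ _ k); rewrite nu_coL_j ler_pdivlMr ?nu_Delta_gt0 // nu_Delta.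
have tn : t != 0 by rewrite gt_eqF.
have -> : rho * t ^ ex * (Dp * t ^ (ord_den%:Z * Dm)) = P * t ^ (ord_den%:Z * M) * t ^ num k.
  by rewrite mulrACA -expfzDr // [ex + _]addrC -e3 e1 expfzDr // mulrA [rho * _]mulrC.
by rewrite ler_wpM2r ?(ltW (exprz_gt0 _ t0)) //; exact: gs_lead eP.
Qed.

Lemma famI_max (F : 'I_dg -> A) i0 : F i0 != 0 ->
  (forall i, (vmul (w (aE (F i))) (Some (1%R, exI i)) <= vmul (w (aE (F i0))) (Some (1%R, exI i0)))%O) ->
  exists g, w (phi g (\sum_i (F i)%:A * cf i)) = vmul (w (aE (F i0))) (Some (1%R, exI i0)).
Proof.
move=> F0 hmax; pose c i := enum_val (cast_ord (esym (card_idx_deg H)) i).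
pose F' (i : idx H) := F (cast_ord (card_idx_deg H) (enum_rank i)).
have FE i : F i = F' (c i) by rewrite /F' enum_valK cast_ordKV.
have ci' (i : idx H) : i = c (cast_ord (card_idx_deg H) (enum_rank i)).
  by rewrite /c cast_ordK enum_rankK.
exists (idx_y (c i0)); rewrite (FE i0) -[RHS](@orth_max H F' (c i0)) -?FE //.
  congr (w (phi _ _)); rewrite [RHS]sum_famI; apply: eq_bigr => i _.
  by rewrite FE.
by move=> i; rewrite (ci' i) -FE; exact: hmax.
Qed.
(** Up to the denominator [g], the coordinates of [y] consist of leading terms at [r']. The largest
    value at [r] of the numerator is [(v' t ^ (- ex), ex / ord_den)]; multiplicativity of [w] at a
    point attaining it gives the values of the powers, and [nl_ge] leads back to [r'], where the
    powers of [t] cancel. *)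
Lemma nl_approx z : 0 < nl z -> exists y, nl (z - y) < nl z /\ forall n, nl z ^+ n <= nl (y ^+ n).
Proof.
move=> z0; set v := nl z in z0 *; have tk (m : int) : 0 < t ^ m by rewrite exprz_gt0.
have hZ := nLZ hnu ff_span ff_free.
pose x k := coL z 0 k / mu k.
have nux k : nu (x k) * t ^ num k = nu (coL z 0 k).
  by rewrite -nu_mu -(abs_mul hnu) /x divfK // mu_neq0.
have [g [F [g0 hF]]] := common_frac x (fun k => divr_gt0 z0 (tk (num k))).
have gg0 := gs_gt0 g0; have ig0 := iotak_neq0 g0.
pose v' := gs g * v; have v'0 : 0 < v' by rewrite mulr_gt0.
have sc (c : R) f k : (nu (iotak f / iotak g) * t ^ num k <= c) = (gs f <= gs g * c / t ^ num k).
  rewrite (abs_mul hnu) (nabsV hnu) !nu_iotak ler_pdivlMr //.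
  by rewrite mulrAC ler_pdivrMr // [c * _]mulrC.
have hFx k : nu (x k - iotak (F k) / iotak g) * t ^ num k < v by rewrite -ltr_pdivlMr.
have Fle k : gs (F k) <= v' / t ^ num k.
  rewrite -sc -ler_pdivlMr //; rewrite -[_ / iotak g](subKr (x k)); apply: (nabs_suble hnu).
    by rewrite ler_pdivlMr // nux; exact: nL_ub.
  exact/ltW/hF.
have /choice[F0 hF0] k := trim (divr_gt0 v'0 (tk (num k))) (Fle k).
pose u : C := \sum_k F0 k *: cC k; pose y := (iotak g)^-1 *: j u.
have uE : fixval u = \sum_k (F0 k)%:A * cf k.
  by rewrite fixval_sum; apply: eq_bigr => k _; rewrite -scalerAl mul1r.
have coku k : cok u k = iotak (F0 k).
  by rewrite (cok_uniq (D := 1) (y := F0)) ?oner_neq0 ?rmorph1 ?divr1 // scale1r mul1r.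
have zy : nl (z - y) < v.
  apply: bigmax_lt => // k _; rewrite (coB ff_span ff_free) (coZ ff_span ff_free) !mxE coL_j coku.
  have -> : coL z 0 k - (iotak g)^-1 * (iotak (F0 k) * mu k) =
      ((x k - iotak (F k) / iotak g) + iotak (F k - F0 k) / iotak g) * mu k.
    by rewrite rmorphB /x; field; rewrite mu_neq0 ig0.
  rewrite (abs_mul hnu) nu_mu -ltr_pdivlMr //; apply: (nabs_addlt hnu); first exact: hF.
  rewrite (abs_mul hnu) (nabsV hnu) !nu_iotak ltr_pdivrMr // mulrC mulrA.
  exact: (hF0 k).1.
exists y; split=> // n.
(* All terms of [F0 k] have norm [v' / t ^ num k] at [r']; the term of exponent [m] thus has this
   norm times [t ^ (- ord_den * m)] at [r]. *)
have v_eq k : F0 k != 0 -> exists m : int, w (aE (F0 k)) = Some (v' * t ^ (- (ord_den%:Z * m + num k)), m%:~R).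
  move=> n0; rewrite w_aE; have [m [m0 -> _ _]] := eta_lead rab n0; exists m.
  congr (Some (_, _)); have := (hF0 k).2 m m0; rewrite nrm_scale.
  have tn : t != 0 by rewrite gt_eqF.
  have tm : t ^+ ord_den ^ m = t ^ (ord_den%:Z * m) by rewrite exprnP exprz_exp.
  rewrite tm => e; apply: (mulIf (expfz_neq0 (ord_den%:Z * m) tn)); rewrite e.
  by rewrite -[RHS]mulrA -expfzDr // opprD addrAC addNr add0r invr_expz.
have [k0 Fk0] : exists k, F0 k != 0.
  apply: contrapT => /forallNP h; have : v <= nl (z - y).
    have -> : y = 0.
      rewrite /y /u big1 ?rmorph0 ?scaler0 // => k _.
      by have /negP := h k; rewrite negbK => /eqP->; rewrite scale0r.
    by rewrite subr0.
  by rewrite leNgt zy.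
have [i0 _ hi0] := @arg_maxP _ _ _ k0 xpredT (fun k => vmul (w (aE (F0 k))) (Some (1%R, exI k))) isT.
have Fi0 : F0 i0 != 0.
  apply: contraTneq (hi0 k0 isT) => ->; rewrite rmorph0 (w0 hw) /= vle_Nnone.
  by rewrite vmul_eqn negb_or aE_eqn Fk0.
have [|g1 hg1] := @famI_max F0 i0 Fi0; first by move=> i; exact: (hi0 i isT).
have [m em] := v_eq i0 Fi0; rewrite em /= mulr1 in hg1.
pose ex := ord_den%:Z * m + num i0.
have hex : (m%:~R + exI i0) *+ ord_den = ex%:~R.
  by rewrite mulrnDl numP rmorphD rmorphM /= mulr_natl.
have ule g' : (w (phi g' (fixval u)) <= Some (v' * t ^ (- ex), m%:~R + exI i0))%O.
  rewrite uE rmorph_sum; apply: (w_sum_le hw) => k _; rewrite /= phi_aM (wM hw).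
  have := hi0 k isT; rewrite em /= mulr1; apply: le_trans.
  by rewrite ![vmul (w (aE _)) _]vmulC; apply: vleM2r; [exact: (w_pos hN hw)|exact: cf_le].
have : (v' * t ^ (- ex)) ^+ n * t ^ (ex * n%:Z) <= nl (j (u ^+ n)).
  have fX : fixval (u ^+ n) = fixval u ^+ n by elim: (n) => // n' IH; rewrite !exprS -IH.
  apply: (@nl_ge _ g1 _ ((m%:~R + exI i0) *+ n)).
  - move=> g'; rewrite fX rmorphXn (wX hw) -vexp_some; apply: vexp_le => //; last exact: ule.
    by rewrite /= mulr_gt0.
  - by rewrite fX rmorphXn (wX hw) uE hg1 vexp_some.
  - by rewrite mulrnAC hex rmorphM /= mulr_natr.
have tn : t != 0 by rewrite gt_eqF.
have -> : (v' * t ^ (- ex)) ^+ n * t ^ (ex * n%:Z) = v' ^+ n.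
  rewrite exprMn -mulrA [X in _ * X](_ : _ = 1) ?mulr1 //.
  by rewrite exprnP exprz_exp -expfzDr // mulNr addNr expr0z.
rewrite rmorphXn exprMn -nu_iotak -(nabsX hnu) => h.
by rewrite /y exprZn hZ exprVn (nabsV hnu) mulrC ler_pdivlMr ?(nabs_gt0 hnu) ?expf_neq0 // mulrC.
Qed.

Definition trm : 'M[A]_dg := sval (cid2 (trace_mx (@famIC H) (@famIC H))).
Lemma trmP k l : (trm k l)%:A = \sum_i act (crep (H := H) i) (cf k * cf l).
Proof. by rewrite /trm; case: cid2. Qed.
Lemma det_trm : \det trm = Delta.
Proof.
apply: aE_inj; rewrite -det_map_mx aE_Delta /trm; case: cid2 => T /= _ ->.
by rewrite det_mulmx det_tr expr2.
Qed.
(** Over [E] the matrix of multiplication by [Delta z] is conjugate to the diagonal matrix of the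
    conjugates, so its trace is [Delta] times the sum of the conjugates of [z]. *)
Lemma trace_coord z f : inC H z -> f%:A = \sum_i act (crep (H := H) i) z ->
  \sum_k coord (z * cf k) k = Delta * f.
Proof.
move=> zC ef; pose X : 'M[A]_dg := \matrix_(k, l) coord (z * cf k) l.
have u := famI_unit H.
pose dd : 'rV[E]_dg := \row_k (aE Delta * phi (crep k) z).
have e : map_mx aE X *m (Phi H cf)^T = (Phi H cf)^T *m diag_mx dd.
  rewrite mul_mx_diag; apply/matrixP => k l; rewrite !mxE.
  transitivity (phi (crep l) (\sum_i (X k i)%:A * cf i)).
    by rewrite rmorph_sum; apply: eq_bigr => i _; rewrite !mxE /= phi_aM.
  rewrite (eq_bigr (fun i => (coord (z * cf k) i)%:A * cf i)); last by move=> i _; rewrite mxE.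
  rewrite -coordP; last by apply: inCM => //; exact: famIC.
  by rewrite !rmorphM /= phi_aE mulrA mulrC.
apply: aE_inj; rewrite rmorph_sum (rmorphM aE).
transitivity (\tr (map_mx aE X)); first by apply: eq_bigr => k _; rewrite !mxE.
have uT : (Phi H cf)^T \in unitmx by rewrite unitmx_tr.
rewrite -[map_mx aE X](mulmxK uT) e mxtrace_mulC mulmxA mulVmx // mul1mx mxtrace_diag.
rewrite /= (_ : aE f = \sum_k phi (crep (H := H) k) z); last by rewrite /aE /= ef rmorph_sum.
by rewrite mulr_sumr; apply: eq_bigr => k _; rewrite mxE.
Qed.
Lemma trL_j u f : f%:A = \sum_i act (crep (H := H) i) (fixval u) -> trL ff_span (j u) = iotak f.
Proof.
move=> ef; rewrite /trL /mxtrace.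
have h k : mulm ff_span (j u) k k = cok (u * cC k) k.
  rewrite mxE /ff -scalerAr -rmorphM (coZ ff_span ff_free) mxE coL_j mulrCA mulVf ?mulr1 //.
  exact: mu_neq0.
under eq_bigr do rewrite h; rewrite /cok -mulr_suml -rmorph_sum.
have -> : \sum_k coord (fixval (u * cC k)) k = Delta * f by exact: trace_coord (fixvalC u) ef.
by rewrite rmorphM mulrAC divff ?mul1r // iotak_Delta.
Qed.
Lemma nu_disc (d' : nat) (e : 'I_d' -> L) (T : 'M[kap]_d') : is_plus_basis nu e -> is_trace_form_mx e T ->
  nu (\det T) = gs Delta * \prod_k t ^ (- (num k *+ 2)).
Proof.
move=> he hT.
rewrite (plus_basis_disc hnu ff_free nl_mul nl_1 nl_approx he hT).
pose dm : 'rV[kap]_dg := \row_k (mu k)^-1.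
have -> : \matrix_(k, l) trL ff_span (ff k * ff l) = diag_mx dm *m map_mx iotak trm *m diag_mx dm.
  rewrite mul_mx_diag mul_diag_mx; apply/matrixP => k l; rewrite !mxE.
  have e1 : (trm k l)%:A = \sum_i act (crep (H := H) i) (fixval (cC k * cC l)) by exact: trmP.
  rewrite /ff -scalerAl -scalerAr scalerA -rmorphM.
  have hl := trL_lin ff_span ff_free ((mu k)^-1 / mu l) (j (cC k * cC l)) 0.
  have h0 := trL_lin ff_span ff_free (-1) 0 0.
  rewrite scaler0 addr0 mulN1r addNr in h0.
  by move: hl; rewrite addr0 h0 addr0 (trL_j e1) => ->; rewrite mulrAC.
rewrite !det_mulmx det_map_mx det_trm det_diag mulrAC (abs_mul hnu) nu_iotak mulrC; congr (_ * _).
rewrite -big_split /= (nabs_prod hnu); apply: eq_bigr => k _.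
have tn : t != 0 by rewrite gt_eqF.
by rewrite !mxE (abs_mul hnu) (nabsV hnu) nu_mu -invfM -expfzDr // invr_expz mulr2n.
Qed.
End AtRadius.
Lemma sum_num : \sum_k num k *+ 2 = ord_den%:Z * (dg%:Z - #|Y H|%:Z).
Proof.
apply/eqP; rewrite -(eqr_int rat) rmorph_sum rmorphM rmorphB /=.
have := sum_ex H; rewrite card_idx_deg => h.
have -> : \sum_i (num i *+ 2)%:~R = (\sum_(i : idx H) ex i) *+ 2 *+ ord_den :> rat.
  rewrite sum_famI -!sumrMnl; apply: eq_bigr => i _.
  by rewrite mulrnAC rmorphMn /= -numP.
by rewrite h -[X in X == _]mulr_natl.
Qed.
Lemma log_disc_near : near1 (fun t => forall (sigma : K), absK sigma = t -> forall v,
  is_log_discriminant absK a b coef (fixring act H) (rr t) v ->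
  v = - ln Dp - (Dm - (dg%:Z - #|Y H|%:Z))%:~R * ln (t ^+ ord_den)).
Proof.
apply: near1_imp near1_good => t t0 t1 hg sigma hs v.
move=> [kap [nu [iotak [L [j [d [e [T [hsrf hj he hT ->]]]]]]]]].
rewrite (nu_disc t0 hg hs hsrf hj he hT).
have -> : \prod_k t ^ (- (num k *+ 2)) = t ^ (- (ord_den%:Z * (dg%:Z - #|Y H|%:Z))).
  rewrite -sum_num -sumrN; elim/big_rec2: _ => [|i x y _ ->]; first by rewrite expr0z.
  by rewrite expfzDr // gt_eqF.
have tn : t != 0 by rewrite gt_eqF.
have pos (m : int) : 0 < (t ^+ ord_den) ^ m by rewrite exprz_gt0 ?exprn_gt0.
have lnz (m : int) : ln ((t ^+ ord_den) ^ m) = m%:~R * ln (t ^+ ord_den).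
  case: m => n; first by rewrite -exprnP lnXn ?exprn_gt0 // mulr_natl.
  rewrite NegzE -invr_expz -exprnP lnV ?posrE ?exprn_gt0 // lnXn ?exprn_gt0 //.
  by rewrite mulrNz mulNr -pmulrn mulr_natl.
case: hg => _ -> _ _; set X := _ - _.
have -> : t ^ (- (ord_den%:Z * X)) = (t ^+ ord_den) ^ (- X) by rewrite -mulrN exprnP exprz_exp.
rewrite -mulrA -expfzDr ?expf_neq0 // lnM ?posrE ?Dp_gt0 // lnz.
by rewrite opprD.
Qed.
End Transfer.

(** * Conductors *)

Section Conductor.
Variables (actE : gT -> {rmorphism E -> E}) (ix : gT -> val2 R).
Let x c := w (iota c).
Hypotheses (hactE : is_stabilizer_action act x w iota actE)
  (hix : is_ramification_function act x w actE ix).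
Let St := stabilizer act x.
Lemma St_group : group_set St.
Proof.
apply/group_setP; split=> [|s u].
  by rewrite inE; apply/asboolP => c; rewrite (gal_act1 hB).
rewrite !inE => /asboolP hs /asboolP hu; apply/asboolP => c.
by rewrite (gal_actM hB) hs hu.
Qed.
Canonical StG := Group St_group.

Variable H : {group gT}.
(** The points of X/H over eta(r) are the double cosets of [St] and [H]. If [g'] is not in [St g H],
    take an approximate idempotent [z] at [g] on X: the product of the [1 - h z] over [H] is
    invariant, small at [g] and a unit at [g']. *)
Lemma eqv_double g g' : eqv H g g' = (g' * g^-1 \in St * (H :^ g^-1))%g.
Proof.
apply/idP/idP => [/eqvP h|/mulsgP[s h sS]]; last first.
  rewrite mem_conjg => hH e; apply/eqvP => c cC.
  have -> : g' = (s * (g * h ^ g))%g.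
    by rewrite -[LHS](mulgKV g) e conjgE !mulgA mulgK.
  rewrite /phi /= (gal_actM hB s) (gal_actM hB g) (cC (h ^ g)%g); last by rewrite invgK in hH.
  have := sS; rewrite inE => /asboolP hs; by rewrite -[LHS]/(x _) -[RHS]/(x _) hs.
apply: contraT => nin.
have no h0 : h0 \in H -> ~~ eqv [1 gT]%G g (g' * h0)%g.
  move=> hH; apply: contra nin => e.
  have -> : (g' * g^-1 = (g' * h0 * g^-1) * (h0^-1 ^ g^-1))%g.
    by rewrite conjgE invgK !mulgA mulgKV mulgK.
  apply: mem_mulg; last by rewrite memJ_conjg groupV.
  by rewrite -(eqv_St g) mulgKV.
have [z _ hz] := idem0 [1 gT]%G g.
pose c := \prod_(h in H) (1 - act h z).
have cC : inC H c.
  move=> k kH; rewrite rmorph_prod [RHS](reindex_inj (mulgI k)) /=.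
  apply: eq_big => [h0|h0 _]; first by rewrite groupMl.
  by rewrite rmorphB rmorph1 (gal_actM hB).
have phic t : phi t c = \prod_(h in H) (1 - phi (t * h)%g z).
  rewrite rmorph_prod; apply: eq_bigr => h0 _.
  by rewrite rmorphB rmorph1 /= /phi /= (gal_actM hB).
have z1 t : (w (1 - phi t z) <= vone R)%O.
  have [e|e] := boolP (eqv [1 gT]%G g t).
    by rewrite (w_subC hN hw) ltW // ((hz t).1 e).
  by apply: (w_suble hN hw); rewrite ?(w1 hw) // ltW // ((hz t).2 e).
have eg' : w (phi g' c) = vone R.
  rewrite phic (w_prod hw) big1 // => h0 /no e.
  by rewrite addrC (w_dom hN hw) ?(w1 hw) // (wN hN hw) ((hz _).2 e).
have : (w (phi g c) < vone R)%O.
  rewrite phic (bigD1 1%g) ?group1 //= mulg1 mulrC.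
  apply: le_lt_trans (_ : w (1 - phi g z) < _)%O.
    apply: (w_mull hN hw) => //; elim/big_rec: _ => [|h0 y _ IH]; first by rewrite (w1 hw).
    exact: (w_mull hN hw).
  by rewrite (w_subC hN hw); exact: (hz g).1 (eqv_refl _ g).
by rewrite (h c cC) eg' ltxx.
Qed.
Lemma card_class g : (#|[set t | eqv H g t]%SET| * #|St :&: (H :^ g^-1)%g| = #|St| * #|H|)%N.
Proof.
rewrite -[#|H|](cardJg H g^-1) (mul_cardG StG (H :^ g^-1)%G) /=; congr (_ * _)%N.
rewrite -[RHS](card_rcoset _ g); apply: eq_card => t.
by rewrite inE eqv_double mem_rcoset.
Qed.
(** The number of fixed points of [s] on the cosets of [H], that is the permutation character with
    values in [nat]. *)
Definition fixn (s : gT) : nat := #|[set k : 'I_(deg H) | ((crep k)^-1 * s * crep k)%g \in H]%SET|.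
Lemma sum_coset (F : gT -> nat) : (forall g h, h \in H -> F (g * h)%g = F g) ->
  (\sum_g F g = #|H| * \sum_(k < deg H) F (crep k))%N.
Proof.
move=> hF; rewrite (partition_big (ci H) xpredT) //= big_distrr; apply: eq_bigr => k _.
rewrite (reindex_inj (mulgI (crep k))) /= -sum_nat_const; apply: eq_big => [h|h /eqP e].
  apply/eqP/idP => [e|hH]; last by apply: ci_uniq; rewrite mulKg.
  by have := ciP H (crep k * h)%g; rewrite e mulKg.
by apply: hF; have := ciP H (crep k * h)%g; rewrite e mulKg.
Qed.
(** Burnside's orbit count: the orbits of [St] on the cosets of [H] are the points in [Y H]. *)
Lemma sum_fixn : (\sum_(s in St) fixn s = #|St| * #|Y H|)%N.
Proof.
have conjE s g : (s \in H :^ g^-1)%g = (g^-1 * s * g \in H)%g.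
  by rewrite mem_conjg invgK conjgE mulgA.
have e1 : (\sum_(s in St) fixn s = \sum_(k < deg H) #|St :&: (H :^ (crep k)^-1)%g|)%N.
  under eq_bigr do rewrite /fixn -sum1_card.
  rewrite (exchange_big_dep xpredT) //=; apply: eq_bigr => k _.
  rewrite -sum1_card; apply: eq_bigl => s.
  by rewrite !inE conjE.
have e2 : (\sum_g #|St :&: (H :^ g^-1)%g| = #|H| * \sum_(k < deg H) #|St :&: (H :^ (crep k)^-1)%g|)%N.
  apply: (sum_coset (F := fun g => #|St :&: (H :^ g^-1)%g|)) => g h hH; rewrite invMg conjsgM.
  by rewrite (conjGid (groupVr hH)).
have e3 : (\sum_g #|St :&: (H :^ g^-1)%g| = #|St| * #|H| * #|Y H|)%N.
  have cl g : (0 < #|[set t | eqv H g t]%SET|)%N by apply/card_gt0P; exists g; rewrite inE eqv_refl.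
  rewrite (partition_big (rep H) (mem (Y H))) /=; last by move=> g _; exact: rep_in.
  rewrite mulnC -sum_nat_const; apply: eq_bigr => y yY.
  have yy : rep H y = y by move: yY; rewrite inE => /eqP.
  rewrite (eq_bigr (fun=> #|St :&: (H :^ y^-1)%g|)); last first.
    move=> g /eqP e; apply/eqP; rewrite -(eqn_pmul2l (cl g)) card_class.
    rewrite (_ : [set t | eqv H g t]%SET = [set t | eqv H y t]%SET) ?card_class //.
    by apply/setP => t; rewrite !inE !rep_eq e yy.
  rewrite sum_nat_const -(card_class y); congr (_ * _)%N; apply: eq_card => g.
  by rewrite !inE rep_eq yy eq_sym.
rewrite e1; apply/eqP; rewrite -(eqn_pmul2l (cardG_gt0 H)) -e2 e3.
by apply/eqP; ring.
Qed.
Lemma perm_char_fixn s : perm_char R H s = (fixn s)%:R.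
Proof.
rewrite /perm_char /cind; pose F g : nat := (g^-1 * s * g \in H)%g.
have -> : \sum_(y : gT | (y^-1 * s * y)%g \in H) (1 : R) = (\sum_g F g)%N%:R.
  by rewrite natr_sum big_mkcond; apply: eq_bigr => g _; rewrite /F; case: ifP.
rewrite sum_coset => [|g h hH]; last first.
  rewrite /F; congr nat_of_bool.
  have -> : ((g * h)^-1 * s * (g * h) = (g^-1 * s * g) ^ h)%g by rewrite conjgE invMg !mulgA.
  by rewrite groupJr.
rewrite natrM mulKf ?pnatr_eq0 -?lt0n ?cardG_gt0 //; congr (_%:R).
by rewrite /fixn -sum1_card [RHS]big_mkcond; apply: eq_bigr => k _; rewrite inE /F; case: ifP.
Qed.
(** Frobenius reciprocity. Conjugation by [y] moves each summand of the induced function into [St]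
    without changing [perm_char], so all [y] contribute equally. *)
Lemma cdot_ind (ph : gT -> R) : cdot (cind St ph) (perm_char R H) =
  #|St|%:R^-1 * \sum_(s in St) ph s * (fixn s)%:R.
Proof.
rewrite /cdot /cind; under eq_bigr => g _ do rewrite -mulrA mulr_suml big_mkcond.
rewrite -mulr_sumr mulrCA; congr (_ * _).
rewrite exchange_big /= (eq_bigr (fun=> \sum_(s in St) ph s * (fixn s)%:R)); last first.
  move=> y _; rewrite (reindex_inj (conjg_inj y^-1%g)) /= [RHS]big_mkcond; apply: eq_bigr => s _.
  have -> : (y^-1 * s ^ y^-1 * y)%g = s by rewrite conjgE invgK !mulgA mulVg mul1g mulgKV.
  case: ifP => // _; rewrite -perm_char_fixn; congr (_ * _).
  rewrite /perm_char /cind; congr (_ * _); rewrite (reindex_inj (mulgI y)) /=.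
  apply: eq_bigl => z.
  by rewrite conjgE invMg invgK !mulgA mulgKV mulgKV.
by rewrite sumr_const cardT -cardE -[X in _ * X]mulr_natl mulKf // pnatr_eq0 -lt0n; apply/card_gt0P; exists 1%g.
Qed.

Lemma vprod_ln (I : finType) (P : pred I) (F : I -> val2 R) :
  (forall i, P i -> F i != None /\ vpos (F i)) ->
  let v := \big[@vmul R/vone R]_(i | P i) F i in
  [/\ v != None, vpos v, ln (vflat v) = \sum_(i | P i) ln (vflat (F i))
    & vnat v = \sum_(i | P i) vnat (F i)].
Proof.
move=> h v; rewrite /v; elim/big_rec3: _ => [|i l m u Pi [h1 h2 <- <-]].
  by split=> //; [exact: ltr01|exact: ln1].
have [n1 p1] := h i Pi; case: (F i) n1 p1 => [[p q]|] // _ p0.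
case: u h1 h2 => [[p' q']|] // _ p0'; split=> //=; first by rewrite /= mulr_gt0.
by rewrite lnM.
Qed.
Lemma ix_val s : s \in St -> s != 1%g -> ix s != None /\ vpos (ix s).
Proof.
move=> sS s1; have [al [al1 al2 [t tC hthe]]] := theta_ex [1 gT]%G.
rewrite (ram_St hactE hix 1%g al1 hthe sS); split; last exact: (w_pos hN hw).
rewrite (w_eqn hw) subr_eq0; apply: contra s1 => /eqP/(gen_inj (theta_generates al1 al2 tC hthe)).
by rewrite mulg1 => ->.
Qed.
Let cond s (k : 'I_(deg H)) := ((crep k)^-1 * s * crep k)%g \notin H.
Lemma sum_cond (g : gT -> R) : \sum_(k < deg H) \sum_(s in St | cond s k) g s =
  \sum_(s in St) ((deg H)%:R - (fixn s)%:R) * g s.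
Proof.
rewrite (exchange_big_dep (mem St)) /=; last by move=> k s _ /andP[].
apply: eq_bigr => s sS; rewrite (eq_bigl (fun k => k \notin [set k | ~~ cond s k]%SET)); last first.
  by move=> k; rewrite sS inE negbK.
rewrite sumr_const -[X in X = _]mulr_natl; congr (_ * _).
have := cardC [set k | ~~ cond s k]%SET; rewrite card_ord => e; rewrite -[X in _ = X%:R - _]e.
rewrite natrD (_ : fixn s = #|[set k | ~~ cond s k]%SET|); last first.
  by apply: eq_card => k; rewrite !inE negbK.
by rewrite addrAC subrr add0r.
Qed.
Lemma cond_not1 s k : cond s k -> s != 1%g.
Proof. by apply: contraNneq => ->; rewrite mulg1 mulVg group1. Qed.
(** In [disc_formula] the factor [ix s] occurs once for every coset moved by [s], hence
    [deg - fixn s] times. *)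
Lemma Delta_conductor : ln (Dp H) = \sum_(s in St) ((deg H)%:R - (fixn s)%:R) * ln (vflat (ix s)) /\
  (Dm H)%:~R = \sum_(s in St) ((deg H)%:R - (fixn s)%:R) * ratr (vnat (ix s)) :> R.
Proof.
have e : w (aE (Delta H)) = \big[@vmul R/vone R]_k \big[@vmul R/vone R]_(s in St | cond s k) ix s.
  by rewrite aE_Delta (wX hw) (disc_formula hactE hix).
have hk (k : 'I_(deg H)) := vprod_ln (P := fun s => (s \in St) && cond s k) (F := ix)
  (fun s h => ix_val (proj1 (andP h)) (cond_not1 (proj2 (andP h)))).
have [|_ _ h3 h4] := vprod_ln (P := xpredT) (F := fun k => \big[@vmul R/vone R]_(s in St | cond s k) ix s).
  by move=> k _; have [] := hk k.
rewrite DeltaE in e; rewrite -e /= in h3 h4; split.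
  rewrite h3 -sum_cond; apply: eq_bigr => k _; by have [_ _ -> _] := hk k.
rewrite -(ratr_int R) h4 rmorph_sum -sum_cond; apply: eq_bigr => k _ /=.
by have [_ _ _ ->] := hk k; rewrite rmorph_sum.
Qed.
Lemma fixn1 : fixn 1%g = deg H.
Proof.
rewrite /fixn -[RHS]card_ord; apply: eq_card => k.
by rewrite !inE mulg1 mulVg group1.
Qed.
(** The value at 1 is the sum of all the [ell s] and is weighted by [fixn 1 = deg]; it turns each
    weight [- fixn s] into [deg - fixn s]. *)
Lemma conductor_sum (ell f : gT -> R) : f 1%g = \sum_(s in St | s != 1%g) ell s ->
  (forall s, s \in St -> s != 1%g -> f s = - ell s) ->
  \sum_(s in St) f s * (fixn s)%:R = \sum_(s in St) ((deg H)%:R - (fixn s)%:R) * ell s.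
Proof.
move=> f1 fs; have S1 : 1%g \in St := group1 StG.
rewrite (bigD1 1%g) //= [RHS](bigD1 1%g) //= fixn1 subrr mul0r add0r f1 mulr_suml -big_split /=.
by apply: eq_bigr => s /andP[sS s1]; rewrite fs //; ring.
Qed.
Lemma a_x1 : [/\ ln (vflat (a_x act x ix 1%g)) = \sum_(s in St | s != 1%g) ln (vflat (ix s)) &
  vnat (a_x act x ix 1%g) = \sum_(s in St | s != 1%g) vnat (ix s)].
Proof.
rewrite /a_x eqxx; have [|_ _ -> ->] := vprod_ln (P := fun s => (s \in St) && (s != 1%g)) (F := ix).
  by move=> s /andP[]; exact: ix_val.
by [].
Qed.
Lemma card_St_neq0 : #|St|%:R != 0 :> R.
Proof. by rewrite pnatr_eq0 -lt0n (cardG_gt0 StG). Qed.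
Lemma a_flat_cdot : cdot (a_flat_G act x ix) (perm_char R H) = - ln (Dp H).
Proof.
rewrite cdot_ind (Delta_conductor).1 -(conductor_sum (f := fun s => ln (vflat (a_x act x ix s)))).
- rewrite mulr_sumr -sumrN; apply: eq_bigr => s _.
  by rewrite /a_flat_x mulNr -mulrA mulrN mulKf ?card_St_neq0.
- by case: a_x1.
- move=> s sS s1; have := ix_val sS s1; rewrite /a_x (negPf s1).
  by case: (ix s) => [[p q]|] [] //= _ p0; rewrite lnV.
Qed.
(** The correction [reg - 1] pairs to [deg - #|Y H|] by [sum_fixn]; in the discriminant the same
    number comes from the rescaling constants. *)
Lemma sw_nat_cdot : cdot (sw_nat_G act x ix) (perm_char R H) =
  (Dm H - ((deg H)%:Z - #|Y H|%:Z))%:~R.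
Proof.
rewrite cdot_ind 2!rmorphB /= (Delta_conductor).2 -(conductor_sum (f := fun s => ratr (vnat (a_x act x ix s)))); first last.
- move=> s sS s1; have := ix_val sS s1; rewrite /a_x (negPf s1).
  by case: (ix s) => [[p q]|] [] //= _ p0; rewrite rmorphN.
- by case: a_x1 => _ ->; rewrite rmorph_sum.
rewrite /sw_nat_x; under eq_bigr do rewrite mulrBl.
rewrite sumrB mulrBr; congr (_ - _).
  by rewrite mulr_sumr; apply: eq_bigr => s _; rewrite /a_nat_x -mulrA mulKf ?card_St_neq0.
under eq_bigr do rewrite mulrBl mul1r.
rewrite sumrB -natr_sum sum_fixn natrM mulrBr mulKf ?card_St_neq0 //; congr (_ - _).
rewrite (bigD1 1%g) /=; last exact: (group1 StG).
rewrite /reg_char eqxx fixn1 big1 ?addr0 ?mulKf ?card_St_neq0 // => s /andP[_ /negPf ->].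
by rewrite mul0r.
Qed.
End Conductor.

(** * Value and right derivative of the discriminant function *)

Lemma piecewise_right (u v tau : R) (delta : R -> R) : piecewise_linear u v delta -> u <= tau < v ->
  exists m c e : R, 0 < e /\ forall h, 0 <= h <= e -> delta (tau + h) = m * (tau + h) + c.
Proof.
move=> [ss [pth lst hs]] /andP[ut tv].
elim: ss u pth lst hs ut => [|y ss IH] u /=.
  by move=> _ -> _; rewrite leNgt tv.
move=> /andP[uy pth] lst hs ut; have [ty|yt] := ltP tau y.
  have [m [c hmc]] := hs 0%N isT; exists m, c, (y - tau); split=> [|h /andP[h0 h1]]; first by rewrite subr_gt0.
  by apply: hmc => /=; apply/andP; split; [lra|rewrite addrC -lerBrDr].
apply: (IH y) => // i hi.
have [m [c hmc]] := hs i.+1 hi; exists m, c => t ht'.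
have e1 : nth y (y :: ss) i = nth u (y :: ss) i by apply: set_nth_default => /=; exact: ltnW.
have e2 : nth y (y :: ss) i.+1 = nth u (y :: ss) i.+1 by apply: set_nth_default.
by apply: hmc; rewrite e1 e2 in ht'.
Qed.
(** Roots of high order of a constant [y] with [|y| < 1] have absolute values close to 1: if
    [q ^ (n + 1) < |y|], a root of order [n + 1] exceeds [q]. *)
Lemma near1_witness (P : R -> Prop) (t0 : R) : t0 < 1 -> near1 P ->
  exists sigma : K, t0 < absK sigma < 1 /\ P (absK sigma).
Proof.
move=> t01 [t1 /andP[t10 t11] hP]; pose q := Num.max t0 t1.
have q0 : 0 <= q by rewrite le_max t10 orbT.
have q1 : q < 1 by rewrite gt_max t01.
have [y y0 y1] := small_ex (ltr01 : (0 : R) < 1).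
have : (fun n => q ^+ n) @ \oo --> (0 : R) by apply: cvg_expr; rewrite ger0_norm.
move=> /cvg0P/(_ _ (nabs_gt0 hN y0))[n /(_ n.+1 (leqnSn n))].
rewrite ger0_norm ?exprn_ge0 // => hn.
have [sigma hs] := closed_root y (isT : 0 < n.+1)%N; exists sigma.
have e : absK sigma ^+ n.+1 = absK y by rewrite -(nabsX hN) hs.
have hq : q < absK sigma.
  rewrite ltNge; apply/negP => h; move: hn; rewrite -e ltNge => /negP; apply.
  by rewrite lerXn2r ?nnegrE ?(abs_ge0 hN).
have h1 : absK sigma < 1.
  rewrite ltNge; apply/negP => h; move: y1; rewrite -e ltNge => /negP; apply.
  exact: exprn_ege1.
rewrite h1 (le_lt_trans _ hq) ?le_max ?lexx //; split=> //; apply: hP => //.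
by apply: le_lt_trans hq; rewrite le_max lexx orbT.
Qed.
Lemma near1_ln (e : R) : 0 < e -> near1 (fun s : R => - ln s <= e).
Proof.
move=> e0; exists (expR (- e)); first by rewrite expR_ge0 expR_lt1 oppr_lt0.
move=> s h s1; have s0 : 0 < s by apply: lt_trans (expR_gt0 _) h.
by rewrite lerNl -ler_expR lnK ?posrE // ltW.
Qed.
Lemma disc_function_right (H : {group gT}) delta :
  is_discriminant_function absK a b coef (fixring act H) delta ->
  delta (- ln r) = - ln (Dp H) /\
  has_right_derivative delta (- ln r) (Dm H - ((deg H)%:Z - #|Y H|%:Z))%:~R.
Proof.
move=> [pl hd]; set al := - ln (Dp H); set be := _%:~R.
have a0 : 0 < a := ann_a0; have b0 : 0 < b := ann_b0; have r0 := r_gt0.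
have [|m [c [e [e0 he]]]] := @piecewise_right _ _ (- ln r) _ pl.
  by rewrite !lnV ?posrE // lerN2 ltrN2 ler_ln ?posrE // ltr_ln ?posrE // hrb har.
have key := near1_and (near1_and (near1_pow den_gt0 near1_ge) (near1_pow den_gt0 (near1_ln e0))) (log_disc_near H).
have val (sigma : K) : 0 < absK sigma -> absK sigma < 1 ->
   (a <= absK sigma ^+ ord_den * r <= b /\ - ln (absK sigma ^+ ord_den) <= e) /\
   (forall sg : K, absK sg = absK sigma -> forall v, is_log_discriminant absK a b coef (fixring act H)
     (absK sigma ^+ ord_den * r) v -> v = al - be * ln (absK sigma ^+ ord_den)) ->
   let h := - ln (absK sigma ^+ ord_den) in m * (- ln r + h) + c = al + be * h.
  move=> s0 s1 [[hab' hle] hv] h.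
  have t0 : 0 < absK sigma ^+ ord_den by rewrite exprn_gt0.
  have h0 : 0 <= h by rewrite oppr_ge0 ln_le0 // exprn_ile1 // ltW.
  rewrite -he ?h0 //.
  have -> : - ln r + h = - ln (absK sigma ^+ ord_den * r) by rewrite lnM ?posrE // opprD addrC.
  rewrite (hv sigma erefl _ (hd _ _ hab')) ?/h; last first.
    have [rho rho0 hrho] := hr; exists (sigma ^+ ord_den * rho).
      rewrite /= mulf_neq0 // expf_neq0 //; apply: contraTneq s0 => ->.
      by rewrite (abs_zero hN) ltxx.
    by rewrite (abs_mul hN) (nabsX hN) hrho.
  by rewrite mulrN.
(* Smaller radii lie to the right of [- ln r], where [delta] is affine; its values at two of them
   fix slope and intercept. *)
have [s1 [/andP[s10 s11] /(val _ s10 s11) e1]] := near1_witness (ltr01 : (0 : R) < 1) key.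
have [s2 [/andP[s21 s22] hs2]] := near1_witness s11 key.
have s20 := lt_trans s10 s21; have /= e2 := val _ s20 s22 hs2.
rewrite /= in e1; set h1 := - ln (absK s1 ^+ ord_den) in e1; set h2 := - ln (absK s2 ^+ ord_den) in e2.
have h12 : h2 < h1.
  rewrite ltrN2 ltr_ln ?posrE ?exprn_gt0 // ltrXn2r ?nnegrE ?(ltW s10) ?(ltW s20) //.
  by rewrite gtn_eqF // den_gt0.
have mb : m = be.
  apply/eqP; rewrite -subr_eq0; apply/eqP.
  have : (m - be) * (h1 - h2) = 0.
    transitivity ((m * (- ln r + h1) + c - (al + be * h1)) - (m * (- ln r + h2) + c - (al + be * h2))).
      by ring.
    by rewrite e1 e2 !subrr.
  by move/eqP; rewrite mulf_eq0 [X in _ || X]subr_eq0 [h1 == h2]gt_eqF ?orbF // => /eqP.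
(* The affine piece contains its left end [h = 0], which is where continuity of [delta] enters. *)
have d0 : delta (- ln r) = al.
  have := he 0; rewrite addr0 lexx (ltW e0) => /(_ isT) ->.
  by move: e1; rewrite mb mulrDr; clear; lra.
split=> //; apply/cvgrPdist_lt => ep ep0; near=> h.
have h0 : 0 < h by near: h; exact: nbhs_right_gt.
have hle : h <= e by near: h; exact: nbhs_right_le.
rewrite he ?(ltW h0) // d0.
have -> : (m * (- ln r + h) + c - al) / h = be.
  have -> : m * (- ln r + h) + c - al = be * h.
    have := he 0; rewrite addr0 lexx (ltW e0) => /(_ isT); rewrite d0 mb mulrDr; clear; lra.
  by rewrite mulfK // gt_eqF.
by rewrite subrr normr0.
Unshelve. all: by end_near.
Qed.
End Annulus.

Theorem lemma3p3p10 (R : realType) (K : closedFieldType) (absK : K -> R)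
  (hK : is_complete_rank1 absK)
  (a b : R) (ha : value_group absK a) (hb : value_group absK b) (hab : a < b)
  (A : comAlgType K) (coef : A -> int -> K)
  (hA : is_annulus_algebra absK a b coef)
  (B : comAlgType A) (gT : finGroupType) (act : gT -> {lrmorphism B -> B})
  (hB : is_galois_cover act)
  (H : {group gT}) (delta : R -> R)
  (hdelta : is_discriminant_function absK a b coef (fixring act H) delta)
  (r : R) (hr : value_group absK r) (har : a < r) (hrb : r <= b)
  (x : B -> val2 R) (hx : is_point_over absK coef r x)
  (E : fieldType) (w : E -> val2 R) (iota : {rmorphism B -> E})
  (hE : is_completed_henselization absK x w iota)
  (actE : gT -> {rmorphism E -> E})
  (hactE : is_stabilizer_action act x w iota actE)
  (ix : gT -> val2 R) (hix : is_ramification_function act x w actE ix) :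
  delta (- ln r) = cdot (a_flat_G act x ix) (perm_char R H) /\
  has_right_derivative delta (- ln r)
    (cdot (sw_nat_G act x ix) (perm_char R H)).
Proof.
have [F [v [i [j [hF hj ij]]]]] := hE.
have hw := hens_val hj.
have ex : x = (fun c => w (iota c)).
  by apply/funext => c; rewrite ij (hens_ext hj) (crf_ext hF).
have hiota f : w (iota f%:A) = Defs.eta absK coef r f.
  by rewrite -[w _]/((fun c => w (iota c)) f%:A) -ex; case: hx.
rewrite ex in hactE hix *.
have [d1 d2] := disc_function_right hK ha hb hab hA hr har hrb hB hw hiota hdelta.
rewrite (a_flat_cdot hK ha hb hab hA hr har hrb hB hw hiota hactE hix).
by rewrite (sw_nat_cdot hK ha hb hab hA hr har hrb hB hw hiota hactE hix).
Qed.
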